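(* Let $X$ be a smooth complex projective variety of complex dimension $m$ and $n\ge1$. a) For every type $(L_*,H_* )$ the $\mathcal{S}_n$-representation $E_*^*(L_*,H_* )$ has character $$\chi_{E_*^*(L_*,H_* )}=\mathrm{Ind}_{Z_{(L_*,H_* )}}^{\mathcal{S}_n}(\xi_{(L_*,H_* )}).$$ b) The $\mathcal{S}_n$-representation $E_q^k(X,n)$ has character $$\chi_{E_q^k(X,n)}=\sum_{\substack{|L_*|=q\\ |H_*|+q(2m-1)=k}}\mathrm{Ind}_{Z_{(L_*,H_* )}}^{\mathcal{S}_n}(\xi_{(L_*,H_* )}).$$ c) The $\mathcal{S}_n$-representation on the Kriz algebra $E_*^*(X,n)$ has character $$\chi_{E_*^*(X,n)}=\sum_{(L_*,H_* )}\mathrm{Ind}_{Z_{(L_*,H_* )}}^{\mathcal{S}_n}(\xi_{(L_*,H_* )}).$$ The sums run over types $(L_*,H_* )$.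
   Context: $X$ is connected of complex dimension $m\ge1$, $H^*(X)=H^*(X;\mathbb{Q})$, and $\mathcal{B}=\{x_1=1\prec\dots\prec x_B=w\}$ is a fixed homogeneous ordered basis of $H^*(X)$ with nondecreasing degrees, $w\in H^{2m}(X)$ the fundamental class; $|x_h|=\deg x_h$. $p_i^*:H^*(X)\to H^*(X^n)$ is the pullback along the $i$-th projection. As a bigraded algebra, the Kriz model $E(X,n)=E_*^*(X,n)$ is the graded-commutative algebra obtained from the exterior algebra with generators $G_{ij}$ ($1\le i\neq j\le n$) of degree $2m-1$ and coefficients in $H^*(X)^{\otimes n}$, modulo $G_{ji}=G_{ij}$; $p_j^*(x)G_{ij}=p_i^*(x)G_{ij}$ ($i<j$, $x\in H^*(X)$); $G_{ik}G_{jk}=G_{ij}G_{jk}-G_{ij}G_{ik}$ ($i<j<k$). $E_q^k(X,n)$ is the part with $q$ exterior generators and total degree $k$. $\mathcal{S}_n$ acts by algebra automorphisms with $\sigma(p_i^*(x))=p_{\sigma(i)}^*(x)$, $\sigma(G_{ij})=G_{\sigma(i)\sigma(j)}$. Types. The canonical basis of $E(X,n)$ consists of the monomials $p_1^*(x_{a_1})\cdots p_n^*(x_{a_n})G_{i_1j_1}\cdots G_{i_qj_q}$ with $x_{a_l}\in\mathcal{B}$, $i_l<j_l$, $j_1<\dots<j_q$, and $x_{a_l}=1$ for $l\in\{j_1,\dots,j_q\}$. The marked graph of such a monomial has vertices $1,\dots,n$ and edges $\{i_l,j_l\}$ (a forest); the mark of a component with smallest vertex $i$ is $x_{a_i}$.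 A type $(L_*,H_* )$ is a partition $L_*=(\lambda_1\ge\dots\ge\lambda_t\ge1)$ of $n$ with $H_*=(h_1,\dots,h_t)$, $x_{h_i}\in\mathcal{B}$, such that $x_{h_i}\succeq x_{h_{i+1}}$ whenever $\lambda_i=\lambda_{i+1}$. $E_*^*(L_*,H_* )$ is the linear span of the canonical basis monomials whose marked graph has $t$ components which can be numbered so that the $i$-th has $\lambda_i$ vertices and mark $x_{h_i}$. $|L_*|=\sum_i(\lambda_i-1)$, $|H_*|=\sum_i\deg(x_{h_i})$. Groups and characters. Put $L_0=0$, $L_i=\lambda_1+\dots+\lambda_i$. Let $c_{\lambda_i}=(L_{i-1}+1,L_{i-1}+2,\dots,L_i)$ (a cycle in $\mathcal{S}_n$) and $C_{L_*}=\langle c_{\lambda_1}\rangle\times\dots\times\langle c_{\lambda_t}\rangle$. For each $i$ with $\lambda_i=\lambda_{i+1}$ and $h_i=h_{i+1}$ let $v_i=(L_{i-1}+1,L_i+1)(L_{i-1}+2,L_i+2)\cdots(L_i,L_{i+1})$; $N_{(L_*,H_* )}$ is the subgroup generated by these $v_i$, and $Z_{(L_*,H_* )}=C_{L_*}\rtimes N_{(L_*,H_* )}\subset\mathcal{S}_n$. Let $\varepsilon_n$ be the sign character of $\mathcal{S}_n$ and $\varphi_{\lambda_i}$ the character of $\langle c_{\lambda_i}\rangle$ with $\varphi_{\lambda_i}(c_{\lambda_i})=e^{2\pi\sqrt{-1}/\lambda_i}$. Define characters $$\varphi_{L_*}=(\varphi_{\lambda_1}\otimes\dots\otimes\varphi_{\lambda_t})\cdot\varepsilon_n|_{C_{L_*}}:C_{L_*}\to\mathbb{C}^*,\qquad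 \alpha_{(L_*,H_* )}:N_{(L_*,H_* )}\to\mathbb{C}^*,\quad \alpha_{(L_*,H_* )}(v_i)=\begin{cases}(-1)^{\lambda_i+1}&|x_{h_i}|\text{ even}\\(-1)^{\lambda_i}&|x_{h_i}|\text{ odd}\end{cases}$$ and $\xi_{(L_*,H_* )}=\varphi_{L_*}\cdot\alpha_{(L_*,H_* )}:Z_{(L_*,H_* )}\to\mathbb{C}^*$, i.e. $\xi_{(L_*,H_* )}(cv)=\varphi_{L_*}(c)\,\alpha_{(L_*,H_* )}(v)$ for $c\in C_{L_*}$, $v\in N_{(L_*,H_* )}$. *)

(* Defs.v *)
From HB Require Import structures.
From mathcomp Require Import all_boot all_order all_algebra all_fingroup.
From mathcomp Require Import all_field all_character.
From mathcomp Require Import ring_quotient boolp monalg.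

Set Implicit Arguments.
Unset Strict Implicit.
Unset Printing Implicit Defensive.

Import GRing.Theory Num.Theory.
Local Open Scope ring_scope.

(* H with its grading plays the role of the ring H^*(X; Q) of a connected
   smooth projective variety X of complex dimension m.                       *)
Record connected_PD_algebra (m : nat) (H : falgType rat)
    (gr : nat -> {vspace H}) : Prop := {
  gr_direct : directv (\sum_(k < (2 * m).+1) gr k)%VS;
  gr_full : (\sum_(k < (2 * m).+1) gr k)%VS = fullv;
  gr_vanish : forall k, (2 * m < k)%N -> gr k = 0%VS;
  gr_mul : forall k l y z, y \in gr k -> z \in gr l -> y * z \in gr (k + l)%N;
  gr_comm : forall k l y z, y \in gr k -> z \in gr l ->
    z * y = (-1) ^+ (k * l)%N * (y * z);
  gr_connected : gr 0%N = <[1]>%VS;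
  gr_top : \dim (gr (2 * m)%N) = 1%N;
  gr_duality : forall k y, (k <= 2 * m)%N -> y \in gr k ->
    (forall z, z \in gr (2 * m - k)%N -> y * z = 0) -> y = 0
}.

(* The basis {x_1 = 1 < ... < x_B = w} is x ord0, ..., x ord_max (B = b.+1),
   ordered by index, and deg h = |x_h|.                                      *)
Record homogeneous_basis (m b : nat) (H : falgType rat)
    (gr : nat -> {vspace H}) (w : H) (x : 'I_b.+1 -> H)
    (deg : 'I_b.+1 -> nat) : Prop := {
  hb_basis : basis_of fullv [tuple x h | h < b.+1];
  hb_homog : forall h, x h \in gr (deg h);
  hb_deg : forall h h' : 'I_b.+1, (h <= h')%N -> (deg h <= deg h')%N;
  hb_first : x ord0 = 1;
  hb_last : x ord_max = w;
  hb_fund : w \in gr (2 * m)%N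
}.

Lemma rat_scalerAr (A : lalgType rat) a (u v : A) : a *: (u * v) = u * (a *: v).
Proof.
have d0 : (denq a)%:~R != 0 :> rat by rewrite intr_eq0 denq_neq0.
apply: (can_inj (scalerK d0)).
have -> : (denq a)%:~R *: (u * (a *: v)) = u * ((denq a)%:~R *: (a *: v)).
  by rewrite !scaler_int mulrzAr.
by rewrite !scalerA mulrC -numqE !scaler_int mulrzAr.
Qed.

(* The free associative algebra over rat on the set I.  Here and
   below, HB.lock only keeps unification from unfolding the construction.      *)
Definition freealg (I : choiceType) := {malg rat[{fmonom I}]}.
HB.instance Definition _ (I : choiceType) := GRing.Zmodule.on (freealg I).

HB.lock Definition freealg_one (I : choiceType) : freealg I :=
  (1 : {malg rat[{fmonom I}]}).
HB.lock Definition freealg_mul (I : choiceType) (u v : freealg I) : freealg I :=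
  (u : {malg rat[{fmonom I}]}) * (v : {malg rat[{fmonom I}]}).
HB.lock Definition freealg_scale (I : choiceType) (a : rat) (u : freealg I) :
    freealg I :=
  a *: (u : {malg rat[{fmonom I}]}).
HB.lock Definition freealg_var (I : choiceType) (i : I) : freealg I :=
  << fmu i >>.

Section FreeAlgebra.

Variable I : choiceType.
Implicit Types u v w : freealg I.

Fact freealg_mulA : associative (@freealg_mul I).
Proof. by move=> u v w; rewrite freealg_mul.unlock mulrA. Qed.
Fact freealg_mul1r : left_id (freealg_one I) (@freealg_mul I).
Proof. by move=> u; rewrite freealg_mul.unlock freealg_one.unlock mul1r. Qed.
Fact freealg_mulr1 : right_id (freealg_one I) (@freealg_mul I).
Proof. by move=> u; rewrite freealg_mul.unlock freealg_one.unlock mulr1. Qed.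
Fact freealg_mulDl : left_distributive (@freealg_mul I) +%R.
Proof. by move=> u v w; rewrite freealg_mul.unlock; apply: mulrDl. Qed.
Fact freealg_mulDr : right_distributive (@freealg_mul I) +%R.
Proof. by move=> u v w; rewrite freealg_mul.unlock; apply: mulrDr. Qed.
Fact freealg_1neq0 : freealg_one I != 0.
Proof. by rewrite freealg_one.unlock; apply: oner_neq0. Qed.
HB.instance Definition _ :=
  GRing.Zmodule_isNzRing.Build (freealg I) freealg_mulA freealg_mul1r
    freealg_mulr1 freealg_mulDl freealg_mulDr freealg_1neq0.

Fact freealg_scaleA a c u :
  freealg_scale a (freealg_scale c u) = freealg_scale (a * c) u.
Proof. by rewrite freealg_scale.unlock; apply: scalerA. Qed.
Fact freealg_scale1 : left_id 1 (@freealg_scale I).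
Proof. by move=> u; rewrite freealg_scale.unlock; apply: scale1r. Qed.
Fact freealg_scaleDr : right_distributive (@freealg_scale I) +%R.
Proof. by move=> a u v; rewrite freealg_scale.unlock; apply: scalerDr. Qed.
Fact freealg_scaleDl u : {morph (@freealg_scale I)^~ u : a c / a + c}.
Proof. by move=> a c; rewrite freealg_scale.unlock; apply: scalerDl. Qed.
HB.instance Definition _ :=
  GRing.Zmodule_isLmodule.Build rat (freealg I) freealg_scaleA freealg_scale1
    freealg_scaleDr freealg_scaleDl.

Fact freealg_scaleAl a u v : a *: (u * v) = (a *: u) * v.
Proof.
rewrite [LHS](_ : _ = freealg_scale a (freealg_mul u v)) //.
rewrite [RHS](_ : _ = freealg_mul (freealg_scale a u) v) //.
by rewrite freealg_mul.unlock freealg_scale.unlock; apply: scalerAl.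
Qed.
HB.instance Definition _ :=
  GRing.Lmodule_isLalgebra.Build rat (freealg I) freealg_scaleAl.
HB.instance Definition _ :=
  GRing.Lalgebra_isAlgebra.Build rat (freealg I) (@rat_scalerAr _).

Variables (A : algType rat) (h : I -> A).

Definition freealg_word (w : {fmonom I}) : A := \prod_(i <- w) h i.

Lemma freealg_word_mmorphism : mmorphism freealg_word.
Proof.
by split=> [u v|]; rewrite /freealg_word ?fm1 ?big_nil // fmM big_cat.
Qed.
HB.instance Definition _ :=
  isMultiplicative.Build {fmonom I} A freealg_word freealg_word_mmorphism.

End FreeAlgebra.

(* The algebra morphism with freealg_var i |-> h i. *)
HB.lock Definition freealg_map (I : choiceType) (A : algType rat) (h : I -> A)
    (u : freealg I) : A :=
  mmap (in_alg A) (freealg_word h) u.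

Section FreeAlgebraMap.

Variables (I : choiceType) (A : algType rat) (h : I -> A).

Fact freealg_map_is_zmod_morphism :
  {morph freealg_map h : u v / u - v}.
Proof. by move=> u v; rewrite freealg_map.unlock; apply: raddfB. Qed.
HB.instance Definition _ :=
  GRing.isZmodMorphism.Build (freealg I) A (freealg_map h)
    freealg_map_is_zmod_morphism.

Fact freealg_map_is_monoid_morphism : monoid_morphism (freealg_map h).
Proof.
have [M O] : multiplicative (mmap (in_alg A) (freealg_word h)).
  apply: commr_mmap_is_multiplicative => u w w'; rewrite /GRing.comm /=.
  by rewrite -scalerAl mul1r -scalerAr mulr1.
split=> [|u v]; rewrite freealg_map.unlock.
  by rewrite -[RHS]O -[X in mmap _ _ X]/(freealg_one I) freealg_one.unlock.
by rewrite -[RHS]M -[X in mmap _ _ X]/(freealg_mul u v) freealg_mul.unlock.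
Qed.
HB.instance Definition _ :=
  GRing.isMonoidMorphism.Build (freealg I) A (freealg_map h)
    freealg_map_is_monoid_morphism.

Fact freealg_map_is_scalable : scalable (freealg_map h).
Proof.
move=> a u; rewrite freealg_map.unlock.
rewrite -[X in mmap _ _ X]/(freealg_scale a u) freealg_scale.unlock.
by rewrite [LHS]mmapZ /= -scalerAl mul1r.
Qed.
HB.instance Definition _ :=
  GRing.isScalable.Build rat (freealg I) A *:%R (freealg_map h)
    freealg_map_is_scalable.

Lemma freealg_mapZ a u : freealg_map h (a *: u) = a *: freealg_map h u.
Proof. exact: freealg_map_is_scalable. Qed.

Lemma freealg_map_var i : freealg_map h (freealg_var i) = h i.
Proof.
rewrite freealg_map.unlock freealg_var.unlock [LHS]mmapU /= scale1r mul1r.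
by rewrite /freealg_word fmU big_seq1.
Qed.

End FreeAlgebraMap.

(* The algebra presented by the generators I and the relations u = 0, u in R. *)
Section Ideal.

Variables (I : choiceType) (R : freealg I -> Prop).

Inductive gen_ideal : freealg I -> Prop :=
| gen_ideal_rel u : R u -> gen_ideal u
| gen_ideal0 : gen_ideal 0
| gen_idealD u v : gen_ideal u -> gen_ideal v -> gen_ideal (u + v)
| gen_idealMl u v : gen_ideal v -> gen_ideal (u * v)
| gen_idealMr u v : gen_ideal u -> gen_ideal (u * v).

Definition gen_idealb : {pred freealg I} := fun u => `[< gen_ideal u >].

Lemma gen_idealP u : reflect (gen_ideal u) (u \in gen_idealb).
Proof. exact: asboolP. Qed.

Fact gen_ideal_zmod_closed : zmod_closed gen_idealb.
Proof.
split=> [|u v /gen_idealP Iu /gen_idealP Iv]; apply/gen_idealP.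
  exact: gen_ideal0.
by rewrite -mulN1r; apply/gen_idealD/gen_idealMl.
Qed.
HB.instance Definition _ :=
  GRing.isZmodClosed.Build (freealg I) gen_idealb gen_ideal_zmod_closed.

Lemma gen_idealZ (c : rat) u : gen_ideal u -> gen_ideal (c *: u).
Proof. by move=> Iu; rewrite -[u]mul1r scalerAl; apply: gen_idealMl. Qed.

Definition palg := Quotient.quot gen_idealb.
HB.instance Definition _ := GRing.Zmodule.on palg.

End Ideal.

HB.lock Definition prepr (I : choiceType) (R : freealg I -> Prop)
    (e : palg R) : freealg I :=
  generic_quotient.repr e.
HB.lock Definition ppi (I : choiceType) (R : freealg I -> Prop)
    (u : freealg I) : palg R :=
  \pi_(Quotient.quot (gen_idealb R))%qT u.
HB.lock Definition palg_mul (I : choiceType) (R : freealg I -> Prop)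
    (e f : palg R) : palg R :=
  ppi R (prepr e * prepr f).
HB.lock Definition palg_scale (I : choiceType) (R : freealg I -> Prop)
    (a : rat) (e : palg R) : palg R :=
  ppi R (a *: prepr e).

Section PresentedAlgebra.

Variables (I : choiceType) (R : freealg I -> Prop).
Implicit Types (u v : freealg I) (e f g : palg R).

Lemma ppiP u v : ppi R u = ppi R v <-> gen_ideal R (u - v).
Proof.
rewrite ppi.unlock; split=> [uv|Iuv].
  by apply/gen_idealP; rewrite Quotient.idealrBE; apply/eqP.
by apply/eqP; rewrite -Quotient.idealrBE; apply/gen_idealP.
Qed.

Lemma ppi_repr e : ppi R (prepr e) = e.
Proof. by rewrite ppi.unlock prepr.unlock; apply: reprK. Qed.

Fact ppi_is_zmod_morphism : {morph ppi R : u v / u - v}.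
Proof. by move=> u v; rewrite ppi.unlock !piE. Qed.
HB.instance Definition _ :=
  GRing.isZmodMorphism.Build (freealg I) (palg R) (ppi R) ppi_is_zmod_morphism.

Lemma ppi_eq0 u : ppi R u = 0 <-> gen_ideal R u.
Proof. by rewrite -(raddf0 (ppi R)); have := ppiP u 0; rewrite subr0. Qed.

Fact ppi_mul u v : ppi R (u * v) = palg_mul (ppi R u) (ppi R v).
Proof.
have Irepr w : gen_ideal R (w - prepr (ppi R w)).
  by apply/ppiP; rewrite ppi_repr.
rewrite palg_mul.unlock; apply/ppiP; move: (Irepr u) (Irepr v).
set u' := prepr _; set v' := prepr _ => Iu Iv.
have -> : u * v - u' * v' = (u - u') * v + u' * (v - v').
  by rewrite mulrBl mulrBr addrA subrK.
by apply: gen_idealD; [apply: gen_idealMr | apply: gen_idealMl].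
Qed.

Fact ppi_scale a u : ppi R (a *: u) = palg_scale a (ppi R u).
Proof.
rewrite palg_scale.unlock; apply/ppiP; rewrite -scalerBr.
by apply/gen_idealZ/ppiP; rewrite ppi_repr.
Qed.

Fact palg_mulA : associative (@palg_mul I R).
Proof.
move=> e f g; rewrite -[e]ppi_repr -[f]ppi_repr -[g]ppi_repr.
by rewrite -!ppi_mul mulrA.
Qed.

Fact palg_mul1r : left_id (ppi R 1) (@palg_mul I R).
Proof. by move=> e; rewrite -[e]ppi_repr -ppi_mul mul1r. Qed.

Fact palg_mulr1 : right_id (ppi R 1) (@palg_mul I R).
Proof. by move=> e; rewrite -[e]ppi_repr -ppi_mul mulr1. Qed.

Fact palg_mulDl : left_distributive (@palg_mul I R) +%R.
Proof.
move=> e f g; rewrite -[e]ppi_repr -[f]ppi_repr -[g]ppi_repr.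
by rewrite -raddfD -!ppi_mul mulrDl raddfD.
Qed.

Fact palg_mulDr : right_distributive (@palg_mul I R) +%R.
Proof.
move=> e f g; rewrite -[e]ppi_repr -[f]ppi_repr -[g]ppi_repr.
by rewrite -raddfD -!ppi_mul mulrDr raddfD.
Qed.

HB.instance Definition _ :=
  GRing.Zmodule_isPzRing.Build (palg R) palg_mulA palg_mul1r palg_mulr1
    palg_mulDl palg_mulDr.

Fact palg_scaleA a c e : palg_scale a (palg_scale c e) = palg_scale (a * c) e.
Proof. by rewrite -[e]ppi_repr -!ppi_scale scalerA. Qed.

Fact palg_scale1 : left_id 1 (@palg_scale I R).
Proof. by move=> e; rewrite -[e]ppi_repr -ppi_scale scale1r. Qed.

Fact palg_scaleDr : right_distributive (@palg_scale I R) +%R.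
Proof.
move=> a e f; rewrite -[e]ppi_repr -[f]ppi_repr.
by rewrite -raddfD -!ppi_scale scalerDr raddfD.
Qed.

Fact palg_scaleDl e : {morph (@palg_scale I R)^~ e : a c / a + c}.
Proof. by move=> a c; rewrite -[e]ppi_repr -!ppi_scale scalerDl raddfD. Qed.

HB.instance Definition _ :=
  GRing.Zmodule_isLmodule.Build rat (palg R) palg_scaleA palg_scale1
    palg_scaleDr palg_scaleDl.

Fact ppi_is_monoid_morphism : monoid_morphism (ppi R).
Proof. by split; [|exact: ppi_mul]. Qed.
HB.instance Definition _ :=
  GRing.isMonoidMorphism.Build (freealg I) (palg R) (ppi R)
    ppi_is_monoid_morphism.

Lemma ppiZ a u : ppi R (a *: u) = a *: ppi R u.
Proof. exact: ppi_scale. Qed.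

Lemma palg_scalerAl a e f : a *: (e * f) = (a *: e) * f.
Proof.
rewrite -[e]ppi_repr -[f]ppi_repr -rmorphM -!ppiZ -rmorphM; congr (ppi R _).
exact: scalerAl.
Qed.

Lemma palg_scalerAr a e f : a *: (e * f) = e * (a *: f).
Proof.
rewrite -[e]ppi_repr -[f]ppi_repr -rmorphM -!ppiZ -rmorphM; congr (ppi R _).
exact: scalerAr.
Qed.

End PresentedAlgebra.

Section KrizModel.

Variables (m n : nat) (H : falgType rat) (gr : nat -> {vspace H}).

(* [inl (i, y)] stands for p_i^*(y) and [inr (i, j)] for G_ij. *)
Definition kgen : choiceType := ('I_n * H + 'I_n * 'I_n)%type.

Local Notation var := (@freealg_var kgen).
Local Notation P i y := (var (inl (i, y))).
Local Notation G i j := (var (inr (i, j))).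

Definition kgen_deg (g : kgen) (d : nat) : Prop :=
  match g with
  | inl (_, y) => y \in gr d
  | inr _ => d = (2 * m - 1)%N
  end.

(* H^{(x) n} is the graded-commutative algebra generated by n copies of H, with
   p_i^* the i-th coprojection, so [krel_lin], [krel_mul], [krel_one] and
   [krel_comm] present the exterior algebra on the G_ij over H^{(x) n}: the G_ij
   have odd degree, hence anticommute and square to 0.  [krel_diag] discards the
   symbols G_ii, which are not generators of the Kriz model.                  *)
Inductive krel : freealg kgen -> Prop :=
| krel_lin i (a : rat) y z : krel (P i (a *: y + z) - (a *: P i y + P i z))
| krel_mul i y z : krel (P i (y * z) - P i y * P i z)
| krel_one i : krel (P i 1 - 1)
| krel_comm g g' d d' : kgen_deg g d -> kgen_deg g' d' ->
    krel (var g' * var g - (-1) ^+ (d * d')%N *: (var g * var g'))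
| krel_diag i : krel (G i i)
| krel_sym i j : krel (G j i - G i j)
| krel_slide (i j : 'I_n) y : (i < j)%N ->
    krel (P j y * G i j - P i y * G i j)
| krel_arnold (i j k : 'I_n) : (i < j)%N -> (j < k)%N ->
    krel (G i k * G j k - (G i j * G j k - G i j * G i k)).

Definition kriz := palg krel.
HB.instance Definition _ := GRing.PzRing.on kriz.
HB.instance Definition _ := GRing.Lmodule.on kriz.

Definition kP (i : 'I_n) (y : H) : kriz := ppi krel (P i y).
Definition kG (i j : 'I_n) : kriz := ppi krel (G i j).

Definition kgen_act (s : 'S_n) (g : kgen) : kgen :=
  match g with
  | inl (i, y) => inl (s i, y)
  | inr (i, j) => inr (s i, s j)
  end.

Definition kfree_act (s : 'S_n) : freealg kgen -> freealg kgen :=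
  freealg_map (fun g => var (kgen_act s g)).

Definition kact (s : 'S_n) (e : kriz) : kriz :=
  ppi krel (kfree_act s (prepr e)).

Lemma ppi_krel (u v : freealg kgen) : krel (u - v) -> ppi krel u = ppi krel v.
Proof. by move=> r; apply/ppiP/gen_ideal_rel. Qed.

Fact kP_is_zmod_morphism i : {morph kP i : y z / y - z}.
Proof.
move=> y z; rewrite addrC -scaleN1r; rewrite /kP.
rewrite (ppi_krel (krel_lin i (-1) z y)) raddfD /= ppiZ scaleN1r addrC //.
Qed.
HB.instance Definition _ i :=
  GRing.isZmodMorphism.Build H kriz (kP i) (kP_is_zmod_morphism i).

Lemma kPZ i a y : kP i (a *: y) = a *: kP i y.
Proof.
have := ppi_krel (krel_lin i a y 0); rewrite raddfD /= ppiZ => e.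
by move: (e : kP i _ = a *: kP i y + kP i 0); rewrite raddf0 !addr0.
Qed.

Fact kP_is_monoid_morphism i : monoid_morphism (kP i).
Proof.
split=> [|y z]; rewrite /kP; first by rewrite (ppi_krel (krel_one i)) rmorph1.
by rewrite (ppi_krel (krel_mul i y z)) rmorphM.
Qed.
HB.instance Definition _ i :=
  GRing.isMonoidMorphism.Build H kriz (kP i) (kP_is_monoid_morphism i).

Lemma kgen_comm g g' d d' : kgen_deg g d -> kgen_deg g' d' ->
  ppi krel (var g') * ppi krel (var g) =
    (-1) ^+ (d * d')%N *: (ppi krel (var g) * ppi krel (var g')).
Proof.
move=> gd gd'.
by rewrite -rmorphM /= (ppi_krel (krel_comm gd gd')) ppiZ rmorphM.
Qed.

Lemma kGxx i : kG i i = 0.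
Proof. exact/ppi_eq0/gen_ideal_rel/krel_diag. Qed.

Lemma kG_sym i j : kG j i = kG i j.
Proof. exact/ppi_krel/krel_sym. Qed.

Lemma kP_kG i j y : kP j y * kG i j = kP i y * kG i j.
Proof.
have slide (k l : 'I_n) : (k < l)%N -> kP l y * kG k l = kP k y * kG k l.
  by move=> kl; have := ppi_krel (krel_slide y kl); rewrite !rmorphM.
case: (ltngtP i j) => [/slide // | /slide e | /val_inj -> //].
by rewrite -kG_sym e.
Qed.

Hypothesis m_gt0 : (0 < m)%N.

Lemma kG_anticomm i j k l : kG k l * kG i j = - (kG i j * kG k l).
Proof.
rewrite [LHS](@kgen_comm (inr (i, j)) (inr (k, l)) _ _ erefl erefl) -scaleN1r.
congr (_ *: _); rewrite -signr_odd oddM andbb oddB ?muln_gt0 //=.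
by rewrite mul2n odd_double.
Qed.

Lemma kG_arnold i j k : i != j -> j != k -> i != k ->
  kG i k * kG j k = kG i j * kG j k - kG i j * kG i k.
Proof.
pose arn (a b c : 'I_n) :=
  kG a b * kG b c + kG b c * kG c a + kG c a * kG a b.
have arnE a b c : kG a c * kG b c = kG a b * kG b c - kG a b * kG a c <->
    arn a b c = 0.
  rewrite /arn (kG_sym a c) (kG_anticomm a c b c) (kG_anticomm a b a c).
  rewrite addrAC; split=> [->|/eqP]; first by rewrite subrr.
  by rewrite subr_eq0 => /eqP.
have rot a b c : arn b c a = arn a b c by rewrite /arn addrC addrA.
have rev a b c : arn a b c = 0 -> arn c b a = 0.
  move=> e; apply: (can_inj opprK); rewrite oppr0 -e /arn !opprD.
  rewrite (kG_sym b c) (kG_sym a b) (kG_sym c a).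
  by rewrite -!kG_anticomm addrAC.
have lt (a b c : 'I_n) : (a < b)%N -> (b < c)%N -> arn a b c = 0.
  move=> ab bc; apply/arnE; have := ppi_krel (krel_arnold ab bc).
  by rewrite raddfB /= !rmorphM.
move=> ij jk ik; apply/arnE.
case: (ltngtP i j) ij => [ij|ij|/val_inj->]; last by rewrite eqxx.
  case: (ltngtP j k) jk => [jk|jk|/val_inj->]; last by rewrite eqxx.
    by move=> _ _; apply: lt.
  case: (ltngtP i k) ik => [ik|ik|/val_inj->]; last by rewrite eqxx.
    by move=> *; rewrite -rot -rot; apply/rev; rewrite -rot; apply: lt.
  by move=> *; rewrite -rot -rot; apply: lt.
case: (ltngtP j k) jk => [jk|jk|/val_inj->]; last by rewrite eqxx.
  case: (ltngtP i k) ik => [ik|ik|/val_inj->]; last by rewrite eqxx.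
    by move=> *; rewrite -rot; apply: rev; rewrite rot; apply: lt.
  by move=> *; rewrite -rot; apply: lt.
by move=> *; apply/rev/lt.
Qed.

Lemma kfree_act_ideal s u :
  gen_ideal krel u -> gen_ideal krel (kfree_act s u).
Proof.
have varE g : kfree_act s (var g) = var (kgen_act s g).
  exact: freealg_map_var.
rewrite /kfree_act in varE *.
elim=> {u} [u||u v _ Iu _ Iv|u v _ Iv|u v _ Iu]; last 4 first.
- by rewrite raddf0; apply: gen_ideal0.
- by rewrite raddfD; apply: gen_idealD.
- by rewrite rmorphM; apply: gen_idealMl.
- by rewrite rmorphM; apply: gen_idealMr.
case=> {u} [i a y z|i y z|i|g g' d d' gd gd'|i|i j|i j y ij|i j k ij jk].
- rewrite raddfB raddfD /= freealg_mapZ !varE; exact/gen_ideal_rel/krel_lin.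
- by rewrite raddfB /= rmorphM /= !varE; apply/gen_ideal_rel/krel_mul.
- by rewrite raddfB /= rmorph1 /= varE; apply/gen_ideal_rel/krel_one.
- rewrite raddfB /= freealg_mapZ !rmorphM /= !varE; apply/gen_ideal_rel/krel_comm.
    by case: g gd => [[]|[]].
  by case: g' gd' => [[]|[]].
- by rewrite varE; apply/gen_ideal_rel/krel_diag.
- by rewrite raddfB /= !varE; apply/gen_ideal_rel/krel_sym.
- rewrite raddfB /= !rmorphM /= !varE; apply/ppiP; rewrite !rmorphM.
  exact: kP_kG.
- rewrite 2!raddfB /= !rmorphM /= !varE; apply/ppiP.
  rewrite raddfB /= !rmorphM.
  apply: kG_arnold; rewrite (inj_eq perm_inj) neq_ltn ?ij ?jk //.
  by rewrite (ltn_trans ij jk).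
Qed.

Lemma kact_ppi s u : kact s (ppi krel u) = ppi krel (kfree_act s u).
Proof.
rewrite /kact; apply/ppiP; rewrite /kfree_act -raddfB.
exact/kfree_act_ideal/ppiP/ppi_repr.
Qed.

Lemma kactD s e f : kact s (e + f) = kact s e + kact s f.
Proof.
rewrite -[e]ppi_repr -[f]ppi_repr -raddfD /= !kact_ppi.
by rewrite /kfree_act !raddfD.
Qed.

Lemma kactZ s a e : kact s (a *: e) = a *: kact s e.
Proof.
by rewrite -[e]ppi_repr -ppiZ !kact_ppi /kfree_act freealg_mapZ ppiZ.
Qed.

Lemma kactM s e f : kact s (e * f) = kact s e * kact s f.
Proof.
rewrite -[e]ppi_repr -[f]ppi_repr -rmorphM /= !kact_ppi.
by rewrite /kfree_act !rmorphM.
Qed.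

Lemma kact1 s : kact s 1 = 1.
Proof. by rewrite -(rmorph1 (ppi krel)) kact_ppi /kfree_act !rmorph1. Qed.

Lemma kact_kP s i y : kact s (kP i y) = kP (s i) y.
Proof. by rewrite kact_ppi /kfree_act freealg_map_var. Qed.

Lemma kact_kG s i j : kact s (kG i j) = kG (s i) (s j).
Proof. by rewrite kact_ppi /kfree_act freealg_map_var. Qed.

End KrizModel.

Definition lspan (V : lmodType rat) (S : V -> Prop) (e : V) : Prop :=
  exists2 r : seq (rat * V),
    forall c, c \in r -> S c.2 & e = \sum_(c <- r) c.1 *: c.2.

Definition is_lbasis (V : lmodType rat) (U : V -> Prop) (d : nat)
    (e : 'I_d -> V) : Prop :=
  (forall u, U u <-> exists c : 'I_d -> rat, u = \sum_i c i *: e i) /\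
  (forall c : 'I_d -> rat, \sum_i c i *: e i = 0 -> forall i, c i = 0).

(* MathComp composes permutations from left to right, so that an action given by
   s |-> (p_i |-> p_(s i)) satisfies act (s * t) = act t \o act s and is encoded
   by matrices acting on row vectors.  The value of the character at s is the
   trace of act s on the subspace U.                                          *)
Definition has_character (n : nat) (V : lmodType rat)
    (act : 'S_n -> V -> V) (U : V -> Prop) (chi : 'CF([set: 'S_n])) : Prop :=
  exists (d : nat) (e : 'I_d -> V)
      (rG : mx_representation rat [set: 'S_n] d),
    [/\ is_lbasis U e,
        forall s i, act s (e i) = \sum_j rG s i j *: e j
      & chi = cfRepr (map_repr (@ratr algC) rG)].

(* A type (L, H) is the sequence of pairs (lambda_i, h_i).  Indices start at
   0: block T i is {L_i + 1, ..., L_(i+1)} in the usual 1-based numbering.     *)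
Section Types.

Variables (n b : nat).

Definition ktype_ge (p p' : 'I_n.+1 * 'I_b.+1) : bool :=
  (p'.1 < p.1)%N || (p.1 == p'.1) && (p'.2 <= p.2)%N.

Definition is_ktype (r : seq ('I_n.+1 * 'I_b.+1)) : bool :=
  [&& all (fun p : 'I_n.+1 * 'I_b.+1 => 0 < p.1)%N r,
      (\sum_(p <- r) p.1 == n)%N & sorted ktype_ge r].

Record ktype := KType {
  ktype_val :> n.-bseq ('I_n.+1 * 'I_b.+1);
  _ : is_ktype ktype_val
}.
HB.instance Definition _ := [isSub for ktype_val].
HB.instance Definition _ := [Finite of ktype by <:].

Variable T : ktype.

Definition ktype_lam (i : nat) : nat := (nth (ord0, ord0) T i).1.
Definition ktype_h (i : nat) : 'I_b.+1 := (nth (ord0, ord0) T i).2.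

Definition ktype_q : nat := (\sum_(i < size T) (ktype_lam i - 1))%N.
Definition ktype_deg (deg : 'I_b.+1 -> nat) : nat :=
  (\sum_(i < size T) deg (ktype_h i))%N.

Definition ktype_psum (i : nat) : nat := (\sum_(l < i) ktype_lam l)%N.

Definition block (i : nat) : seq 'I_n :=
  [seq v : 'I_n <- enum 'I_n | ktype_psum i <= v < ktype_psum i.+1]%N.

Lemma block_uniq i : uniq (block i).
Proof. by rewrite filter_uniq ?enum_uniq. Qed.

Definition block_cycle (i : nat) : 'S_n :=
  perm (can_inj (prev_next (block_uniq i))).

Definition block_swap (i : nat) : 'S_n :=
  (\prod_(p <- zip (block i) (block i.+1)) tperm p.1 p.2)%g.

Definition swappable (i : nat) : bool :=
  [&& i.+1 < size T, ktype_lam i == ktype_lam i.+1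
    & ktype_h i == ktype_h i.+1]%N.

Definition ktypeC : {group 'S_n} := (\prod_(i < size T) <[block_cycle i]>)%G.

Definition ktypeN : {group 'S_n} :=
  <<[set block_swap i | i : 'I_(size T) & swappable i]>>%G.

Definition ktypeZ : {group 'S_n} := (ktypeC <*> ktypeN)%G.

(* e^(2 i pi / l): among the l-th roots of -1, l.-root (-1) has the smallest
   nonnegative argument pi / l.                                               *)
Definition zeta (l : nat) : algC := l.-root (-1) ^+ 2.

Definition is_phi (phi : 'CF(ktypeC)) : Prop :=
  exists psi : 'CF(ktypeC),
    [/\ psi \is a linear_char,
        forall i, (i < size T)%N -> psi (block_cycle i) = zeta (ktype_lam i)
      & forall c, c \in ktypeC -> phi c = psi c * (-1) ^+ odd_perm c].

Definition is_alpha (deg : 'I_b.+1 -> nat) (alpha : 'CF(ktypeN)) : Prop :=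
  alpha \is a linear_char /\
  forall i, swappable i ->
    alpha (block_swap i) =
      if odd (deg (ktype_h i)) then (-1) ^+ ktype_lam i
      else (-1) ^+ (ktype_lam i).+1.

(* c * v in MathComp is the composite v \o c; since phi is invariant under
   conjugation by N, the formula xi (c v) = phi c alpha v is the same for both
   conventions.  is_phi, is_alpha and is_xi determine phi, alpha and xi uniquely, since the
   elements block_cycle i generate C, the block_swap i generate N and Z = C N. *)
Definition is_xi (deg : 'I_b.+1 -> nat) (xi : 'CF(ktypeZ)) : Prop :=
  exists (phi : 'CF(ktypeC)) (alpha : 'CF(ktypeN)),
    [/\ is_phi phi, is_alpha deg alpha
      & forall c v, c \in ktypeC -> v \in ktypeN ->
          xi (c * v)%g = phi c * alpha v].

End Types.

Section KrizParts.

Variables (m n b : nat) (H : falgType rat) (gr : nat -> {vspace H}).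
Variable x : 'I_b.+1 -> H.

(* E_q^k(X, n) *)
Definition kriz_part (q k : nat) : kriz m n gr -> Prop :=
  lspan (fun e => exists (y : 'I_n -> H) (d : 'I_n -> nat)
      (r : seq ('I_n * 'I_n)),
    [/\ forall i, y i \in gr (d i), size r = q,
        (\sum_i d i + q * (2 * m - 1))%N = k
      & e = (\prod_i kP m gr i (y i)) * \prod_(g <- r) kG m gr g.1 g.2]).

Definition kmonomial (a : 'I_n -> 'I_b.+1) (r : seq ('I_n * 'I_n)) :
    kriz m n gr :=
  (\prod_i kP m gr i (x (a i))) * \prod_(g <- r) kG m gr g.1 g.2.

Definition canonical_monomial (a : 'I_n -> 'I_b.+1) (r : seq ('I_n * 'I_n)) :
    Prop :=
  [/\ forall g, g \in r -> (g.1 < g.2)%N,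
      sorted (fun g g' : 'I_n * 'I_n => g.2 < g'.2)%N r
    & forall g, g \in r -> x (a g.2) = 1].

Definition marked_edge (r : seq ('I_n * 'I_n)) : rel 'I_n :=
  fun u v => ((u, v) \in r) || ((v, u) \in r).

(* f numbers the components of the marked graph. *)
Definition monomial_of_type (T : ktype n b) (a : 'I_n -> 'I_b.+1)
    (r : seq ('I_n * 'I_n)) : Prop :=
  exists f : 'I_n -> 'I_(size T),
    [/\ forall u v, (f u == f v) = connect (marked_edge r) u v,
        forall i, #|[set u | f u == i]| = ktype_lam T i
      & forall i u, f u = i -> (forall v, f v = i -> (u <= v)%N) ->
          x (a u) = x (ktype_h T i)].

(* E(L, H) *)
Definition kriz_type (T : ktype n b) : kriz m n gr -> Prop :=
  lspan (fun e => exists (a : 'I_n -> 'I_b.+1) (r : seq ('I_n * 'I_n)),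
    [/\ canonical_monomial a r, monomial_of_type T a r & e = kmonomial a r]).

End KrizParts.

(* Main.v *)
From HB Require Import structures.
Require Import Defs.
From mathcomp Require Import all_boot all_order all_algebra all_fingroup.
From mathcomp Require Import all_field all_character.
From mathcomp Require Import boolp monalg ring.

(* The monomials in the canonical basis are independent because they act independently on
   a module built by adding one point at a time: if V is a module for the first k points,
   then the module for k + 1 points is the direct sum of H (x) V and one copy G_ik V of V
   for every i <= k.

   For a type T let m_T be the product, over the blocks of T, of x_h times the path
   G_12 G_23 G_34 ... through the block.  The translates of m_T span E(T).  Let v_T be the
   product of m_T with the idempotents (up to a scalar) of the block cycles for the
   character phi.  It is a common eigenvector of Z_T with character xi_T, so it generates
   a module K_T of dimension at most |S_n : Z_T|.  By an argument going back to Klyachko,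
   m_T is recovered from v_T by an element of the group algebra, so that E(T) is contained
   in K_T.

   Finally, the indices |S_n : Z_T| add up to at most the number of canonical monomials:
   both are compared with the number of pairs of a permutation and a marking of the points
   which is constant on its cycles.  Hence E(T) = K_T has dimension |S_n : Z_T|, and it is
   induced from the line spanned by v_T. *)

Set Implicit Arguments.
Unset Strict Implicit.
Unset Printing Implicit Defensive.

Import Order.TTheory GRing.Theory Num.Theory.
Local Open Scope ring_scope.

(** * Parity automorphism of the cohomology ring *)

(** The Kriz algebra is a quotient by a generated ideal, so rewriting with its relations only bounds
    its size from above; for a lower bound one needs an action in which the canonical monomials stay
    apart. The comparison of dimensions then yields facts that are awkward to prove directly: E(T)
    is stable although canonical monomials are not permuted among themselves, a monomial has only
    one type, and the translates of v_T satisfy no relations beyond those imposed by Z_T. The common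
    value of the two counts is the product of the b + 1 + j for j < n: point j carries one of b + 1
    classes or an edge to one of j smaller points. This is n! times the binomial coefficient of n +
    b over n, the Burnside count of the pairs. What the recovery of m_T uses of e^(2 i pi / lambda)
    is that its powers with exponents 1, ..., lambda - 1 differ from 1, which makes certain
    operators 1 - y g invertible. The sign twist in phi comes from reordering the odd edges when a
    path is rotated, and alpha comes from exchanging two equal words of degree |x_h| + (lambda -
    1)(2m - 1). *)

Section Cohomology.

Variables (m b : nat) (H : falgType rat) (gr : nat -> {vspace H}).
Hypothesis H_cohomology : connected_PD_algebra m gr.
Variables (w : H) (x : 'I_b.+1 -> H) (deg : 'I_b.+1 -> nat).
Hypothesis x_basis : homogeneous_basis m gr w x deg.

Definition hcoord (h : 'I_b.+1) (y : H) : rat :=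
  coord [tuple x h | h < b.+1] h y.

Fact hcoord_is_linear h : linear_for *%R (hcoord h).
Proof. by move=> a y z; rewrite /hcoord linearP. Qed.
HB.instance Definition _ h :=
  GRing.isLinear.Build rat H rat *%R (hcoord h) (hcoord_is_linear h).

Lemma hcoord_sum y : y = \sum_h hcoord h y *: x h.
Proof.
rewrite {1}(coord_basis (hb_basis x_basis) (memvf y)).
by apply: eq_bigr => h _; rewrite (nth_mktuple x).
Qed.

Lemma hcoord_x h h' : hcoord h (x h') = (h == h')%:R.
Proof.
have := coord_free h' h (basis_free (hb_basis x_basis)).
by rewrite -tnth_nth tnth_mktuple eq_sym.
Qed.

Lemma x_neq0 h : x h != 0.
Proof.
apply/eqP => x0; have := hcoord_x h h.
by rewrite x0 eqxx linear0 => /esym/eqP; rewrite oner_eq0.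
Qed.

Lemma x_inj : injective x.
Proof.
move=> h h' e; have := hcoord_x h h'; rewrite -e hcoord_x eqxx.
by case: eqP => // _ /eqP; rewrite oner_eq0.
Qed.

Lemma deg_max h : (deg h < (2 * m).+1)%N.
Proof.
rewrite ltnS leqNgt; apply: contra (x_neq0 h) => /(gr_vanish H_cohomology) e.
by have := hb_homog x_basis h; rewrite e memv0.
Qed.

(** Grouping the basis expansion of [y] by degree gives one homogeneous decomposition, and [y]
    placed alone in degree [d] gives another; directness of the sum identifies them. *)
Lemma hcoord_homog h y d : y \in gr d -> deg h != d -> hcoord h y = 0.
Proof.
move=> yd hd.
have [dle|/(gr_vanish H_cohomology) e] := leqP d (2 * m)%N; last first.
  by move: yd; rewrite e memv0 => /eqP ->; rewrite linear0.
pose dd := Ordinal (dle : (d < (2 * m).+1)%N).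
pose us (k : 'I_(2 * m).+1) := \sum_(l | deg l == k) hcoord l y *: x l.
pose vs (k : 'I_(2 * m).+1) := if k == dd then y else 0.
have us_gr k : us k \in gr k.
  apply: memv_suml => l /eqP <-; exact/memvZ/(hb_homog x_basis).
have usE : \sum_k us k = y.
  by rewrite [RHS]hcoord_sum (partition_big (fun l => Ordinal (deg_max l)) xpredT) //=.
have vsE : \sum_k vs k = y by rewrite /vs -big_mkcond big_pred1_eq.
have vs_gr k : vs k \in gr k.
  by rewrite /vs; case: eqP => [->//|_]; rewrite mem0v.
have /directv_sum_unique uniq := gr_direct H_cohomology.
have := uniq us vs (fun i _ => us_gr i) (fun i _ => vs_gr i).
rewrite usE vsE eqxx => /esym/forall_inP uv.
have /eqP := uv (Ordinal (deg_max h)) isT; rewrite /vs -val_eqE /= (negPf hd).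
move=> /(congr1 (hcoord h)); rewrite linear0 /us linear_sum (bigD1 h) //= linearZ /=.
rewrite hcoord_x eqxx mulr1 big1 ?addr0 // => l /andP[_ lh].
by rewrite linearZ /= hcoord_x eq_sym (negPf lh) mulr0.
Qed.

Lemma hcoord_homog_sum y d : y \in gr d ->
  y = \sum_(h | deg h == d) hcoord h y *: x h.
Proof.
move=> yd; rewrite {1}[y]hcoord_sum [RHS]big_mkcond /=; apply: eq_bigr => h _.
by case: ifPn => // hd; rewrite (hcoord_homog yd hd) scale0r.
Qed.

Lemma deg0 : deg ord0 = 0%N.
Proof.
apply/eqP; apply: contraT => d0.
have g0 : x ord0 \in gr 0%N.
  by rewrite (hb_first x_basis) (gr_connected H_cohomology) memv_line.
have := hcoord_homog g0 d0; rewrite hcoord_x eqxx => /eqP; by rewrite oner_eq0.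
Qed.

(** The parity automorphism, equal to (-1)^d on [gr d]. Writing it in the basis makes it a total
    linear map, so that sign rules can be stated for inhomogeneous classes. *)
Definition hbar (y : H) : H := \sum_h ((-1) ^+ deg h * hcoord h y) *: x h.

Fact hbar_is_linear : linear hbar.
Proof.
move=> a y z; rewrite /hbar scaler_sumr -big_split /=; apply: eq_bigr => h _.
by rewrite linearP /= mulrDr scalerDl scalerA mulrCA.
Qed.
HB.instance Definition _ :=
  GRing.isLinear.Build rat H H *:%R hbar hbar_is_linear.

Lemma hcoord_bar h y : hcoord h (hbar y) = (-1) ^+ deg h * hcoord h y.
Proof.
rewrite linear_sum (bigD1 h) //= linearZ /= hcoord_x eqxx mulr1 big1 ?addr0 //.
by move=> l lh; rewrite linearZ /= hcoord_x eq_sym (negPf lh) mulr0.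
Qed.

Lemma hbar_homog y d : y \in gr d -> hbar y = (-1) ^+ d *: y.
Proof.
move=> yd; rewrite [in RHS](hcoord_sum y) scaler_sumr; apply: eq_bigr => h _.
rewrite scalerA; have [<-//|/(hcoord_homog yd) ->] := eqVneq (deg h) d.
by rewrite !mulr0.
Qed.

Lemma hbar_x h : hbar (x h) = (-1) ^+ deg h *: x h.
Proof. exact/hbar_homog/(hb_homog x_basis). Qed.

Lemma hbarK : involutive hbar.
Proof.
move=> y; rewrite [RHS]hcoord_sum {1}/hbar; apply: eq_bigr => h _.
by rewrite hcoord_bar mulrA -expr2 sqrr_sign mul1r.
Qed.

Lemma hbar1 : hbar 1 = 1.
Proof. by rewrite -(hb_first x_basis) hbar_x deg0 scale1r. Qed.

Lemma hbarM : {morph hbar : y z / y * z}.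
Proof.
move=> y z; rewrite [y]hcoord_sum [z]hcoord_sum mulr_suml !linear_sum mulr_suml.
apply: eq_bigr => h _; rewrite !mulr_sumr linear_sum; apply: eq_bigr => l _ /=.
rewrite -scalerAl -scalerAr !linearZ /= !hbar_x -!scalerAl -!scalerAr.
rewrite (hbar_homog (gr_mul H_cohomology (hb_homog x_basis h) (hb_homog x_basis l))).
by rewrite exprD !scalerA -!mulrA; congr (_ *: _); congr (_ * _); rewrite mulrCA.
Qed.

(** The effect on a class of moving it past an element of degree [d]. *)
Definition hsbar (d : nat) (y : H) : H := if odd d then hbar y else y.

Lemma hsbarE d y : hsbar d y = if odd d then hbar y else y.
Proof. by []. Qed.

Lemma hcoord_hsbar d l y :
  hcoord l (hsbar d y) = (-1) ^+ (deg l * d)%N * hcoord l y.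
Proof.
rewrite /hsbar -[_ ^+ (_ * _)]signr_odd oddM andbC.
by case: (odd d); rewrite ?mul1r // hcoord_bar signr_odd.
Qed.

Lemma hsbar_homog d y d' : y \in gr d' -> hsbar d y = (-1) ^+ (d * d')%N *: y.
Proof.
move=> yd; rewrite /hsbar -signr_odd oddM; case: (odd d); rewrite ?scale1r //=.
by rewrite (hbar_homog yd) signr_odd.
Qed.

Lemma hsbar_x d h : hsbar d (x h) = (-1) ^+ (d * deg h)%N *: x h.
Proof. exact/hsbar_homog/(hb_homog x_basis). Qed.

Fact hsbar_is_linear d : linear (hsbar d).
Proof. by move=> a y z; rewrite /hsbar; case: odd => //; apply: linearP. Qed.
HB.instance Definition _ d :=
  GRing.isLinear.Build rat H H *:%R (hsbar d) (hsbar_is_linear d).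

Lemma hsbarM d : {morph hsbar d : y z / y * z}.
Proof. by move=> y z; rewrite /hsbar; case: odd => //; apply: hbarM. Qed.

Lemma hsbar1 d : hsbar d 1 = 1.
Proof. by rewrite /hsbar hbar1 if_same. Qed.

Lemma hsbarD d d' y : hsbar d (hsbar d' y) = hsbar (d + d') y.
Proof. by rewrite /hsbar oddD; do 2!case: odd => //=; rewrite hbarK. Qed.

Lemma hsbar_bar d y : hsbar d (hbar y) = hbar (hsbar d y).
Proof. by rewrite /hsbar; case: odd. Qed.

Lemma hmulC h z : x h * z = hsbar (deg h) z * x h.
Proof.
rewrite {1 2}[z]hcoord_sum mulr_sumr linear_sum mulr_suml; apply: eq_bigr => l _.
rewrite -scalerAr linearZ /= -scalerAl; congr (_ *: _).
rewrite (gr_comm H_cohomology (hb_homog x_basis l) (hb_homog x_basis h)) mulnC.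
rewrite hsbar_x -2![_ ^+ (_ * _)]signr_odd; case: (odd _).
  by rewrite !expr1 mulN1r scaleN1r mulNr.
by rewrite !expr0 mul1r scale1r.
Qed.

End Cohomology.

(** * Independence of the canonical monomials *)

Section Model.

Variables (m b : nat) (H : falgType rat) (gr : nat -> {vspace H}).
Hypothesis H_cohomology : connected_PD_algebra m gr.
Variables (w : H) (x : 'I_b.+1 -> H) (deg : 'I_b.+1 -> nat).
Hypothesis x_basis : homogeneous_basis m gr w x deg.

Local Notation hcoord := (hcoord x).
Local Notation hbar := (hbar x deg).
Local Notation hsbar := (hsbar x deg).

(* An action of the Kriz algebra of k points.  The signs are expressed by the parity
   automorphism hbar of H, so that the relations need no homogeneity hypothesis. *)
Record kmodel (k : nat) (V : lmodType rat) (P : 'I_k -> H -> {linear V -> V})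
    (G : 'I_k -> 'I_k -> {linear V -> V}) : Prop := {
  km_lin : forall i a y z u, P i (a *: y + z) u = a *: P i y u + P i z u;
  km_mul : forall i y z u, P i (y * z) u = P i y (P i z u);
  km_one : forall i u, P i 1 u = u;
  km_PP : forall i j h z u,
    P i (x h) (P j z u) = P j (hsbar (deg h) z) (P i (x h) u);
  km_GP : forall i j l y u, G i j (P l y u) = P l (hbar y) (G i j u);
  km_GG : forall i j k l u, G k l (G i j u) = - G i j (G k l u);
  km_diag : forall i u, G i i u = 0;
  km_sym : forall i j u, G j i u = G i j u;
  km_slide : forall i j y u, P j y (G i j u) = P i y (G i j u);
  km_arnold : forall i j l u,
    G i l (G j l u) = G i j (G j l u) - G i j (G i l u)
}.

Section Step.

Variables (k : nat) (V : lmodType rat) (P : 'I_k -> H -> {linear V -> V}).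
Variables (G : 'I_k -> 'I_k -> {linear V -> V}).

(* In u : kmodel_next, u.1 h is the coefficient of x_h at the new point and u.2 l is the
   coefficient of the edge from l to the new point. *)
Definition kmodel_next : lmodType rat := ({ffun 'I_b.+1 -> V} * {ffun 'I_k -> V})%type.

Implicit Types u : kmodel_next.

(* In the product with G_ik, k being the new point, p_k^*(x_h) slides to p_i^*(x_h) and the
   Arnold relation turns G_ik G_jk into G_ij G_jk - G_ij G_ik. *)
Definition attach (i : 'I_k) (u : kmodel_next) : V :=
  \sum_h P i (x h) (u.1 h) + \sum_j G i j (u.2 j).

(** The factor at the new point stands to the left of [V]. A class at an old point must therefore
    pass x_h or an odd edge, whence [hsbar] and [hbar]; a class at the new point multiplies x_h, or
    slides along the edge to its end [l] and then passes that edge. *)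
Definition nextP (i : 'I_k.+1) (y : H) (u : kmodel_next) : kmodel_next :=
  if unlift ord_max i is Some j then
    ([ffun h => P j (hsbar (deg h) y) (u.1 h)], [ffun l => P j (hbar y) (u.2 l)])
  else
    ([ffun h' => \sum_h hcoord h' (y * x h) *: u.1 h],
     [ffun l => P l (hbar y) (u.2 l)]).

(** Multiplication by the edge from [i] to the new point. [attach] collects the terms that keep this
    edge; the other Arnold term keeps the edge from [l], and the minus sign comes from moving that
    edge to the left of G_il. *)
Definition link (i : 'I_k) (u : kmodel_next) : kmodel_next :=
  ([ffun=> 0], [ffun l => (l == i)%:R *: attach i u - G i l (u.2 l)]).

Definition nextG (i j : 'I_k.+1) (u : kmodel_next) : kmodel_next :=
  match unlift ord_max i, unlift ord_max j with
  | Some i', Some j' => ([ffun h => (-1) ^+ deg h *: G i' j' (u.1 h)],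
                         [ffun l => - G i' j' (u.2 l)])
  | Some i', None => link i' u
  | None, Some j' => link j' u
  | None, None => 0
  end.

Lemma kmodel_next_eq (u v : kmodel_next) :
  (forall h, u.1 h = v.1 h) -> (forall l, u.2 l = v.2 l) -> u = v.
Proof.
by case: u v => [u1 u2] [v1 v2] /= e1 e2; congr (_, _); apply/ffunP.
Qed.

Fact nextP_is_linear i y : linear (nextP i y).
Proof.
move=> a u v; rewrite /= /nextP; case: unlift => [j|]; apply: kmodel_next_eq => l;
  rewrite /= !ffunE ?linearP //.
rewrite scaler_sumr -big_split /=; apply: eq_bigr => h _.
by rewrite !ffunE scalerDr !scalerA mulrC.
Qed.
HB.instance Definition _ i y :=
  GRing.isLinear.Build rat kmodel_next kmodel_next *:%R (nextP i y)
    (nextP_is_linear i y).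

Fact attach_is_linear i : linear (attach i).
Proof.
move=> a u v; rewrite /attach scalerDr addrACA !scaler_sumr -!big_split /=.
by congr (_ + _); apply: eq_bigr => h _; rewrite !ffunE linearP.
Qed.
HB.instance Definition _ i :=
  GRing.isLinear.Build rat kmodel_next V *:%R (attach i) (attach_is_linear i).

Fact link_is_linear i : linear (link i).
Proof.
move=> a u v; apply: kmodel_next_eq => l; rewrite /= !ffunE ?scaler0 ?addr0 //.
rewrite (linearP (attach i)) (linearP (G i l)) scalerDr opprD addrACA.
by rewrite [in RHS]scalerBr !scalerA mulrC.
Qed.
HB.instance Definition _ i :=
  GRing.isLinear.Build rat kmodel_next kmodel_next *:%R (link i) (link_is_linear i).

Fact nextG_is_linear i j : linear (nextG i j).
Proof.
move=> a u v; rewrite /nextG; case: unlift => [i'|]; case: unlift => [j'|];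
  rewrite ?linearP ?scaler0 ?addr0 //.
by apply: kmodel_next_eq => l;
  rewrite /= !ffunE ?linearP ?opprD ?scalerDr ?scalerN.
Qed.
HB.instance Definition _ i j :=
  GRing.isLinear.Build rat kmodel_next kmodel_next *:%R (nextG i j)
    (nextG_is_linear i j).

Hypothesis PG : kmodel P G.

Lemma kmodelPZ i a y e : P i (a *: y) e = a *: P i y e.
Proof.
have P0 : P i 0 e = 0.
  by have := km_lin PG i (-1) 0 0 e; rewrite scaler0 addr0 scaleN1r addNr.
by have := km_lin PG i a y 0 e; rewrite !addr0 P0 addr0.
Qed.

Lemma attachP i j z u : attach i (nextP (lift ord_max j) z u) = P j z (attach i u).
Proof.
rewrite /attach /nextP liftK /= linearD !linear_sum /=; congr (_ + _).
  apply: eq_bigr => h _; rewrite ffunE (km_PP PG) (hsbarD x_basis).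
  by rewrite !hsbarE addnn odd_double.
by apply: eq_bigr => l _; rewrite ffunE (km_GP PG) (hbarK x_basis).
Qed.

Lemma attachG i j l u : attach i (nextG (lift ord_max j) (lift ord_max l) u) = G j l (attach i u).
Proof.
rewrite /attach /nextG !liftK /= linearD !linear_sum /=; congr (_ + _).
  apply: eq_bigr => h _; rewrite ffunE (km_GP PG) (hbar_x H_cohomology x_basis) kmodelPZ.
  by rewrite linearZ.
by apply: eq_bigr => i1 _; rewrite ffunE linearN /= (km_GG PG).
Qed.

Lemma kmodelP_sum i y e : P i y e = \sum_h hcoord h y *: P i (x h) e.
Proof.
rewrite {1}[y](hcoord_sum x_basis); elim/big_rec2: _ => [|h u v _ <-].
  by rewrite -[0 in LHS](scale0r 0) kmodelPZ scale0r.
by rewrite (km_lin PG).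
Qed.

Lemma attach_maxP i z u : attach i (nextP ord_max z u) = P i z (attach i u).
Proof.
rewrite /attach /nextP unlift_none /= linearD !linear_sum /=; congr (_ + _); last first.
  by apply: eq_bigr => l _; rewrite ffunE (km_GP PG) (hbarK x_basis) (km_slide PG).
transitivity (\sum_h' \sum_h hcoord h' (z * x h) *: P i (x h') (u.1 h)).
  apply: eq_bigr => h' _; rewrite ffunE linear_sum; apply: eq_bigr => h _.
  by rewrite linearZ.
by rewrite exchange_big; apply: eq_bigr => h _ /=; rewrite -kmodelP_sum (km_mul PG).
Qed.

Lemma link_old i j z u :
  link i (nextP (lift ord_max j) z u) = nextP (lift ord_max j) (hbar z) (link i u).
Proof.
apply: kmodel_next_eq => l; rewrite /= ?attachP /nextP liftK /= !ffunE ?linear0 //.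
by rewrite (km_GP PG) (hbarK x_basis) linearB linearZ.
Qed.

Lemma nextG_max i u :
  (nextG (lift ord_max i) ord_max u = link i u) *
  (nextG ord_max (lift ord_max i) u = link i u).
Proof. by rewrite /nextG liftK unlift_none. Qed.

Lemma nextG_max2 u : nextG ord_max ord_max u = 0.
Proof. by rewrite /nextG unlift_none. Qed.

Lemma link_max i z u : link i (nextP ord_max z u) = nextP ord_max (hbar z) (link i u).
Proof.
apply: kmodel_next_eq => l; rewrite /= ?attach_maxP /nextP unlift_none /= !ffunE.
  by rewrite big1 // => h _; rewrite ffunE scaler0.
rewrite (km_GP PG) (hbarK x_basis) linearB linearZ /= (km_slide PG).
by case: eqP => [->//|_]; rewrite !scale0r.
Qed.

Lemma link_oldG i j l u :
  link i (nextG (lift ord_max j) (lift ord_max l) u)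
    = - nextG (lift ord_max j) (lift ord_max l) (link i u).
Proof.
apply: kmodel_next_eq => h; rewrite /= ?attachG /nextG !liftK /= !ffunE.
  by rewrite linear0 scaler0 oppr0.
by rewrite linearN /= opprK linearB linearZ /= (km_GG PG) opprK.
Qed.

(** Sliding along G_ij cancels the cohomology parts, and the Arnold relation among old points treats
    the edges one by one. *)
Lemma attach_arnold i j u :
  G i j (attach j u) - G i j (attach i u) = \sum_l G i l (G j l (u.2 l)).
Proof.
have slide : G i j (\sum_h P j (x h) (u.1 h)) = G i j (\sum_h P i (x h) (u.1 h)).
  by rewrite !linear_sum; apply: eq_bigr => h _; rewrite /= !(km_GP PG) (km_slide PG).
rewrite /attach !linearD /= slide.
rewrite addrACA subrr add0r !linear_sum -big_split.
by apply: eq_bigr => l _; rewrite [RHS](km_arnold PG).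
Qed.

Lemma attach_link i j u : attach i (link j u) = G i j (attach i u).
Proof.
rewrite [LHS]/attach big1 ?add0r => [|h _]; last by rewrite ffunE linear0.
under eq_bigr do rewrite ffunE linearB linearZ /=.
rewrite sumrB -(attach_arnold i j u) (bigD1 j) //= eqxx scale1r big1.
  by rewrite addr0 opprB addrC subrK.
by move=> l /negPf ->; rewrite scale0r.
Qed.

Lemma link_slide i y u : nextP ord_max y (link i u) = nextP (lift ord_max i) y (link i u).
Proof.
apply: kmodel_next_eq => l; rewrite /nextP unlift_none liftK /= !ffunE.
  by rewrite linear0 big1 // => h _; rewrite ffunE scaler0.
rewrite !linearB !linearZ /= (km_slide PG).
by case: eqP => [->//|_]; rewrite !scale0r.
Qed.

(** The explicit form from which both the anticommutation of two edges at the new point and their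
    Arnold relation are read off. *)
Lemma link_link i j u l : (link i (link j u)).2 l =
  (l == i)%:R *: G i j (attach i u) - (l == j)%:R *: G i j (attach j u)
    + G i l (G j l (u.2 l)).
Proof.
rewrite /= !ffunE attach_link linearB linearZ /= opprB addrA addrAC.
by have [->|_] := eqVneq l j; rewrite ?scale0r.
Qed.

Lemma link_arnold i j u :
  link i (link j u) = nextG (lift ord_max i) (lift ord_max j) (link j u)
                      - nextG (lift ord_max i) (lift ord_max j) (link i u).
Proof.
apply: kmodel_next_eq => l; last rewrite link_link.
  by rewrite /nextG !liftK /= !ffunE linear0 scaler0 subr0.
rewrite /nextG !liftK /= !ffunE !linearB !linearZ /= (km_arnold PG).
rewrite !opprK.
by rewrite [RHS]addrACA [X in _ = X + _]addrC.
Qed.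

Lemma linkC i j u : link i (link j u) = - link j (link i u).
Proof.
apply: kmodel_next_eq => l; first by rewrite /= !ffunE oppr0.
have -> : (- link j (link i u)).2 l = - (link j (link i u)).2 l by rewrite /= ffunE.
rewrite !link_link; by rewrite !(km_sym PG i j) (km_GG PG i l j l) opprD opprB opprK.
Qed.

Lemma nextP_mul i y z u : nextP i (y * z) u = nextP i y (nextP i z u).
Proof.
apply: kmodel_next_eq => l; rewrite /= /nextP; case: unlift => [j|];
  rewrite /= !ffunE ?(hsbarM H_cohomology x_basis) ?(hbarM H_cohomology x_basis) ?(km_mul PG) //.
under [RHS]eq_bigr do rewrite ffunE scaler_sumr.
rewrite exchange_big; apply: eq_bigr => h _ /=.
under eq_bigr do rewrite scalerA mulrC.
rewrite -scaler_suml -mulrA {1}[z * x h](hcoord_sum x_basis) mulr_sumr linear_sum /=.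
by congr (_ *: _); apply: eq_bigr => h' _; rewrite -scalerAr linearZ.
Qed.

Lemma nextPC i j h z u :
  nextP i (x h) (nextP j z u) = nextP j (hsbar (deg h) z) (nextP i (x h) u).
Proof.
have sC d d' y : hsbar d (hsbar d' y) = hsbar d' (hsbar d y).
  by rewrite !(hsbarD x_basis) addnC.
have g j1 l v : P l (hbar (x h)) (P j1 (hbar z) v) =
    P j1 (hbar (hsbar (deg h) z)) (P l (hbar (x h)) v).
  rewrite (hbar_x H_cohomology x_basis) !kmodelPZ linearZ; congr (_ *: _).
  by rewrite (km_PP PG) hsbar_bar.
case: (unliftP ord_max i) => [i' ->|->]; case: (unliftP ord_max j) => [j' ->|->].
- apply: kmodel_next_eq => l; rewrite /nextP !liftK /= !ffunE ?g //.
  by rewrite (hsbar_x H_cohomology x_basis) !kmodelPZ linearZ (km_PP PG) sC.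
- apply: kmodel_next_eq => l; rewrite /nextP liftK unlift_none /= !ffunE ?g //.
  rewrite linear_sum; apply: eq_bigr => h' _; rewrite ffunE linearZ /=.
  rewrite !(hsbar_x H_cohomology x_basis) !kmodelPZ !scalerA; congr (_ *: _).
  rewrite mulrC -(hcoord_hsbar x_basis) (hsbarM H_cohomology x_basis).
  rewrite (hsbar_x H_cohomology x_basis) -scalerAr linearZ /= mulrC.
  by rewrite mulnC.
- apply: kmodel_next_eq => l; rewrite /nextP liftK unlift_none /= !ffunE ?g //.
  rewrite linear_sum; apply: eq_bigr => h' _; rewrite ffunE linearZ /=.
  (* Only classes of degree [deg h + deg h'] occur in the product of x_h and x_h', so on the
     surviving terms the two parity twists agree. *)
  have [e|/(hcoord_homog H_cohomology x_basis (gr_mul H_cohomology (hb_homog x_basis h) (hb_homog x_basis h')))] := eqVneq (deg l) (deg h + deg h')%N; last first.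
    by move=> ->; rewrite !scale0r.
  by rewrite e (hsbarD x_basis) !hsbarE !oddD; do 2!case: odd.
- by rewrite -!nextP_mul (hmulC H_cohomology x_basis).
Qed.

Lemma nextGP i j l y u :
  nextG i j (nextP l y u) = nextP l (hbar y) (nextG i j u).
Proof.
case: (unliftP ord_max i) => [i' ->|->]; case: (unliftP ord_max j) => [j' ->|->];
  rewrite ?nextG_max ?nextG_max2.
- case: (unliftP ord_max l) => [l' ->|->]; apply: kmodel_next_eq => h;
    rewrite /nextG /nextP ?unlift_none !liftK /= !ffunE.
  + by rewrite (km_GP PG) linearZ hsbar_bar.
  + by rewrite (km_GP PG) linearN.
  + rewrite linear_sum scaler_sumr; apply: eq_bigr => h' _; rewrite !ffunE.
    rewrite linearZ !scalerA; congr (_ *: _).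
    rewrite -(hcoord_bar x_basis) (hbarM H_cohomology x_basis) (hbar_x H_cohomology x_basis).
    by rewrite -scalerAr linearZ /= mulrC.
  + by rewrite (km_GP PG) linearN.
- by case: (unliftP ord_max l) => [l' ->|->]; rewrite ?link_old ?link_max.
- by case: (unliftP ord_max l) => [l' ->|->]; rewrite ?link_old ?link_max.
- by rewrite linear0.
Qed.

Lemma nextGG i j k' l u : nextG k' l (nextG i j u) = - nextG i j (nextG k' l u).
Proof.
case: (unliftP ord_max i) => [i' ->|->]; case: (unliftP ord_max j) => [j' ->|->];
  case: (unliftP ord_max k') => [k1 ->|->]; case: (unliftP ord_max l) => [l' ->|->];
  rewrite ?nextG_max ?nextG_max2 ?linear0 ?oppr0 ?link_oldG ?opprK //;
  try exact: linkC.
apply: kmodel_next_eq => h; rewrite /nextG !liftK /= !ffunE.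
  by rewrite !linearZ /= (km_GG PG) scalerN.
by rewrite !(linearN (G _ _)) (km_GG PG) !opprK.
Qed.

Lemma nextG_arnold i j l u :
  nextG i l (nextG j l u) = nextG i j (nextG j l u) - nextG i j (nextG i l u).
Proof.
(* The relation is claimed for all indices; this settles cases in which two of them are the new
   point. *)
have link2 a v : link a (link a v) = 0 by rewrite link_arnold subrr.
case: (unliftP ord_max i) => [i' ->|->]; case: (unliftP ord_max j) => [j' ->|->];
  case: (unliftP ord_max l) => [l' ->|->];
  rewrite ?nextG_max ?nextG_max2 ?linear0 ?link2 ?subrr ?oppr0 ?addr0 ?sub0r ?link2 //.
- apply: kmodel_next_eq => h; rewrite /nextG !liftK /= !ffunE.
    rewrite !linearZ /= (km_arnold PG). by rewrite -!scalerDr.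
  by rewrite !(linearN (G _ _)) !opprK (km_arnold PG).
- exact: link_arnold.
- by rewrite link_oldG opprK link_arnold subrK.
- by rewrite !link_oldG link_arnold opprB addKr.
Qed.

Lemma kmodel_step : kmodel nextP nextG.
Proof.
split; try by [exact: nextP_mul | exact: nextPC | exact: nextGP | exact: nextGG
  | exact: nextG_arnold].
- move=> i a y z u; apply: kmodel_next_eq => l; rewrite /= /nextP; case: unlift => [j|];
    rewrite /= !ffunE ?linearP /= ?(km_lin PG) //.
  rewrite scaler_sumr -big_split; apply: eq_bigr => h _ /=.
  by rewrite mulrDl -scalerAl linearP scalerDl scalerA.
- move=> i u; apply: kmodel_next_eq => l; rewrite /= /nextP; case: unlift => [j|];
    rewrite /= !ffunE ?(hsbar1 H_cohomology x_basis) ?(hbar1 H_cohomology x_basis) ?(km_one PG) //.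
  rewrite (bigD1 l) //= mul1r (hcoord_x x_basis) eqxx scale1r big1 ?addr0 //.
  by move=> h /negPf hl; rewrite mul1r (hcoord_x x_basis) eq_sym hl scale0r.
- move=> i u; case: (unliftP ord_max i) => [i' ->|->]; last exact: nextG_max2.
  by apply: kmodel_next_eq => l; rewrite /= /nextG liftK /= !ffunE (km_diag PG) ?scaler0 ?oppr0.
- move=> i j u; rewrite /=.
  case: (unliftP ord_max i) => [i' ->|->]; case: (unliftP ord_max j) => [j' ->|->];
    rewrite ?nextG_max ?nextG_max2 //.
  by apply: kmodel_next_eq => h; rewrite /nextG !liftK /= !ffunE (km_sym PG).
- move=> i j y u /=.
  case: (unliftP ord_max i) => [i' ->|->]; case: (unliftP ord_max j) => [j' ->|->];
    rewrite ?nextG_max ?nextG_max2 ?link_slide //.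
  apply: kmodel_next_eq => h; rewrite /nextG /nextP !liftK /= !ffunE.
    by rewrite !linearZ /= (km_slide PG).
  by rewrite !(linearN (P _ _)) (km_slide PG).
Qed.

End Step.
End Model.

(** * The Kriz algebra acting on the models *)

Section EndAlgebra.

Variables (V : vectType rat) (V_proper : (0 < dim V)%N).

Definition end_ring : nzRingType := lfun_comp_nzRingType V_proper.
Definition end_lalg : lalgType rat :=
  HB.pack 'End(V) end_ring
    (GRing.Lmodule_isLalgebra.Build rat end_ring (fun k x y => comp_lfunZl k x y)).
Definition end_alg : algType rat :=
  HB.pack 'End(V) end_lalg
    (GRing.Lalgebra_isAlgebra.Build rat end_lalg (fun k x y => comp_lfunZr k x y)).

End EndAlgebra.

Section Model.

Variables (m b : nat) (H : falgType rat) (gr : nat -> {vspace H}).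
Hypothesis H_cohomology : connected_PD_algebra m gr.
Variables (w : H) (x : 'I_b.+1 -> H) (deg : 'I_b.+1 -> nat).
Hypothesis x_basis : homogeneous_basis m gr w x deg.

Local Notation hcoord := (hcoord x).
Local Notation hbar := (hbar x deg).
Local Notation hsbar := (hsbar x deg).
Local Notation kmodel := (kmodel x deg).

(* t : 'I_k -> klabel k stands for the monomial whose factor at j is p_j^*(x_h) if
   t j = inl h and G_aj if t j = inr a. *)
Definition klabel (k : nat) : finType := ('I_b.+1 + 'I_k)%type.

Definition admissible k (t : 'I_k -> klabel k) : bool :=
  [forall j, if t j is inr a then (a < j)%N else true].

Section Vectors.

Variables (k : nat) (V : lmodType rat).
Variables (P : 'I_k -> H -> {linear V -> V}) (G : 'I_k -> 'I_k -> {linear V -> V}).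

Definition kop (t : 'I_k -> klabel k) (v : V) (j : 'I_k) : V :=
  match t j with inl h => P j (x h) v | inr a => G a j v end.

Definition kvec (vac : V) (t : 'I_k -> klabel k) : V := foldl (kop t) vac (enum 'I_k).

(** Independence in dual form: it passes from k to k + 1 points by composing functionals, and it
    directly supplies the coordinate functions used later. *)
Definition dual_vectors (vac : V) : Prop :=
  forall t0, admissible t0 -> exists phi : {linear V -> rat^o},
    forall t, admissible t -> phi (kvec vac t) = [forall j, t j == t0 j]%:R.

End Vectors.

(** The default [inl ord0] is not reached for admissible labels: an old point cannot have the new
    point as its smaller neighbour. *)
Definition restrict_label k (t : 'I_k.+1 -> klabel k.+1) (j : 'I_k) : klabel k :=
  match t (lift ord_max j) with
  | inl h => inl h
  | inr a => if unlift ord_max a is Some a' then inr a' else inl ord0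
  end.

Lemma admissible_lift k (t : 'I_k.+1 -> klabel k.+1) j a : admissible t ->
  t j = inr a -> exists a', a = lift ord_max a'.
Proof.
move/forallP/(_ j) => tj e; move: tj; rewrite e => aj.
case: (unliftP ord_max a) => [a' ->|ea]; first by exists a'.
by move: aj; rewrite ea /= ltnNge -ltnS ltn_ord.
Qed.

Lemma restrict_admissible k (t : 'I_k.+1 -> klabel k.+1) :
  admissible t -> admissible (restrict_label t).
Proof.
move=> ta; apply/forallP => j; rewrite /restrict_label.
case e : (t _) => [//|a]; have [a' ea] := admissible_lift ta e.
move/forallP/(_ (lift ord_max j)): ta; rewrite e ea liftK.
by rewrite !lift_max.
Qed.

Lemma restrict_label_eq k (t t0 : 'I_k.+1 -> klabel k.+1) :
  admissible t -> admissible t0 ->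
  [forall j, t j == t0 j] =
  (t ord_max == t0 ord_max) && [forall j, restrict_label t j == restrict_label t0 j].
Proof.
move=> ta t0a; apply/forallP/andP => [e|[e1 /forallP e2] j].
  by split=> //; apply/forallP => j; rewrite /restrict_label (eqP (e _)).
case: (unliftP ord_max j) => [j' ->|-> //].
have := e2 j'; rewrite /restrict_label.
case e : (t _) => [h|a]; case e0 : (t0 _) => [h0|a0] //.
- by have [a0' ->] := admissible_lift t0a e0; rewrite liftK.
- by have [a' ->] := admissible_lift ta e; rewrite liftK.
have [a0' ->] := admissible_lift t0a e0; have [a' ->] := admissible_lift ta e.
by rewrite !liftK => /eqP [->].
Qed.

Lemma enum_ord_lift k : enum 'I_k.+1 = rcons (map (lift ord_max) (enum 'I_k)) ord_max.
Proof.
rewrite enum_ordSr; congr rcons; apply: eq_map => j.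
by apply/ord_inj; rewrite lift_max.
Qed.

Section Step.

Variables (k : nat) (V : lmodType rat) (P : 'I_k -> H -> {linear V -> V}).
Variables (G : 'I_k -> 'I_k -> {linear V -> V}).
Hypothesis PG : kmodel P G.

Local Notation nextP := (nextP x deg P).
Local Notation nextG := (nextG x deg P G).

Definition next_vac (v : V) : kmodel_next b k V :=
  ([ffun h => (h == ord0)%:R *: v], [ffun=> 0]).

Lemma kop_lift t v j : admissible t ->
  kop nextP nextG t (next_vac v) (lift ord_max j) = next_vac (kop P G (restrict_label t) v j).
Proof.
move=> ta; rewrite /kop /restrict_label; case e : (t _) => [h|a].
  apply: kmodel_next_eq => l; rewrite /= /(nextP _ _) liftK /= !ffunE ?linear0 //.
  rewrite linearZ /=.
  have [->|_] := eqVneq l ord0; last by rewrite !scale0r.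
  by rewrite (deg0 H_cohomology x_basis).
have [a' ea] := admissible_lift ta e; rewrite ea liftK.
apply: kmodel_next_eq => l; rewrite /= /(nextG _ _) !liftK /= !ffunE ?linear0 ?oppr0 //.
have [->|_] := eqVneq l ord0; last by rewrite !scale0r linear0 scaler0.
by rewrite (deg0 H_cohomology x_basis) !scale1r.
Qed.

(** The new point is the last one applied. Until then the vector has the form 1 (x) u, on which the
    last factor produces x_h (x) u or the copy of u at one edge. *)
Lemma kvec_next v t : admissible t -> kvec nextP nextG (next_vac v) t =
  let u := kvec P G v (restrict_label t) in
  match t ord_max with
  | inl h => ([ffun l => (l == h)%:R *: u], [ffun=> 0])
  | inr a => ([ffun=> 0], [ffun l => (lift ord_max l == a)%:R *: u])
  end.
Proof.
move=> ta; rewrite /kvec enum_ord_lift foldl_rcons.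
have -> s : foldl (kop nextP nextG t) (next_vac v) (map (lift ord_max) s) =
    next_vac (foldl (kop P G (restrict_label t)) v s).
  by elim: s v => //= j s IH v; rewrite kop_lift.
move: (foldl _ _ _) => u /=; rewrite {1}/kop; case e : (t _) => [h|a].
  apply: kmodel_next_eq => l; rewrite /= /(nextP _ _) unlift_none /= !ffunE ?linear0 //.
  rewrite (bigD1 ord0) //= big1 => [|h' /negPf h'0]; rewrite ffunE ?h'0 ?scale0r ?scaler0 //.
  by rewrite (hb_first x_basis) mulr1 (hcoord_x x_basis) eqxx scale1r addr0.
have [a' ->] := admissible_lift ta e; rewrite /= nextG_max.
have -> : link x P G a' (next_vac u) = ([ffun=> 0], [ffun l => (l == a')%:R *: u]).
  apply: kmodel_next_eq => l; rewrite /= !ffunE // linear0 subr0.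
  rewrite /attach [X in _ + X]big1 => [|j _]; last by rewrite ffunE linear0.
  rewrite (bigD1 ord0) //= big1 => [|h' /negPf h'0]; rewrite ffunE.
    by rewrite (hb_first x_basis) (km_one PG) eqxx scale1r !addr0.
  by rewrite h'0 scale0r linear0.
by apply: kmodel_next_eq => l; rewrite /= !ffunE // (inj_eq lift_inj).
Qed.

(** The last label of [t0] selects a component of the direct sum; the functional reads that
    component with the old functional for the restricted label. *)
Lemma dual_vectors_next v : dual_vectors P G v -> dual_vectors nextP nextG (next_vac v).
Proof.
move=> dual t0 t0a; have [phi phiE] := dual _ (restrict_admissible t0a).
case e0 : (t0 ord_max) => [h0|a0].
  have lin : linear (fun u : kmodel_next b k V => phi (u.1 h0) : rat^o).
    by move=> a u u'; rewrite /= !ffunE linearP.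
  pose L := GRing.isLinear.Build _ _ _ _ _ lin.
  pose psi : {linear kmodel_next b k V -> rat^o} := HB.pack (fun u : kmodel_next b k V => phi (u.1 h0) : rat^o) L.
  exists psi => t ta; rewrite kvec_next // (restrict_label_eq ta t0a) e0 /=.
  case: (t ord_max) => [h|a] /=; rewrite !ffunE ?linear0 //.
  rewrite linearZ /= phiE ?restrict_admissible //.
  by rewrite [inl h == _]/(_ == _) /= eq_sym; case: eqP; rewrite ?scale1r ?scale0r.
have [a0' ea0] := admissible_lift t0a e0.
have lin : linear (fun u : kmodel_next b k V => phi (u.2 a0') : rat^o).
  by move=> a u u'; rewrite /= !ffunE linearP.
pose L := GRing.isLinear.Build _ _ _ _ _ lin.
pose psi : {linear kmodel_next b k V -> rat^o} := HB.pack (fun u : kmodel_next b k V => phi (u.2 a0') : rat^o) L.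
exists psi => t ta; rewrite kvec_next // (restrict_label_eq ta t0a) e0 /=.
case: (t ord_max) => [h|a] /=; rewrite !ffunE ?linear0 //.
rewrite linearZ /= phiE ?restrict_admissible // ea0 eq_sym.
by rewrite [inr a == _]/(_ == _) /=; case: eqP; rewrite ?scale1r ?scale0r.
Qed.

End Step.

Lemma kmodel_exists k : exists (V : vectType rat) (P : 'I_k -> H -> {linear V -> V})
  (G : 'I_k -> 'I_k -> {linear V -> V}) (vac : V), kmodel P G /\ dual_vectors P G vac.
Proof.
elim: k => [|k [V [P [G [vac [PG dual]]]]]].
  exists (rat^o : vectType rat), (fun _ _ => idfun), (fun _ _ => idfun), 1.
  split; first by split=> [][].
  move=> t0 _; exists idfun => t _; rewrite /kvec enum_ord0 /=.
  by case: forallP => // [][] [].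
exists ({ffun 'I_b.+1 -> V} * {ffun 'I_k -> V})%type,
  (fun i y => nextP x deg P i y), (fun i j => nextG x deg P G i j), (next_vac k vac).
split; first exact: (kmodel_step H_cohomology x_basis PG).
exact: dual_vectors_next.
Qed.

Variable n : nat.
Hypothesis m_gt0 : (0 < m)%N.

Local Notation kriz := (kriz m n gr).
Local Notation kP := (kP m gr).
Local Notation kG := (kG m gr).

Definition kfactor (j : 'I_n) (l : klabel n) : kriz :=
  match l with inl h => kP j (x h) | inr a => kG a j end.

(** The factors stand in decreasing order of the points, so that, acting on a vector, they are
    applied in increasing order, as in [kvec]. *)
Definition kmon (t : 'I_n -> klabel n) : kriz :=
  \prod_(j <- rev (enum 'I_n)) kfactor j (t j).

Section Representation.

Variables (V : vectType rat) (P : 'I_n -> H -> {linear V -> V}).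
Variables (G : 'I_n -> 'I_n -> {linear V -> V}).
Hypotheses (PG : kmodel P G) (V_proper : (0 < dim V)%N).

Local Notation A := (end_alg V_proper).

Definition gen_end (g : kgen n H) : A :=
  match g with
  | inl (i, y) => linfun (P i y)
  | inr (i, j) => linfun (G i j)
  end.

Definition kend : freealg (kgen n H) -> A := freealg_map gen_end.

Lemma kend_var g : kend (freealg_var g) = gen_end g.
Proof. exact: freealg_map_var. Qed.

Lemma kendB u v : kend (u - v) = kend u - kend v.
Proof. by rewrite /kend raddfB. Qed.

Lemma kendD u v : kend (u + v) = kend u + kend v.
Proof. by rewrite /kend raddfD. Qed.

Lemma kendM u v : kend (u * v) = kend u * kend v.
Proof. by rewrite /kend rmorphM. Qed.

Lemma kend1 : kend 1 = 1.
Proof. by rewrite /kend rmorph1. Qed.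

Lemma kendZ a u : kend (a *: u) = a *: kend u.
Proof. exact: freealg_mapZ. Qed.

Lemma end_algM (f g : A) (v : V) :
  fun_of_lfun (f * g : 'End(V)) v = fun_of_lfun (f : 'End(V)) (fun_of_lfun (g : 'End(V)) v).
Proof. exact: comp_lfunE. Qed.

Lemma end_algZ a (f : A) (v : V) :
  fun_of_lfun (a *: f : 'End(V)) v = a *: fun_of_lfun (f : 'End(V)) v.
Proof. exact: scale_lfunE. Qed.

Lemma end_algD (f g : A) (v : V) : fun_of_lfun (f + g : 'End(V)) v =
  fun_of_lfun (f : 'End(V)) v + fun_of_lfun (g : 'End(V)) v.
Proof. exact: add_lfunE. Qed.

Lemma end_algN (f : A) (v : V) :
  fun_of_lfun (- f : 'End(V)) v = - fun_of_lfun (f : 'End(V)) v.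
Proof. exact: opp_lfunE. Qed.

Lemma gen_endP i y v : fun_of_lfun (gen_end (inl (i, y)) : 'End(V)) v = P i y v.
Proof. exact: lfunE. Qed.

Lemma gen_endG i j v : fun_of_lfun (gen_end (inr (i, j)) : 'End(V)) v = G i j v.
Proof. exact: lfunE. Qed.

Definition end_algE := (end_algM, end_algZ, end_algD, end_algN, gen_endP, gen_endG).

Lemma kmodelP_comm i j y z d d' u : y \in gr d -> z \in gr d' ->
  P j z (P i y u) = (-1) ^+ (d * d')%N *: P i y (P j z u).
Proof.
move=> yd zd; rewrite !(kmodelP_sum x_basis PG i y) linear_sum scaler_sumr.
apply: eq_bigr => h _; rewrite linearZ [RHS]scalerA mulrC -scalerA /=.
have [<-|/(hcoord_homog H_cohomology x_basis yd) ->] := eqVneq (deg h) d; last by rewrite !scale0r.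
rewrite (km_PP PG) (hsbar_homog H_cohomology x_basis _ zd) (kmodelPZ PG).
by rewrite [X in _ = _ *: X]scalerA -exprD addnn -signr_odd odd_double scale1r.
Qed.

Lemma sign_2m1 c : (-1) ^+ (c * (2 * m - 1))%N = (-1) ^+ c :> rat.
Proof.
rewrite -signr_odd oddM oddB ?muln_gt0 ?m_gt0 // mul2n odd_double /= andbT.
exact: signr_odd.
Qed.

(** Only the commutation relation involves degrees, and on homogeneous classes the parity
    automorphism is exactly the sign it requires. *)
Lemma kend_krel u : krel m gr u -> kend u = 0.
Proof.
case=> {u} [i a y z|i y z|i|g g' d d' gd gd'|i|i j|i j y ij|i j k ij jk];
  rewrite ?kendB ?kendD ?kendZ ?kendM ?kendB ?kendM ?kend1 ?kend_var;
  apply/lfunP => v; rewrite ?end_algE ?zero_lfunE.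
- by rewrite (km_lin PG) subrr.
- by rewrite (km_mul PG) subrr.
- by rewrite (km_one PG) id_lfunE subrr.
- apply/eqP; rewrite subr_eq0; apply/eqP.
  case: g gd => [[i y]|[i j]] /= gd; case: g' gd' => [[i' z]|[i' j']] /= gd'; rewrite !end_algE.
  + exact: kmodelP_comm.
  + by rewrite (km_GP PG) (hbar_homog H_cohomology x_basis gd) (kmodelPZ PG) gd' sign_2m1.
  + rewrite (km_GP PG) (hbar_homog H_cohomology x_basis gd') (kmodelPZ PG) gd mulnC sign_2m1.
    by rewrite scalerA -exprD addnn -signr_odd odd_double scale1r.
  + by rewrite (km_GG PG) gd gd' sign_2m1 -[X in _ ^+ X]mul1n sign_2m1 expr1 scaleN1r.
- by rewrite (km_diag PG).
- by rewrite (km_sym PG) subrr.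
- by rewrite (km_slide PG) subrr.
- by rewrite (km_arnold PG) subrr.
Qed.

Lemma kend_ideal u : gen_ideal (krel m gr) u -> kend u = 0.
Proof.
elim=> {u} [u /kend_krel //||u v _ u0 _ v0|u v _ v0|u v _ u0].
- by rewrite /kend raddf0.
- by rewrite kendD u0 v0 addr0.
- by rewrite kendM v0 mulr0.
- by rewrite kendM u0 mul0r.
Qed.

Definition kriz_act (e : kriz) (v : V) : V := fun_of_lfun (kend (prepr e) : 'End(V)) v.

Lemma kriz_act_ppi u v : kriz_act (ppi (krel m gr) u) v = fun_of_lfun (kend u : 'End(V)) v.
Proof.
rewrite /kriz_act; congr (fun_of_lfun _ v); apply/eqP; rewrite -subr_eq0 -kendB.
by apply/eqP/kend_ideal/ppiP; rewrite ppi_repr.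
Qed.

Lemma kriz_act_linear a e f v : kriz_act (a *: e + f) v = a *: kriz_act e v + kriz_act f v.
Proof.
rewrite -[e]ppi_repr -[f]ppi_repr -ppiZ -raddfD /= !kriz_act_ppi.
by rewrite kendD kendZ end_algE end_algE.
Qed.

Lemma kriz_actM e f v : kriz_act (e * f) v = kriz_act e (kriz_act f v).
Proof.
rewrite -[e]ppi_repr -[f]ppi_repr -rmorphM /= !kriz_act_ppi.
by rewrite kendM end_algE.
Qed.

Lemma kriz_act1 v : kriz_act 1 v = v.
Proof. by rewrite -(rmorph1 (ppi (krel m gr))) kriz_act_ppi kend1 id_lfunE. Qed.

Lemma kriz_act_factor t j v : kriz_act (kfactor j (t j)) v = kop P G t v j.
Proof. by rewrite /kop; case: (t j) => [h|a]; rewrite kriz_act_ppi kend_var end_algE. Qed.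

Lemma kriz_act_mon t v : kriz_act (kmon t) v = kvec P G v t.
Proof.
rewrite /kmon /kvec; elim: (enum 'I_n) v => [|j s IH] v; first by rewrite big_nil kriz_act1.
by rewrite rev_cons big_rcons /= kriz_actM kriz_act_factor IH.
Qed.

End Representation.

Lemma kmon_dual (t0 : 'I_n -> klabel n) : admissible t0 ->
  exists phi : kriz -> rat,
    (forall a e f, phi (a *: e + f) = a * phi e + phi f) /\
    forall t, admissible t -> phi (kmon t) = [forall j, t j == t0 j]%:R.
Proof.
move=> t0a; have [V [P [G [vac [PG dual]]]]] := kmodel_exists n.
have [psi psiE] := dual t0 t0a.
have V_proper : (0 < dim V)%N.
  rewrite lt0n; apply/eqP => V0; have := psiE t0 t0a.
  have -> : kvec P G vac t0 = 0.
    have /eqP fullv0 : fullv == 0%VS :> {vspace V} by rewrite -dimv_eq0 dimvf V0.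
    by apply/eqP; rewrite -memv0 -fullv0 memvf.
  rewrite linear0; have -> : [forall j, t0 j == t0 j] by apply/forallP.
  by move/esym/eqP; rewrite oner_eq0.
exists (fun e => psi (kriz_act P G V_proper e vac)); split=> [a e f|t ta].
  by rewrite (kriz_act_linear PG) linearP.
by rewrite (kriz_act_mon PG) psiE.
Qed.

End Model.

(** * Spanning by the canonical monomials *)

Section LinearSpan.

Variable V : lmodType rat.
Implicit Types (S : V -> Prop) (e f : V).

Lemma lspan0 S : lspan S 0.
Proof. by exists [::]; rewrite ?big_nil. Qed.

Lemma lspan_lin S a e f : lspan S e -> lspan S f -> lspan S (a *: e + f).
Proof.
case=> r rS -> [r' r'S ->].
exists ([seq (a * c.1, c.2) | c <- r] ++ r') => [c|].
  by rewrite mem_cat => /orP[/mapP[c' /rS ? ->]|/r'S].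
rewrite big_cat big_map /= scaler_sumr; congr (_ + _).
by apply: eq_bigr => c _; rewrite scalerA.
Qed.

Lemma lspanZ S a e : lspan S e -> lspan S (a *: e).
Proof. by move=> Se; rewrite -[_ *: _]addr0; apply/lspan_lin/lspan0. Qed.

Lemma lspanD S e f : lspan S e -> lspan S f -> lspan S (e + f).
Proof. by move=> Se Sf; rewrite -[e]scale1r; apply: lspan_lin. Qed.

Lemma lspan_base S e : S e -> lspan S e.
Proof. by move=> Se; exists [:: (1, e)] => [c /[1!inE] /eqP ->|]; rewrite ?big_seq1 ?scale1r. Qed.

Lemma lspan_sum S (I : eqType) (r : seq I) (P : pred I) (F : I -> V) :
  (forall i, i \in r -> P i -> lspan S (F i)) -> lspan S (\sum_(i <- r | P i) F i).
Proof.
elim: r => [|i r IH] SF; first by rewrite big_nil; apply: lspan0.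
have SF' : lspan S (\sum_(i <- r | P i) F i).
  by apply: IH => j jr; apply: SF; rewrite inE jr orbT.
by rewrite big_cons; case: ifP => // Pi; apply: lspanD => //; apply: SF; rewrite ?inE ?eqxx.
Qed.

Lemma lspan_ind S (K : V -> Prop) : K 0 -> (forall a e f, K e -> K f -> K (a *: e + f)) ->
  (forall e, S e -> K e) -> forall e, lspan S e -> K e.
Proof.
move=> K0 Klin SK e [r rS ->]; elim: r rS => [|c r IH] rS; first by rewrite big_nil.
rewrite big_cons; apply: Klin; first by apply/SK/rS/mem_head.
by apply: IH => c' c'r; apply: rS; rewrite inE c'r orbT.
Qed.

Lemma lspan_trans S S' e : (forall f, S f -> lspan S' f) -> lspan S e -> lspan S' e.
Proof.
by move=> SS'; apply: lspan_ind => //; [apply: lspan0 | move=> *; apply: lspan_lin].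
Qed.

End LinearSpan.

Lemma lspan_map (V W : lmodType rat) (f : V -> W) (S : V -> Prop) (S' : W -> Prop) e :
  (forall a u v, f (a *: u + v) = a *: f u + f v) ->
  (forall u, S u -> lspan S' (f u)) -> lspan S e -> lspan S' (f e).
Proof.
move=> flin SS'; have f0 : f 0 = 0.
  by have := flin (-1) 0 0; rewrite scaler0 addr0 scaleN1r addNr.
apply: (@lspan_ind _ S (fun u => lspan S' (f u))) => [|a u v|//].
  by rewrite f0; apply: lspan0.
by rewrite flin => Su Sv; apply: lspan_lin.
Qed.

Lemma freealg_ind (I : choiceType) (K : freealg I -> Prop) :
  K 0 -> K 1 -> (forall a u v, K u -> K v -> K (a *: u + v)) ->
  (forall i u, K u -> K (freealg_var i * u)) -> forall u, K u.
Proof.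
move=> K0 K1 Klin KM u; rewrite (monalgE u).
elim/big_ind: _ => // [v v' Kv Kv'|s _].
  by have := Klin 1 v v' Kv Kv'; rewrite scale1r.
have -> : << u@_s *g s >> = u@_s *: (<< s >> : freealg I).
  rewrite [RHS](_ : _ = freealg_scale u@_s << s >>) // freealg_scale.unlock.
  by apply/malgP => k; rewrite mcoeffZ !mcoeffU mulr_natr.
rewrite -[_ *: _]addr0; apply: Klin => //; case: s => s; elim: s => [|i s IH].
  have -> : << FMonom [::] >> = 1 :> freealg I; last exact: K1.
  rewrite [RHS](_ : _ = freealg_one I) // freealg_one.unlock.
  by congr << _ >>; apply/val_inj; rewrite /= fm1.
have -> : << FMonom (i :: s) >> = freealg_var i * (<< FMonom s >> : freealg I); last exact: KM.
rewrite [RHS](_ : _ = freealg_mul (freealg_var i) << FMonom s >>) //.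
rewrite freealg_mul.unlock freealg_var.unlock malgM_def fgmulUU mulr1.
by congr << _ >>; apply/val_inj; rewrite /= fmM fmU.
Qed.

Section Spanning.

Variables (m b : nat) (H : falgType rat) (gr : nat -> {vspace H}).
Hypothesis H_cohomology : connected_PD_algebra m gr.
Variables (w : H) (x : 'I_b.+1 -> H) (deg : 'I_b.+1 -> nat).
Hypothesis x_basis : homogeneous_basis m gr w x deg.
Variable n : nat.
Hypothesis m_gt0 : (0 < m)%N.

Local Notation kriz := (kriz m n gr).
Local Notation kP := (@kP m n H gr).
Local Notation kG := (@kG m n H gr).
Local Notation kG_sym := (@Defs.kG_sym m n H gr).
Local Notation kG_anticomm := (@Defs.kG_anticomm m n H gr m_gt0).
Local Notation kG_arnold := (@Defs.kG_arnold m n H gr m_gt0).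
Local Notation klabel := (klabel b).
Local Notation kfactor := (@kfactor m b H gr x n).
Local Notation kmon := (@kmon m b H gr x n).

Lemma kP_comm i j y z d d' : y \in gr d -> z \in gr d' ->
  kP j z * kP i y = (-1) ^+ (d * d')%N *: (kP i y * kP j z).
Proof. exact: (@kgen_comm m n H gr (inl (i, y)) (inl (j, z))). Qed.

Lemma kGP_comm i a l y d : y \in gr d ->
  kG a i * kP l y = (-1) ^+ d *: (kP l y * kG a i).
Proof.
move=> yd; rewrite -(sign_2m1 m_gt0 d).
exact: (@kgen_comm m n H gr (inl (l, y)) (inr (a, i)) d (2 * m - 1) yd erefl).
Qed.

Lemma kPG_comm i a l y d : y \in gr d ->
  kP l y * kG a i = (-1) ^+ d *: (kG a i * kP l y).
Proof.
by move=> yd; rewrite (kGP_comm _ _ _ yd) scalerA -expr2 sqrr_sign scale1r.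
Qed.

Lemma kG_sq i j : kG i j * kG i j = 0.
Proof.
have /eqP := kG_anticomm i j i j.
by rewrite -subr_eq0 opprK -mulr2n -scaler_nat scaler_eq0 /= => /eqP.
Qed.

(** The Arnold relation as a rewriting rule: a fork at [r] becomes a difference of two paths
    starting at [r]. When vertices coincide both sides vanish. *)
Lemma kG_fork r a c : kG r a * kG r c = kG r a * kG a c - kG r c * kG c a.
Proof.
have [->|ra] := eqVneq r a; first by rewrite kGxx !mul0r (kG_sym a c) kG_sq subr0.
have [->|rc] := eqVneq r c; first by rewrite kGxx !mul0r mulr0 (kG_sym a c) kG_sq subrr.
have [->|ac] := eqVneq a c; first by rewrite kG_sq subrr.
rewrite -(kG_sym r a) -(kG_sym r c) (kG_arnold ac) 1?[_ == r]eq_sym //.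
rewrite (kG_anticomm c r a c) (kG_anticomm a r a c).
by rewrite opprK addrC (kG_sym a c).
Qed.

(** Bidegree is a relation and not a function: no grading of the quotient is constructed, only the
    way in which an element is generated is recorded. *)
Inductive khom : nat -> nat -> kriz -> Prop :=
| khom1 : khom 0 0 1
| khom0 q k : khom q k 0
| khom_lin a q k e f : khom q k e -> khom q k f -> khom q k (a *: e + f)
| khomP i y d q k e : y \in gr d -> khom q k e -> khom q (d + k) (kP i y * e)
| khomG a i q k e : khom q k e -> khom q.+1 (2 * m - 1 + k) (kG a i * e).

(* The span of the products f_(j-1) ... f_0 of total bidegree (q, k) in which f_i is either
   p_i^*(y) or G_ai with a < i. *)
Inductive kspan : nat -> nat -> nat -> kriz -> Prop :=
| kspan1 : kspan 0 0 0 1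
| kspan0 j q k : kspan j q k 0
| kspan_lin a j q k e f : kspan j q k e -> kspan j q k f -> kspan j q k (a *: e + f)
| kspanP (i : 'I_n) y d q k e : y \in gr d -> kspan i q k e ->
    kspan i.+1 q (d + k) (kP i y * e)
| kspanG (a i : 'I_n) q k e : (a < i)%N -> kspan i q k e ->
    kspan i.+1 q.+1 (2 * m - 1 + k) (kG a i * e).

Lemma kspanZ a j q k e : kspan j q k e -> kspan j q k (a *: e).
Proof. by move=> Ke; rewrite -[_ *: _]addr0; apply/kspan_lin/kspan0. Qed.

Lemma kspanD j q k e f : kspan j q k e -> kspan j q k f -> kspan j q k (e + f).
Proof. by move=> Ke Kf; rewrite -[e]scale1r; apply: kspan_lin. Qed.

Lemma kspanN j q k e : kspan j q k e -> kspan j q k (- e).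
Proof. by rewrite -scaleN1r; apply: kspanZ. Qed.

(** A generator moves past the leading factor up to sign unless it belongs to the same top point.
    There two classes multiply, a class meeting an edge slides to the smaller end, and two edges are
    resolved by [kG_fork] into an edge at the top point times a generator below it. *)
Lemma kspan_mul j q k e : kspan j q k e ->
  (forall (i : 'I_n) y d, (i < j)%N -> y \in gr d -> kspan j q (d + k) (kP i y * e)) /\
  (forall a i : 'I_n, (a < j)%N -> (i < j)%N -> kspan j q.+1 (2 * m - 1 + k) (kG a i * e)).
Proof.
elim=> {j q k e} [|j q k|c j q k e f _ [IHeP IHeG] _ [IHfP IHfG]
  |i y d q k e yd Ke [IHP IHG]|a i q k e ai Ke [IHP IHG]].
- by split.
- by split=> *; rewrite mulr0; apply: kspan0.
- split=> [i y d ij yd|a i aj ij]; rewrite mulrDr -palg_scalerAr; apply: kspan_lin.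
  + exact: IHeP.
  + exact: IHfP.
  + exact: IHeG.
  + exact: IHfG.
- split=> [i' y' d'|a' i'].
    rewrite ltnS leq_eqVlt => /orP[/eqP/val_inj ->|i'i] yd'.
      rewrite mulrA -rmorphM addnA; apply: kspanP => //; exact: (gr_mul H_cohomology).
    rewrite mulrA (kP_comm i i' yd yd') -palg_scalerAl -mulrA addnCA.
    by apply/kspanZ/kspanP/IHP.
  have Gold (a1 i1 : 'I_n) : (a1 < i)%N -> (i1 < i)%N ->
      kspan i.+1 q.+1 (2 * m - 1 + (d + k)) (kG a1 i1 * (kP i y * e)).
    move=> a1i i1i; rewrite mulrA (kGP_comm _ _ _ yd) -palg_scalerAl -mulrA addnCA.
    by apply/kspanZ/kspanP/IHG.
  have Gnew (a1 : 'I_n) : (a1 < i)%N -> kspan i.+1 q.+1 (2 * m - 1 + (d + k)) (kG a1 i * (kP i y * e)).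
    move=> a1i; rewrite mulrA (kGP_comm _ _ _ yd) kP_kG // (kPG_comm _ _ _ yd).
    by rewrite scalerA -expr2 sqrr_sign scale1r -mulrA; apply/kspanG/IHP.
  rewrite !ltnS (leq_eqVlt a') (leq_eqVlt i') => /orP[/eqP/val_inj ->|a'i] /orP[/eqP/val_inj ->|i'i].
  + by rewrite kGxx mul0r; apply: kspan0.
  + by rewrite -kG_sym; apply: Gnew.
  + exact: Gnew.
  + exact: Gold.
- split=> [i' y' d'|a' i'].
    have Pold (i1 : 'I_n) : (i1 < i)%N -> y' \in gr d' ->
        kspan i.+1 q.+1 (d' + (2 * m - 1 + k)) (kP i1 y' * (kG a i * e)).
      move=> i1i yd; rewrite mulrA (kPG_comm _ _ _ yd) -palg_scalerAl -mulrA addnCA.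
      by apply/kspanZ/kspanG/IHP.
    rewrite ltnS leq_eqVlt => /orP[/eqP/val_inj ->|i'i] yd'; last exact: Pold.
    by rewrite mulrA kP_kG -mulrA; apply: Pold.
  have Gold (a1 i1 : 'I_n) : (a1 < i)%N -> (i1 < i)%N ->
      kspan i.+1 q.+2 (2 * m - 1 + (2 * m - 1 + k)) (kG a1 i1 * (kG a i * e)).
    move=> a1i i1i; rewrite mulrA (kG_anticomm) mulNr -mulrA.
    by apply/kspanN/kspanG/IHG.
  have Gnew (a1 : 'I_n) : (a1 < i)%N ->
      kspan i.+1 q.+2 (2 * m - 1 + (2 * m - 1 + k)) (kG a1 i * (kG a i * e)).
    move=> a1i; rewrite mulrA (kG_sym i a1) (kG_sym i a) kG_fork mulrBl -!mulrA.
    rewrite (kG_sym a1 i) (kG_sym a i); apply: kspanD; last apply: kspanN; apply/kspanG/IHG => //.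
  rewrite !ltnS (leq_eqVlt a') (leq_eqVlt i') => /orP[/eqP/val_inj ->|a'i] /orP[/eqP/val_inj ->|i'i].
  + by rewrite kGxx mul0r; apply: kspan0.
  + by rewrite -kG_sym; apply: Gnew.
  + exact: Gnew.
  + exact: Gold.
Qed.

Lemma khom_kspan q k e : khom q k e -> kspan n q k e.
Proof.
elim=> {q k e} [|q k|a q k e f _ Ke _ Kf|i y d q k e yd _ Ke|a i q k e _ Ke].
(* In the normal form every point carries a factor, so 1 is written as the product of all
   p_i^*(1). *)
- suff : forall j, (j <= n)%N -> kspan j 0 0 1 by apply.
  elim=> [_|j IH jn]; first exact: kspan1.
  have g1 : 1 \in gr 0%N by rewrite (gr_connected H_cohomology) memv_line.
  by have := kspanP g1 (IH (ltnW jn) : kspan (Ordinal jn) _ _ _); rewrite rmorph1 mul1r.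
- exact: kspan0.
- exact: kspan_lin.
- by have [KP _] := kspan_mul Ke; apply: KP.
- by have [_ KG] := kspan_mul Ke; apply: KG.
Qed.

Definition label_q (l : klabel n) : nat := if l is inl _ then 0 else 1.
Definition label_deg (l : klabel n) : nat := if l is inl h then deg h else 2 * m - 1.

Definition mon_bidegree (t : 'I_n -> klabel n) (q k : nat) : Prop :=
  (\sum_j label_q (t j))%N = q /\ (\sum_j label_deg (t j))%N = k.

Lemma take_enum_ord (i : 'I_n) : take i.+1 (enum 'I_n) = rcons (take i (enum 'I_n)) i.
Proof. by rewrite (take_nth i) ?size_enum_ord // nth_ord_enum. Qed.

Lemma mem_take_enum_ord (j : nat) (i : 'I_n) : (i \in take j (enum 'I_n)) = (i < j)%N.
Proof. by rewrite in_take ?mem_enum // index_enum_ord. Qed.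

Lemma kspan_mon j q k e : kspan j q k e ->
  lspan (fun f => exists t : 'I_n -> klabel n,
    [/\ admissible t, (\sum_(i <- take j (enum 'I_n)) label_q (t i))%N = q,
      (\sum_(i <- take j (enum 'I_n)) label_deg (t i))%N = k
    & f = \prod_(i <- rev (take j (enum 'I_n))) kfactor i (t i)]) e.
Proof.
have upd (i : 'I_n) t l (R : Type) (F : 'I_n -> klabel n -> R) (idx : R) op s : i \notin s ->
    \big[op/idx]_(i' <- s) F i' (if i' == i then l else t i') = \big[op/idx]_(i' <- s) F i' (t i').
  by move=> si; apply: eq_big_seq => i'; case: eqP => // ->; rewrite (negPf si).
have fresh (i : 'I_n) : i \notin take i (enum 'I_n) by rewrite mem_take_enum_ord ltnn.
elim=> {j q k e} [|j q k|a j q k e f _ Ke _ Kf|i y d q k e yd _ Ke|a i q k e ai _ Ke].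
- apply: lspan_base; exists (fun=> inl ord0); rewrite take0 !big_nil; split=> //.
  exact/forallP.
- exact: lspan0.
- exact: lspan_lin.
- have E f : lspan (fun g => exists2 h, deg h = d & g = kP i (x h) * f) (kP i y * f).
    rewrite {1}(hcoord_homog_sum H_cohomology x_basis yd) raddf_sum mulr_suml.
    apply: lspan_sum => h _ /eqP hd; rewrite /= kPZ -palg_scalerAl.
    by apply/lspanZ/lspan_base; exists h.
  apply: (lspan_map (f := fun f => kP i y * f)) Ke => [c u v|_ [t [ta tq tk ->]]].
    by rewrite mulrDr palg_scalerAr.
  apply: lspan_trans (E _) => _ [h hd ->]; apply: lspan_base.
  exists (fun i' => if i' == i then inl h else t i'); rewrite take_enum_ord rev_rcons.
  rewrite !big_rcons big_cons (upd _ _ _ _ (fun=> label_q)) //.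
  rewrite (upd _ _ _ _ (fun=> label_deg)) // (upd _ _ _ _ kfactor) ?mem_rev //.
  rewrite /= eqxx /= addn0 tq tk hd addnC; split=> //.
  by apply/forallP => i'; case: eqP => // _; apply: (forallP ta).
- apply: (lspan_map (f := fun f => kG a i * f)) Ke => [c u v|_ [t [ta tq tk ->]]].
    by rewrite mulrDr palg_scalerAr.
  apply: lspan_base.
  exists (fun i' => if i' == i then inr a else t i'); rewrite take_enum_ord rev_rcons.
  rewrite !big_rcons big_cons (upd _ _ _ _ (fun=> label_q)) //.
  rewrite (upd _ _ _ _ (fun=> label_deg)) // (upd _ _ _ _ kfactor) ?mem_rev //.
  rewrite /= eqxx /= addn1 tq tk addnC; split=> //.
  by apply/forallP => i'; case: eqP => [-> //|_]; apply: (forallP ta).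
Qed.

Lemma khom_lspan q k e : khom q k e ->
  lspan (fun f => exists t, [/\ admissible t, mon_bidegree t q k & f = kmon t]) e.
Proof.
move/khom_kspan/kspan_mon; apply: lspan_trans => _ [t [ta tq tk ->]].
apply: lspan_base; exists t; move: tq tk; rewrite take_oversize ?size_enum_ord //.
by rewrite !big_enum.
Qed.

Lemma khomM q k q' k' e f : khom q k e -> khom q' k' f ->
  khom (q + q') (k + k') (e * f).
Proof.
move=> he hf; elim: he => {q k e} [|q k|a q k e e' _ IH _ IH'|i y d q k e yd _ IH|a i q k e _ IH].
- by rewrite mul1r.
- by rewrite mul0r; apply: khom0.
- by rewrite mulrDl -palg_scalerAl; apply: khom_lin.
- by rewrite -mulrA -addnA; apply: khomP.
- by rewrite -mulrA -addnA; apply: khomG.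
Qed.

Lemma khom_kP i y d : y \in gr d -> khom 0 d (kP i y).
Proof. by move=> yd; have := khomP i yd khom1; rewrite mulr1 addn0. Qed.

Lemma khom_kG a i : khom 1 (2 * m - 1) (kG a i).
Proof. by have := khomG a i khom1; rewrite mulr1 addn0. Qed.

Lemma khom_comm q k q' k' e f : khom q k e -> khom q' k' f ->
  e * f = (-1) ^+ (k * k')%N *: (f * e).
Proof.
have gen (g : kgen n H) d : kgen_deg m gr g d -> khom q' k' f ->
    ppi (krel m gr) (freealg_var g) * f
      = (-1) ^+ (d * k')%N *: (f * ppi (krel m gr) (freealg_var g)).
  move=> gd; elim=> {q' k' f} [|q' k'|a q' k' e1 f _ IH _ IH'|i y d' q' k' f yd _ IH|a i q' k' f _ IH].
  - by rewrite mul1r mulr1 muln0 scale1r.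
  - by rewrite mul0r mulr0 scaler0.
  - by rewrite mulrDr mulrDl -palg_scalerAr -palg_scalerAl IH IH' scalerDr !scalerA mulrC.
  - rewrite mulrA (@kgen_comm m n H gr (inl (i, y)) g d' d yd gd) -palg_scalerAl -mulrA.
    by rewrite IH -palg_scalerAr !mulrA !scalerA -exprD mulnDr (mulnC d').
  - rewrite mulrA (@kgen_comm m n H gr (inr (a, i)) g _ d erefl gd) -palg_scalerAl -mulrA.
    by rewrite IH -palg_scalerAr !mulrA !scalerA -exprD mulnDr (mulnC _ d).
move=> he hf; elim: he => {q k e} [|q k|a q k e e' _ IH _ IH'|i y d q k e yd _ IH|a i q k e _ IH].
- by rewrite mul1r mulr1 scale1r.
- by rewrite mul0r mulr0 scaler0.
- by rewrite mulrDl mulrDr -palg_scalerAr -palg_scalerAl IH IH' scalerDr !scalerA mulrC.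
- rewrite -mulrA IH -palg_scalerAr !mulrA (gen (inl (i, y)) d yd hf) -palg_scalerAl -mulrA.
  by rewrite !scalerA -exprD addnC -mulnDl.
- rewrite -mulrA IH -palg_scalerAr !mulrA (gen (inr (a, i)) _ erefl hf) -palg_scalerAl -mulrA.
  by rewrite !scalerA -exprD addnC -mulnDl.
Qed.

Lemma lspan_khom e : lspan (fun f => exists q k, khom q k f) e.
Proof.
rewrite -[e]ppi_repr; elim/freealg_ind: (prepr e) => [||a u v|g u].
- by rewrite raddf0; apply: lspan0.
- by rewrite rmorph1; apply: lspan_base; exists 0%N, 0%N; apply: khom1.
- by rewrite raddfD /= ppiZ; apply: lspan_lin.
rewrite rmorphM; apply: lspan_map => [a f f'|f [q [k hf]]].
  by rewrite mulrDr palg_scalerAr.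
case: g => [[i y]|[a i]]; last by apply: lspan_base; exists q.+1, (2 * m - 1 + k)%N; apply: khomG.
rewrite /= -[ppi _ _]/(kP i y) (hcoord_sum x_basis y) raddf_sum mulr_suml.
apply: lspan_sum => h _ _; rewrite /= kPZ -palg_scalerAl; apply/lspanZ/lspan_base.
by exists q, (deg h + k)%N; apply/khomP/hf/(hb_homog x_basis).
Qed.

Lemma lspan_kmon e : lspan (fun f => exists2 t, admissible t & f = kmon t) e.
Proof.
apply: lspan_trans (lspan_khom e) => f [q [k /khom_lspan]].
by apply: lspan_trans => _ [t [ta _ ->]]; apply: lspan_base; exists t.
Qed.

End Spanning.

(** * Forests as combinations of paths *)

Lemma perm_cons_swap (T : eqType) (a j : T) (s s' : seq T) :
  perm_eq s' (j :: s) -> perm_eq (a :: s') (j :: a :: s).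
Proof. by move=> /seq.permP e; apply/seq.permP => p; rewrite /= e /= addnCA. Qed.

Section Paths.

Variables (m b : nat) (H : falgType rat) (gr : nat -> {vspace H}).
Hypothesis H_cohomology : connected_PD_algebra m gr.
Variables (w : H) (x : 'I_b.+1 -> H) (deg : 'I_b.+1 -> nat).
Hypothesis x_basis : homogeneous_basis m gr w x deg.
Variable n : nat.
Hypothesis m_gt0 : (0 < m)%N.

Local Notation kriz := (kriz m n gr).
Local Notation kP := (@kP m n H gr).
Local Notation kG := (@kG m n H gr).
Local Notation kG_sym := (@Defs.kG_sym m n H gr).
Local Notation kG_anticomm := (@Defs.kG_anticomm m n H gr m_gt0).
Local Notation kG_arnold := (@Defs.kG_arnold m n H gr m_gt0).
Local Notation klabel := (klabel b).
Local Notation kfactor := (@kfactor m b H gr x n).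
Local Notation kmon := (@kmon m b H gr x n).
Local Notation khom := (@khom m H gr n).
Local Notation kact := (@kact m n H gr).

Fixpoint kpath (r : 'I_n) (s : seq 'I_n) : kriz :=
  if s is a :: s' then kG r a * kpath a s' else 1.

Definition kword (h : 'I_b.+1) (s : seq 'I_n) : kriz :=
  if s is v :: s' then kP v (x h) * kpath v s' else 1.

(** If [i] is the starting point, [kG_fork] gives the path with [j] inserted second and a term in
    which [j] hangs on the next vertex; otherwise the edge anticommutes past the first edge. Both
    leave a shorter path, and the starting point [r] never changes, so the mark of the word is
    preserved. *)
Lemma kpath_insert r s i j : i \in r :: s ->
  lspan (fun e => exists2 s', perm_eq s' (j :: s) & e = kpath r s') (kG i j * kpath r s).
Proof.
elim: s r i => [|a s IH] r i.
  rewrite inE => /eqP ->; apply: lspan_base; by exists [:: j].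
have sub e : lspan (fun e => exists2 s', perm_eq s' (j :: s) & e = kpath a s') e ->
    lspan (fun e => exists2 s', perm_eq s' (j :: a :: s) & e = kpath r s') (kG r a * e).
  apply: lspan_map => [c u v|_ [s' ss' ->]]; first by rewrite mulrDr palg_scalerAr.
  apply: lspan_base; exists (a :: s') => //.
  exact: perm_cons_swap.
rewrite inE; case/predU1P => [->|ias] /=.
  rewrite mulrA kG_fork // mulrBl -!mulrA; apply: lspanD; last first.
    by rewrite -scaleN1r; apply/lspanZ/sub/IH; apply: mem_head.
  by apply: lspan_base; exists (j :: a :: s).
rewrite mulrA kG_anticomm mulNr -scaleN1r -mulrA.
by apply/lspanZ/sub/IH.
Qed.

Lemma kpath_hom r s : khom (size s) (size s * (2 * m - 1)) (kpath r s).
Proof. by elim: s r => [|a s IH] r /=; [apply: khom1 | rewrite mulSn; apply: khomG]. Qed.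

Lemma kword_hom h s : s != [::] ->
  khom (size s).-1 (deg h + (size s).-1 * (2 * m - 1)) (kword h s).
Proof. by case: s => // v s _; apply/khomP/kpath_hom/(hb_homog x_basis). Qed.

Lemma kword_hom_ex h s : exists q k, khom q k (kword h s).
Proof.
have [->|s0] := eqVneq s [::]; first by exists 0%N, 0%N; apply: khom1.
by do 2!eexists; apply: kword_hom.
Qed.

Lemma kword_insert h s i j : i \in s ->
  lspan (fun e => exists2 s', perm_eq s' (j :: s) & e = kword h s') (kG i j * kword h s).
Proof.
case: s => [//|v s] ivs; rewrite /= mulrA (kGP_comm m_gt0 _ _ _ (hb_homog x_basis h)).
rewrite -palg_scalerAl -mulrA; apply: lspanZ; apply: lspan_map (kpath_insert _ ivs) => [c u u'|].
  by rewrite mulrDr palg_scalerAr.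
move=> _ [s' ss' ->]; apply: lspan_base; exists (v :: s') => //.
exact: perm_cons_swap.
Qed.

Lemma khom_prod (I : eqType) (r : seq I) (F : I -> kriz) :
  (forall i, exists q k, khom q k (F i)) -> exists q k, khom q k (\prod_(i <- r) F i).
Proof.
move=> hF; elim: r => [|i r [q [k IH]]]; first by exists 0%N, 0%N; rewrite big_nil; apply: khom1.
have [q' [k' hi]] := hF i; rewrite big_cons.
by exists (q' + q)%N, (k' + k)%N; apply: khomM.
Qed.

Section Forests.

Variables (l : nat) (hs : 'I_l -> 'I_b.+1).

Definition kforest (ws : 'I_l -> seq 'I_n) : kriz := \prod_(i < l) kword (hs i) (ws i).

Lemma forest_split (i0 : 'I_l) : exists s1 s2 : seq 'I_l,
  [/\ i0 \notin s1, i0 \notin s2 & forall F : 'I_l -> kriz,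
    \prod_i F i = (\prod_(i <- s1) F i) * (F i0 * \prod_(i <- s2) F i)].
Proof.
set r := index_enum 'I_l.
have E F : \prod_i F i = \prod_(i <- r) F i :> kriz by [].
have i0r : i0 \in r by rewrite mem_index_enum.
have ur : uniq r := index_enum_uniq 'I_l.
case/splitPr: i0r ur E => s1 s2.
rewrite -cat_rcons cat_uniq rcons_uniq => /and3P[/andP[i01 _] /hasPn i0r _] E.
exists s1, s2; split=> // [|F]; last by rewrite big_cat big_rcons /= mulrA.
by apply/negP => /i0r; rewrite mem_rcons mem_head.
Qed.

Definition update (ws : 'I_l -> seq 'I_n) (i0 : 'I_l) (s : seq 'I_n) (i : 'I_l) :=
  if i == i0 then s else ws i.

Lemma kforest_update ws i0 : exists A B, (exists q k, khom q k A) /\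
  forall s, kforest (update ws i0 s) = A * kword (hs i0) s * B.
Proof.
have [s1 [s2 [i01 i02 E]]] := forest_split i0.
exists (\prod_(i <- s1) kword (hs i) (ws i)), (\prod_(i <- s2) kword (hs i) (ws i)).
split=> [|s]; first by apply: khom_prod => i; apply: kword_hom_ex.
rewrite /kforest E mulrA /update eqxx; congr (_ * _ * _); apply: eq_big_seq => i;
  case: eqP => // ->.
  by rewrite (negPf i01).
by rewrite (negPf i02).
Qed.

Lemma update_id ws i0 : update ws i0 (ws i0) =1 ws.
Proof. by move=> i; rewrite /update; case: eqP => // ->. Qed.

Lemma eq_kforest ws ws' : ws =1 ws' -> kforest ws = kforest ws'.
Proof. by move=> e; apply: eq_bigr => i _; rewrite e. Qed.

Lemma kforest_mul ws i0 (g : kriz) d q (S : seq 'I_n -> Prop) : khom q d g ->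
  lspan (fun e => exists2 s, S s & e = kword (hs i0) s) (g * kword (hs i0) (ws i0)) ->
  lspan (fun e => exists2 s, S s & e = kforest (update ws i0 s)) (g * kforest ws).
Proof.
move=> hg gS; have [A [B [[q' [k hA]] E]]] := kforest_update ws i0.
rewrite -(eq_kforest (update_id ws i0)) E !mulrA (khom_comm hg hA) -!palg_scalerAl.
apply: lspanZ; rewrite -(mulrA A).
apply: (lspan_map (f := fun e => A * e * B)) gS => [c u v|_ [s Ss ->]].
  by rewrite mulrDr mulrDl -palg_scalerAr -palg_scalerAl.
by apply: lspan_base; exists s.
Qed.

Variables (t : 'I_n -> klabel n) (f : 'I_n -> 'I_l).
Hypothesis f_edge : forall j a, t j = inr a -> (a < j)%N /\ f a = f j.
Hypothesis f_root : forall j h, t j = inl h ->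
  h = hs (f j) /\ forall u : 'I_n, (u < j)%N -> f u != f j.

(** Points are added in increasing order. A class starts the word of its component, still empty
    because a root is the smallest point there; an edge attaches its point to a word that already
    contains the other end. *)
Lemma kmon_forest_prefix (j : nat) : (j <= n)%N ->
  lspan (fun e => exists2 ws : 'I_l -> seq 'I_n,
      forall i, perm_eq (ws i) [seq u <- take j (enum 'I_n) | f u == i]
    & e = kforest ws) (\prod_(i <- rev (take j (enum 'I_n))) kfactor i (t i)).
Proof.
elim: j => [_|j IH jn].
  rewrite take0 big_nil; apply: lspan_base; exists (fun=> [::]) => //.
  by rewrite /kforest big1.
have := IH (ltnW jn); set j' := Ordinal jn; rewrite -[j]/(nat_of_ord j') take_enum_ord.
rewrite rev_rcons big_cons; apply: lspan_map => [c u v|_ [ws wsP ->]].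
  by rewrite mulrDr palg_scalerAr.
have upd s : perm_eq s (j' :: ws (f j')) -> forall i,
    perm_eq (update ws (f j') s i) [seq u <- rcons (take j' (enum 'I_n)) j' | f u == i].
  move=> ss i; rewrite filter_rcons /update [f j' == i]eq_sym; case: eqP => [->|//].
  rewrite perm_sym perm_rcons perm_sym; apply: (perm_trans ss).
  by rewrite perm_cons.
apply: (lspan_trans (S := fun e => exists2 s, perm_eq s (j' :: ws (f j')) & e = kforest (update ws (f j') s))).
  by move=> _ [s ss ->]; apply: lspan_base; exists (update ws (f j') s) => //; apply: upd.
case e : (t j') => [h|a] /=.
  have [-> fu] := f_root e.
  have hg := @khom_kP m H gr n j' _ _ (hb_homog x_basis (hs (f j'))).
  apply: (kforest_mul (i0 := f j') hg).
  have -> : ws (f j') = [::].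
    apply/seq.perm_nilP; apply: perm_trans (wsP _) _;
      rewrite (eq_in_filter (a2 := pred0)) ?filter_pred0 // => u.
    by rewrite mem_take_enum_ord => /fu /negPf.
  by rewrite mulr1; apply: lspan_base; exists [:: j'] => //=; rewrite mulr1.
have [aj fa] := f_edge e.
apply: (kforest_mul (i0 := f j') (khom_kG _ _ a j')); apply: kword_insert.
by rewrite (perm_mem (wsP _)) mem_filter fa eqxx mem_take_enum_ord.
Qed.

Lemma kmon_forest : lspan (fun e => exists2 ws : 'I_l -> seq 'I_n,
    forall i, perm_eq (ws i) [seq u <- enum 'I_n | f u == i] & e = kforest ws) (kmon t).
Proof.
have := kmon_forest_prefix (leqnn n); rewrite take_oversize ?size_enum_ord //.
Qed.

End Forests.

Lemma kact_kpath s r v : kact s (kpath r v) = kpath (s r) (map s v).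
Proof.
elim: v r => [|a v IH] r /=; first exact: kact1.
by rewrite kactM // kact_kG // IH.
Qed.

Lemma kact_kword s h v : kact s (kword h v) = kword h (map s v).
Proof.
case: v => [|a v] /=; first exact: kact1.
by rewrite kactM // kact_kP // kact_kpath.
Qed.

Lemma kact_prod s (I : Type) (r : seq I) (F : I -> kriz) :
  kact s (\prod_(i <- r) F i) = \prod_(i <- r) kact s (F i).
Proof. by apply: (big_morph (kact s)); [move=> e f; apply: kactM|apply: kact1]. Qed.

Lemma kact_kforest l (hs : 'I_l -> 'I_b.+1) s ws :
  kact s (kforest hs ws) = kforest hs (fun i => map s (ws i)).
Proof. by rewrite /kforest kact_prod; apply: eq_bigr => i _; rewrite kact_kword. Qed.

End Paths.

(** * Klyachko's idempotent argument *)

Section Cycles.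

Variable n : nat.
Implicit Types (c : 'S_n) (s : seq 'I_n).

Definition supported c s := forall v, v \notin s -> c v = v.

Lemma map_next_rot s : uniq s -> map (next s) s = rot 1 s.
Proof.
case: s => // y p u; apply: (@eq_from_nth _ y) => [|i].
  by rewrite size_map size_rot.
rewrite size_map => ip; rewrite (nth_map y) // next_nth mem_nth // index_uniq //.
rewrite rot1_cons nth_rcons; move: ip; rewrite /= ltnS leq_eqVlt => /predU1P[->|->//].
by rewrite ltnn eqxx nth_default.
Qed.

Lemma exists_cycle s : uniq s -> exists c, map c s = rot 1 s /\ supported c s.
Proof.
move=> us; exists (perm (can_inj (prev_next us))); split=> [|v vs].
  by rewrite -map_next_rot //; apply: eq_map => v; rewrite permE.
by rewrite permE next_nth (negPf vs).
Qed.

Lemma map_expg_rot c s k : map c s = rot 1 s -> (k <= size s)%N ->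
  map (c ^+ k)%g s = rot k s.
Proof.
move=> cs; elim: k => [_|k IH ks].
  by rewrite rot0 -[RHS]map_id; apply: eq_map => v; rewrite perm1.
rewrite rotS // -IH ?(ltnW ks) // -map_rot -cs -map_comp; apply: eq_map => v.
by rewrite expgS permM.
Qed.

Lemma map_expVg_rotr c s k : map c s = rot 1 s -> (k <= size s)%N ->
  map (c ^- k)%g s = rotr k s.
Proof.
move=> cs ks; have := map_expg_rot cs ks => /(congr1 (rotr k)).
rewrite rotK -map_rotr => {1}<-; rewrite -map_comp -[RHS]map_id.
by apply: eq_map => v; rewrite /= permK.
Qed.

Lemma expg_size c s : map c s = rot 1 s -> supported c s -> (c ^+ size s = 1)%g.
Proof.
move=> cs cf; apply/permP => v; rewrite perm1.
have [vs|vs] := boolP (v \in s); last first.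
  by elim: (size s) => [|k IH]; rewrite ?perm1 // expgSr permM IH cf.
have := map_expg_rot cs (leqnn _); rewrite rot_size -[X in _ = X]map_id => /eq_in_map.
exact.
Qed.

Lemma supportedX c s k : supported c s -> supported (c ^+ k)%g s.
Proof.
by move=> cf v vs; elim: k => [|k IH]; rewrite ?perm1 // expgSr permM IH cf.
Qed.

Lemma supportedV c s : supported c s -> supported (c^-1)%g s.
Proof. by move=> cf v vs; rewrite -{1}(cf v vs) permK. Qed.

Lemma supported_fix c s v : supported c s -> v \in s -> c v \in s.
Proof.
move=> cf vs; apply: contraT => cvs; have := cf _ cvs => /perm_inj cv.
by rewrite cv vs in cvs.
Qed.

Lemma supported_commute c (d : 'S_n) s :
  supported c s -> {in s, d =1 id} -> commute c d.
Proof.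
move=> cf df; apply/permP => v; rewrite !permM.
have [vs|vs] := boolP (v \in s); first by rewrite (df v vs) df ?supported_fix.
have [dvs|dvs] := boolP (d v \in s); last by rewrite cf ?cf.
by have := df _ dvs => /perm_inj dv; rewrite -{1}dv dvs in vs.
Qed.

End Cycles.

Section Klyachko.

Variables (m b : nat) (H : falgType rat) (gr : nat -> {vspace H}).
Hypothesis H_cohomology : connected_PD_algebra m gr.
Variables (w : H) (x : 'I_b.+1 -> H) (deg : 'I_b.+1 -> nat).
Hypothesis x_basis : homogeneous_basis m gr w x deg.
Variable n : nat.
Hypothesis m_gt0 : (0 < m)%N.

Local Notation kriz := (kriz m n gr).
Local Notation kP := (@kP m n H gr).
Local Notation kG := (@kG m n H gr).
Local Notation kG_sym := (@Defs.kG_sym m n H gr).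
Local Notation kG_anticomm := (@Defs.kG_anticomm m n H gr m_gt0).
Local Notation kact := (@kact m n H gr).
Local Notation kpath := (@kpath m H gr n).
Local Notation kword := (@kword m b H gr x n).

Lemma kG_kpath i j r s : kG i j * kpath r s = (-1) ^+ size s *: (kpath r s * kG i j).
Proof.
elim: s r => [|a s IH] r /=; first by rewrite mul1r mulr1 scale1r.
rewrite mulrA kG_anticomm mulNr -!mulrA IH -palg_scalerAr.
by rewrite exprS mulN1r scaleNr.
Qed.

Lemma kpath_cat r s1 s2 : kpath r (s1 ++ s2) = kpath r s1 * kpath (last r s1) s2.
Proof. by elim: s1 r => [|a s1 IH] r /=; rewrite ?mul1r // IH mulrA. Qed.

(** Up to sign this is the path through [q], [r], [p] in this order, seen from the inner vertex [r].
    Rotations of the word [r :: s] thus become forks at [r]. *)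
Definition kfork (r : 'I_n) (p q : seq 'I_n) : kriz := kpath r p * kpath r (rev q).

(** The Arnold relation applied to the first edges of the two legs: the fork moves from [r] to [a]
    or to [c]. *)
Lemma kfork_rec r a p c q :
  kfork r (a :: p) (rcons q c) = kG r a * kfork a p (rcons q c)
    + (-1) ^+ (size p).+1 *: (kG r c * kfork c (a :: p) q).
Proof.
rewrite /kfork rev_rcons /= -mulrA [kpath a p * _]mulrA.
have -> : kpath a p * kG r c = (-1) ^+ size p *: (kG r c * kpath a p).
  by rewrite kG_kpath scalerA -expr2 sqrr_sign scale1r.
rewrite -palg_scalerAl -palg_scalerAr !mulrA (kG_fork gr m_gt0) !mulrBl scalerBr.
congr (_ + _); last by rewrite exprS mulN1r scaleNr.
rewrite -!mulrA [in LHS](mulrA (kG a c)) kG_kpath -!palg_scalerAl -palg_scalerAr.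
by rewrite scalerA -expr2 sqrr_sign scale1r -!mulrA.
Qed.

Lemma kfork_nil r a p : kfork r (a :: p) [::] = kG r a * kfork a p [::].
Proof. by rewrite /kfork !mulr1. Qed.

Lemma kfork_rcons r c q : kfork r [::] (rcons q c) = kG r c * kfork c [::] q.
Proof. by rewrite /kfork rev_rcons !mul1r. Qed.

(** Reversing [(size q).+1] anticommuting edges costs the sign of the reversal permutation. *)
Lemma kpath_rcons_rev v q r : kpath v (rcons q r) =
  (-1) ^+ 'C((size q).+1, 2) *: kpath r (rev (v :: q)).
Proof.
elim: q v => [|u q IH] v /=.
  by rewrite !mulr1 scale1r kG_sym.
rewrite IH -palg_scalerAr kG_kpath scalerA -exprD size_rev [in RHS]binS bin1.
rewrite [rev (v :: _)]rev_cons -cats1 kpath_cat /= mulr1.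
by rewrite [in last _ _]rev_cons last_rcons (kG_sym v u).
Qed.

Lemma kP_kpath h r s u : u \in r :: s ->
  kP u (x h) * kpath r s = kP r (x h) * kpath r s.
Proof.
elim: s r => [|a s IH] r; first by rewrite inE => /eqP ->.
rewrite inE => /predU1P[->//|us] /=.
have xh := hb_homog x_basis h.
rewrite !mulrA !(kPG_comm m_gt0 _ _ _ xh) -!palg_scalerAl -!mulrA IH //.
by rewrite mulrA -[in RHS]mulrA !mulrA !(kGP_comm m_gt0 _ _ _ xh) kP_kG.
Qed.

(** The mark may sit at any vertex of the path, so it slides to [r]. The binomial comes from
    reversing the part before [r], the product of sizes from exchanging the two legs. *)
Lemma kword_rot h r p q : kword h (q ++ r :: p) =
  (-1) ^+ ('C(size q, 2) + size p * size q)%N *: (kP r (x h) * kfork r p q).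
Proof.
case: q => [|v q] /=; first by rewrite muln0 scale1r /kfork mulr1.
rewrite -(@kP_kpath h v _ r) ?inE ?mem_cat ?mem_head ?orbT //.
rewrite -cat_rcons kpath_cat last_rcons kpath_rcons_rev -palg_scalerAl -palg_scalerAr.
rewrite (khom_comm (kpath_hom _ _ _ _) (kpath_hom _ _ _ _)) size_rev mulnA.
rewrite (sign_2m1 m_gt0) mulnAC (sign_2m1 m_gt0) -palg_scalerAr scalerA -exprD /=.
by rewrite mulnC.
Qed.

Variables (N : nat) (rG : mx_representation algC [set: 'S_n] N).
Variable psi : kriz -> 'rV[algC]_N.
Hypothesis psi_lin : forall a e f, psi (a *: e + f) = ratr a *: psi e + psi f.
Hypothesis psi_act : forall s e, psi (kact s e) = psi e *m rG s.

Lemma psi0 : psi 0 = 0.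
Proof.
have := psi_lin (-1) 0 0; rewrite scaler0 addr0 rmorphN1 scaleN1r.
by move=> e; rewrite e addNr.
Qed.

Lemma psiD e f : psi (e + f) = psi e + psi f.
Proof. by have := psi_lin 1 e f; rewrite rmorph1 !scale1r. Qed.

Lemma psiZ a e : psi (a *: e) = ratr a *: psi e.
Proof. by have := psi_lin a e 0; rewrite psi0 !addr0. Qed.

Lemma psi_sign k e : psi ((-1) ^+ k *: e) = (-1) ^+ k *: psi e.
Proof. by rewrite psiZ rmorphXn rmorphN1. Qed.

Section Rotations.

Variable z : algC.

(* The signs are those for which [rotsum] satisfies the two-term recursion [rotsum_rec]. *)
Definition rot_coef (j : nat) : algC := z ^+ j * (-1) ^+ 'C(j.+1, 2).

Lemma rot_coefS j : rot_coef j.+1 = rot_coef j * z * (-1) ^+ j.+1.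
Proof. by rewrite /rot_coef binS bin1 exprD exprSr -!mulrA; congr (_ * _); rewrite mulrCA. Qed.

(** The j-th term moves the last [j] letters of [s] to the second leg, which is the j-th backward
    rotation of [r :: s]. The sum is a path hit by a cycle idempotent, inside a forest with
    remaining factors [L] and [R]. *)
Definition rotsum (L : kriz) r s (R : kriz) :=
  \sum_(j < (size s).+1) rot_coef j *:
     psi (L * kfork r (take (size s - j) s) (drop (size s - j) s) * R).

(** [kfork_rec] splits every inner term in two. The two extreme terms have an empty leg and each
    contributes to one of the sums only, so both sums on the right come out complete. *)
Lemma rotsum_rec L r a s1 s2 c R : a :: s1 = rcons s2 c ->
  rotsum L r (a :: s1) R = rotsum (L * kG r a) a s1 R
    + ((-1) ^+ (size s1).+1 * z) *: rotsum (L * kG r c) c s2 R.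
Proof.
move=> e; have e2 : size s2 = size s1.
  by have := congr1 size e; rewrite size_rcons /= => -[].
set l := size s1.
pose A j := rot_coef j *: psi (L * kG r a * kfork a (take (l - j) s1) (drop (l - j) s1) * R).
pose B j := rot_coef j *: psi (L * kG r c * kfork c (take (l - j) s2) (drop (l - j) s2) * R).
pose T j := rot_coef j *: psi (L * kfork r (take (l.+1 - j) (a :: s1)) (drop (l.+1 - j) (a :: s1)) * R).
have cut j : (j <= l)%N -> take (l - j) (a :: s1) = take (l - j) s2 /\
    drop (l - j) (a :: s1) = rcons (drop (l - j) s2) c.
  by move=> jl; rewrite e drop_rcons ?e2 ?leq_subr // -cats1 takel_cat // e2 leq_subr.
have T0 : T 0%N = A 0%N.
  by rewrite /T /A !subn0 /= drop_size take_size kfork_nil mulrA.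
(* The sign of [kfork_rec] and the increment of [rot_coef] combine to a factor independent of [j];
   this dictates the binomial exponent in [rot_coef]. *)
have BT j : (j <= l)%N -> rot_coef j.+1 * (-1) ^+ (l - j) = ((-1) ^+ l.+1 * z) * rot_coef j :> algC.
  by move=> jl; rewrite rot_coefS -mulrA -exprD addSn subnKC // mulrC (mulrC (rot_coef j)) mulrA.
have Tl : T l.+1 = ((-1) ^+ l.+1 * z) *: B l.
  have [_] := cut l (leqnn _); rewrite subnn !drop0 => es.
  by rewrite /T /B !subnn !take0 !drop0 es kfork_rcons mulrA scalerA -BT // subnn mulr1.
have TS j : (j < l)%N -> T j.+1 = A j.+1 + ((-1) ^+ l.+1 * z) *: B j.
  move=> jl; have [et ed] := cut j (ltnW jl).
  have [k lk] : exists k, (l - j = k.+1)%N by exists (l - j).-1; rewrite prednK // subn_gt0.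
  have lk' : (l - j.+1 = k)%N by rewrite subnS lk.
  rewrite /T /A /B subSS lk' lk; rewrite lk /= in et ed.
  rewrite /= -et ed kfork_rec mulrDr mulrDl psiD scalerDr !mulrA; congr (_ + _).
  rewrite -palg_scalerAr -palg_scalerAl psi_sign !scalerA -BT ?(ltnW jl) // lk !mulrA.
  by rewrite size_takel // -/l (leq_trans (leqnSn k)) // -lk leq_subr.
rewrite /rotsum e2 -/l [size (_ :: _)]/= -/l.
rewrite -[LHS]/(\sum_(j < l.+2) T j) -[X in _ = X + _]/(\sum_(j < l.+1) A j).
rewrite -[X in _ = _ + _ *: X]/(\sum_(j < l.+1) B j).
rewrite big_ord_recl big_ord_recr big_ord_recl [in RHS]big_ord_recr /= /bump !add1n.
rewrite T0 Tl scalerDr -!addrA; congr (_ + _); rewrite addrA; congr (_ + _).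
rewrite scaler_sumr -big_split /=; apply: eq_bigr => j _.
by rewrite /bump !add1n TS.
Qed.

(* The two properties used of an element of the group algebra of the permutations
   supported in s. *)
Definition local_op (s : seq 'I_n) (B : 'M[algC]_N) : Prop :=
  (forall d : 'S_n, {in s, d =1 id} -> B *m rG d = rG d *m B) /\
  (forall U : 'M_N, mxmodule rG U -> (U *m B <= U)%MS).

Lemma local_op1 s : local_op s 1%:M.
Proof. by split=> [d _|U _]; rewrite ?mulmx1 ?mul1mx. Qed.

Lemma local_opM s B C : local_op s B -> local_op s C -> local_op s (B *m C).
Proof.
move=> [Bc BU] [Cc CU]; split=> [d ds|U mU].
  by rewrite -mulmxA Cc // mulmxA Bc // mulmxA.
by rewrite mulmxA (submx_trans _ (CU U mU)) // submxMr // BU.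
Qed.

Lemma local_opZ s a B : local_op s B -> local_op s (a *: B).
Proof.
move=> [Bc BU]; split=> [d ds|U mU]; first by rewrite -scalemxAl Bc // scalemxAr.
by rewrite -scalemxAr scalemx_sub // BU.
Qed.

Lemma local_op_sum s (I : finType) (B : I -> 'M_N) :
  (forall i, local_op s (B i)) -> local_op s (\sum_i B i).
Proof.
move=> BP; split=> [d ds|U mU].
  by rewrite mulmx_suml mulmx_sumr; apply: eq_bigr => i _; apply: (BP i).1.
by rewrite mulmx_sumr summx_sub // => i _; apply: (BP i).2.
Qed.

Lemma local_op_rG s g : supported g s -> local_op s (rG g).
Proof.
move=> gs; split=> [d ds|U mU]; last by apply: (mxmoduleP mU); rewrite inE.
by rewrite -!repr_mxM ?inE // (supported_commute gs ds).
Qed.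

Lemma local_op_sub s s' B : {subset s <= s'} -> local_op s B -> local_op s' B.
Proof. by move=> ss' [Bc BU]; split=> // d ds; apply: Bc => v /ss' /ds. Qed.

Definition fixed_by (s : seq 'I_n) (e : kriz) := forall d, supported d s -> kact d e = e.

Lemma kact_kfork d r p q : kact d (kfork r p q) = kfork (d r) (map d p) (map d q).
Proof. by rewrite /kfork kactM // !kact_kpath // map_rev. Qed.

(* Let F be the left-hand side and l the number of vertices of a :: s1.  By [rotsum_rec],
   rotsum L r (a :: s1) R = F (1 - y g), where g is the rotation of a :: s1, of order l, and
   y = (-1)^(l-1) z; since y^l = z^l is not 1, 1 - y g is invertible. *)
Lemma rotsum_step L r a s1 R : uniq (r :: a :: s1) ->
  fixed_by (a :: s1) L -> fixed_by (a :: s1) R -> z ^+ (size s1).+1 != 1 ->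
  exists B, local_op (a :: s1) B /\
    rotsum (L * kG r a) a s1 R = rotsum L r (a :: s1) R *m B.
Proof.
rewrite cons_uniq => /andP[ras us] fL fR z1.
have [c [cs cf]] := exists_cycle us; set g := (c^-1)%g.
have gf : supported g (a :: s1) by apply: supportedV.
have gl : (g ^+ (size s1).+1 = 1)%g by rewrite /g expVgn (expg_size cs cf) invg1.
have [s2 [c0 e]] : exists s2 c0, a :: s1 = rcons s2 c0.
  by case/lastP: (a :: s1) (isT : a :: s1 != [::]) => // s2 c0 _; exists s2, c0.
have gs : map g (a :: s1) = c0 :: s2.
  by have := map_expVg_rotr cs (isT : (1 <= size (a :: s1))%N); rewrite expg1 e rotr1_rcons.
set l := (size s1).+1; pose y := (-1) ^+ size s1 * z.
pose F := rotsum (L * kG r a) a s1 R.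
(* The second sum of the recursion is the first one moved by the rotation [g], which sends [a] to
   [c0] and [s1] to [s2] and leaves the other factors alone. *)
have Fg : F *m rG g = rotsum (L * kG r c0) c0 s2 R.
  have [ga gs1] : g a = c0 /\ map g s1 = s2 by case: gs.
  have ss : size s2 = size s1 by rewrite -gs1 size_map.
  rewrite /F /rotsum mulmx_suml ss; apply: eq_bigr => j _.
  rewrite -scalemxAl -psi_act 2!(kactM m_gt0) kact_kfork (kactM m_gt0) (kact_kG _ m_gt0) ga map_take map_drop gs1.
  by rewrite fL // fR // gf.
have Rw : rotsum L r (a :: s1) R = F - y *: (F *m rG g).
  rewrite (rotsum_rec _ _ _ e) Fg exprS mulN1r mulNr scaleNr //.
pose Fi i := y ^+ i *: (F *m rG (g ^+ i)%g).
exists ((1 - z ^+ l)^-1 *: \sum_(i < l) y ^+ i *: rG (g ^+ i)%g); split.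
  by apply/local_opZ/local_op_sum => i; apply/local_opZ/local_op_rG/supportedX.
have : rotsum L r (a :: s1) R *m (\sum_(i < l) y ^+ i *: rG (g ^+ i)%g) = Fi 0%N - Fi l.
  rewrite mulmx_sumr -[Fi 0%N - _]opprB -(telescope_sumr Fi (leq0n l)) big_mkord -sumrN.
  apply: eq_bigr => i _; rewrite opprB Rw -scalemxAr mulmxBl scalerBr /Fi; congr (_ - _).
  by rewrite -scalemxAl -mulmxA -repr_mxM ?inE // expgS exprSr scalerA.
rewrite -scalemxAr => ->; rewrite /Fi expr0 scale1r gl expg0 !repr_mx1 !mulmx1.
have -> : y ^+ l = z ^+ l.
  rewrite exprMn -exprM -signr_odd oddM /= andbN.
  by rewrite expr0 mul1r.
have -> : F - z ^+ l *: F = (1 - z ^+ l) *: F by rewrite scalerBl scale1r.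
by rewrite scalerA mulVf ?scale1r // subr_eq0 eq_sym.
Qed.

(** Each letter of the path costs one use of [rotsum_step], in which an operator for a tail of
    length i is inverted. All lengths from 1 to [size s] occur, hence the condition on the powers of
    [z]. *)
Lemma klyachko L r s R : uniq (r :: s) -> fixed_by s L -> fixed_by s R ->
  (forall i, (0 < i <= size s)%N -> z ^+ i != 1) ->
  exists B, local_op s B /\ psi (L * kpath r s * R) = rotsum L r s R *m B.
Proof.
elim: s L r => [|a s IH] L r us fL fR z1.
  exists 1%:M; split; first exact: local_op1.
  by rewrite /rotsum big_ord1 /rot_coef /kfork /= !mulr1 scale1r mulmx1.
have [] := rotsum_step us fL fR; first by apply: z1; rewrite /= leqnn.
move=> B1 [B1l e1]; move: us; rewrite cons_uniq => /andP[ras us].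
have sub d : supported d s -> supported d (a :: s).
  by move=> ds v vs; apply: ds; apply: contra vs; rewrite inE orbC => ->.
have [||| B2 [B2l e2]] := IH (L * kG r a) a us.
- move=> d ds; rewrite kactM // kact_kG // (fL d (sub d ds)) !ds //.
    by move: us; rewrite cons_uniq => /andP[].
  by apply: contra ras; rewrite inE orbC => ->.
- by move=> d /sub /fR.
- by move=> i /andP[i0 il]; apply: z1; rewrite i0 ltnW.
exists (B1 *m B2); split.
  by apply: local_opM => //; apply: local_op_sub B2l => v; rewrite inE orbC => ->.
by rewrite /= mulmxA -e1 -e2 !mulrA.
Qed.

(** If [c] and [y] have l-th power 1, this is l times the projector onto the eigenspace of [c] for
    the eigenvalue [y]. *)
Definition cycle_proj (c : 'S_n) (y : algC) (l : nat) : 'M[algC]_N :=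
  \sum_(j < l) y ^+ j *: rG (c ^- j)%g.

(** Powers of the inverse cycle rotate the word, and [kword_rot] turns the rotations into forks. The
    extra (-1)^(size s) is the sign of the cycle; with it the signs reduce to those of [rot_coef].
    This is how the sign character enters phi. *)
Lemma psi_cycle_proj L h r s (c : 'S_n) R : map c (r :: s) = rot 1 (r :: s) ->
  supported c (r :: s) -> fixed_by (r :: s) L -> fixed_by (r :: s) R ->
  psi (L * kword h (r :: s) * R) *m cycle_proj c (z * (-1) ^+ size s) (size s).+1
    = rotsum (L * kP r (x h)) r s R.
Proof.
move=> cs cf fL fR; rewrite /cycle_proj mulmx_sumr; apply: eq_bigr => j _.
have js : (j <= size s)%N by rewrite -ltnS.
have cj : supported (c ^- j)%g (r :: s) by apply/supportedV/supportedX.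
rewrite -scalemxAr -psi_act 2!(kactM m_gt0) fL // fR // kact_kword //.
rewrite (map_expVg_rotr cs) ?(leqW js) // /rotr /rot.
have -> : (size (r :: s) - j = (size s - j).+1)%N by rewrite /= subSn.
rewrite drop_cons take_cons kword_rot size_drop subKn // size_takel ?leq_subr //.
rewrite -palg_scalerAr -palg_scalerAl psi_sign scalerA !mulrA; congr (_ *: _).
rewrite /rot_coef exprMn -!mulrA -exprM -exprD; congr (_ * _).
have e : odd (size s * j + ('C(j, 2) + (size s - j) * j)) = odd 'C(j.+1, 2).
  rewrite -{1}(subnKC js) binS bin1 !(oddD, oddM).
  by case: (odd j); case: (odd (size s - j)); case: (odd 'C(j, 2)).
by rewrite -[LHS]signr_odd e signr_odd.
Qed.

Theorem klyachko_word L h r s (c : 'S_n) R : uniq (r :: s) -> map c (r :: s) = rot 1 (r :: s) ->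
  supported c (r :: s) -> fixed_by (r :: s) L -> fixed_by (r :: s) R ->
  (forall i, (0 < i <= size s)%N -> z ^+ i != 1) ->
  exists B, local_op (r :: s) B /\
    psi (L * kword h (r :: s) * R) =
    psi (L * kword h (r :: s) * R) *m cycle_proj c (z * (-1) ^+ size s) (size s).+1 *m B.
Proof.
move=> us cs cf fL fR z1; rewrite psi_cycle_proj //.
have sub d : supported d s -> supported d (r :: s).
  by move=> ds v vs; apply: ds; apply: contra vs; rewrite inE orbC => ->.
have fLP : fixed_by s (L * kP r (x h)).
  move=> d ds; rewrite kactM // kact_kP // (fL d (sub d ds)) ds //.
  by move: us; rewrite cons_uniq => /andP[].
have [B [Bl e]] := klyachko us fLP (fun d ds => fR d (sub d ds)) z1.
exists B; split; first by apply: local_op_sub Bl => v; rewrite inE orbC => ->.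
by rewrite -e /= !mulrA.
Qed.

End Rotations.
End Klyachko.

(** * Counting types by the index of their groups *)

Section Blocks.

Variables (n b : nat) (T : ktype n b).
Local Notation t := (size T).
Local Notation lam := (ktype_lam T).
Local Notation psum := (ktype_psum T).
Local Notation block := (block T).

Lemma ktype_lam_gt0 i : (i < t)%N -> (0 < lam i)%N.
Proof.
by move=> it; have /and3P[/all_nthP pos _ _] := valP T; apply: pos.
Qed.

Lemma ktype_psumS i : psum i.+1 = (psum i + lam i)%N.
Proof. by rewrite /ktype_psum big_ord_recr. Qed.

Lemma ktype_psum_size : psum t = n.
Proof.
have /and3P[_ /eqP e _] := valP T; rewrite -[RHS]e (big_nth (ord0, ord0)) big_mkord.
by [].
Qed.

Lemma leq_ktype_psum i j : (i <= j)%N -> (psum i <= psum j)%N.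
Proof.
move=> /subnKC <-; elim: (j - i)%N => [|d IH]; first by rewrite addn0.
by rewrite addnS ktype_psumS (leq_trans IH) ?leq_addr.
Qed.

Lemma mem_block i v : (v \in block i) = (psum i <= v < psum i.+1)%N.
Proof. by rewrite mem_filter mem_enum andbT. Qed.

Lemma val_block i : (i < t)%N -> map val (block i) = iota (psum i) (lam i).
Proof.
move=> it; rewrite -(filter_map _ (fun v => psum i <= v < psum i.+1)%N) val_enum_ord.
have le : (psum i.+1 <= n)%N by have := leq_ktype_psum it; rewrite ktype_psum_size.
have -> : iota 0 n = iota 0 (psum i) ++ iota (psum i) (lam i) ++ iota (psum i.+1) (n - psum i.+1).
  transitivity (iota 0 (psum i + (lam i + (n - psum i.+1)))).
    by rewrite addnA -ktype_psumS subnKC.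
  by rewrite !iotaD !add0n ktype_psumS.
rewrite !filter_cat (eq_in_filter (a2 := pred0)) ?filter_pred0 => [|v].
  rewrite (eq_in_filter (a2 := predT)) ?filter_predT => [|v].
    rewrite (eq_in_filter (a2 := pred0)) ?filter_pred0 ?cats0 // => v.
    by rewrite mem_iota => /andP[v_ge _]; rewrite [(v < _)%N]ltnNge v_ge andbF.
  by rewrite mem_iota -ktype_psumS.
by rewrite mem_iota /= => v_lt; rewrite leqNgt v_lt.
Qed.

Lemma size_block i : (i < t)%N -> size (block i) = lam i.
Proof. by move=> it; rewrite -(size_map val) val_block ?size_iota. Qed.

Lemma flatten_block : flatten [seq block i | i <- iota 0 t] = enum 'I_n.
Proof.
apply: (inj_map val_inj); rewrite val_enum_ord map_flatten -map_comp.
transitivity (iota 0 (psum t)); last by rewrite ktype_psum_size.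
have: (t <= t)%N by []; elim: {1 3 4}t => [|k IH] kt.
  by rewrite /ktype_psum big_ord0.
rewrite -addn1 iotaD map_cat flatten_cat IH ?(ltnW kt) // addn1 ktype_psumS iotaD.
by rewrite /= cats0 add0n val_block.
Qed.

Definition bidx (v : 'I_n) : nat := find (fun i => v \in block i) (iota 0 t).

Lemma bidxP v : (bidx v < t)%N /\ v \in block (bidx v).
Proof.
have : v \in flatten [seq block i | i <- iota 0 t] by rewrite flatten_block mem_enum.
case/flattenP => _ /mapP[i it ->] vi.
have h : has (fun i => v \in block i) (iota 0 t) by apply/hasP; exists i.
have lt : (bidx v < t)%N by move: h; rewrite has_find size_iota.
by split=> //; have := nth_find 0 h; rewrite nth_iota.
Qed.

Lemma bidx_lt v : (bidx v < t)%N. Proof. by have [] := bidxP v. Qed.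

Lemma mem_bidx v : v \in block (bidx v). Proof. by have [] := bidxP v. Qed.

Lemma bidx_block i v : v \in block i -> bidx v = i.
Proof.
move=> vi; have := mem_bidx v; move: vi; rewrite !mem_block => /andP[l1 u1] /andP[l2 u2].
apply/eqP; rewrite eqn_leq; apply/andP; split; rewrite leqNgt; apply/negP => /leq_ktype_psum le.
  by have := leq_ltn_trans (leq_trans le l2) u1; rewrite ltnn.
by have := leq_ltn_trans (leq_trans le l1) u2; rewrite ltnn.
Qed.

Lemma mem_block_bidx i v : (v \in block i) = (bidx v == i).
Proof. by apply/idP/eqP => [/bidx_block//|<-]; apply: mem_bidx. Qed.

Lemma map_block_cycle i : map (block_cycle T i) (block i) = rot 1 (block i).
Proof.
by rewrite -map_next_rot ?block_uniq //; apply: eq_map => v; rewrite permE.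
Qed.

Lemma block_cycle_supported i : supported (block_cycle T i) (block i).
Proof. by move=> v vi; rewrite permE next_nth (negPf vi). Qed.

Lemma block_cycleC i : (i < t)%N -> block_cycle T i \in ktypeC T.
Proof.
move=> it; rewrite /ktypeC bigprodGE mem_gen //; apply/bigcupP.
by exists (Ordinal it) => //; apply: cycle_id.
Qed.

End Blocks.

Lemma prod_tperm (V : finType) (s1 s2 : seq V) (p : {perm V}) :
  p = (\prod_(u <- zip s1 s2) tperm u.1 u.2)%g -> size s1 = size s2 -> uniq (s1 ++ s2) ->
  [/\ map p s1 = s2, map p s2 = s1 & forall v, v \notin s1 ++ s2 -> p v = v].
Proof.
move=> -> {p}; elim: s1 s2 => [|a s1 IH] [|c s2] //= => [_ _|[ss]].
  by rewrite big_nil; split=> // v _; rewrite perm1.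
rewrite mem_cat inE !negb_or cat_uniq /= !negb_or => /andP[/and3P[as1 ac as2]].
case/and3P=> us1 /andP[cs1 dis] /andP[cs2 us2].
have us : uniq (s1 ++ s2) by rewrite cat_uniq us1 us2 dis.
have [IH1 IH2 IH3] := IH s2 ss us; rewrite big_cons;
  set p := (\prod_(u <- zip s1 s2) _)%g in IH1 IH2 IH3 *.
have pc : p c = c by apply: IH3; rewrite mem_cat negb_or cs1 cs2.
have pa : p a = a by apply: IH3; rewrite mem_cat negb_or as1 as2.
have pD v : v != a -> v != c -> (tperm a c * p)%g v = p v.
  by move=> va vc; rewrite permM tpermD // eq_sym.
split=> [||v].
- rewrite permM tpermL pc; congr (_ :: _); rewrite -[RHS]IH1; apply/eq_in_map => v vs.
  by apply: pD; apply: contraTneq vs => ->.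
- rewrite permM tpermR pa; congr (_ :: _); rewrite -[RHS]IH2; apply/eq_in_map => v vs.
  by apply: pD; apply: contraTneq vs => ->.
rewrite inE mem_cat inE !negb_or => /and4P[va vs1 vc vs2].
by rewrite pD // IH3 // mem_cat negb_or vs1.
Qed.

Section Stabiliser.

Variables (n b : nat) (T : ktype n b).
Local Notation t := (size T).
Local Notation lam := (ktype_lam T).
Local Notation block := (block T).
Local Notation bidx := (bidx T).

Lemma ktype_ge_trans : transitive (@ktype_ge n b).
Proof.
move=> p1 p2 p3; rewrite /ktype_ge => /orP[l12|/andP[/eqP e12 h12]] /orP[l23|/andP[/eqP e23 h23]].
- by rewrite (ltn_trans l23 l12).
- by rewrite -e23 l12.
- by rewrite e12 l23.
- by rewrite e12 e23 eqxx (leq_trans h23 h12) orbT.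
Qed.

Lemma ktype_ge_refl : reflexive (@ktype_ge n b).
Proof. by move=> p; rewrite /ktype_ge eqxx leqnn orbT. Qed.

Lemma ktype_ge_anti : antisymmetric (@ktype_ge n b).
Proof.
move=> [l1 h1] [l2 h2]; rewrite /ktype_ge /= => /andP[/orP[lt12|/andP[/eqP e12 h12]] /orP[lt21|/andP[/eqP e21 h21]]].
- by have := ltn_trans lt12 lt21; rewrite ltnn.
- by move: lt12; rewrite e21 ltnn.
- by move: lt21; rewrite e12 ltnn.
- by congr (_, _) => //; apply/val_inj/eqP; rewrite eqn_leq h12 h21.
Qed.

(** A type is sorted for an antisymmetric relation, so equal entries are contiguous and any two
    equal blocks are joined by a chain of adjacent swaps. *)
Lemma ktype_nth_sandwich i j k : (i <= j <= k)%N -> (k < t)%N ->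
  nth (ord0, ord0) T i = nth (ord0, ord0) T k -> nth (ord0, ord0) T j = nth (ord0, ord0) T k.
Proof.
move=> /andP[ij jk] kt e; have /and3P[_ _ so] := valP T.
have ge a c : (a <= c)%N -> (c < t)%N -> ktype_ge (nth (ord0, ord0) T a) (nth (ord0, ord0) T c).
  move=> ac ct; apply: (sorted_leq_nth ktype_ge_trans ktype_ge_refl) => //; rewrite inE //.
  exact: leq_ltn_trans ac ct.
by apply: ktype_ge_anti; rewrite ge //= -e ge // (leq_ltn_trans jk).
Qed.

Fact block_next_inj : injective (fun v => next (block (bidx v)) v).
Proof.
apply: (can_inj (g := fun v => prev (block (bidx v)) v)) => v.
have -> : bidx (next (block (bidx v)) v) = bidx v by apply: bidx_block; rewrite mem_next mem_bidx.
exact/prev_next/block_uniq.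
Qed.

Definition type_perm : 'S_n := perm block_next_inj.

Definition type_mark : {ffun 'I_n -> 'I_b.+1} := [ffun v => ktype_h T (bidx v)].

Lemma type_perm_block i v : v \in block i -> type_perm v = block_cycle T i v.
Proof. by move=> /bidx_block e; rewrite !permE e. Qed.

Lemma map_type_perm i : map type_perm (block i) = rot 1 (block i).
Proof. by rewrite -map_block_cycle; apply/eq_in_map => v /type_perm_block. Qed.

Lemma bidx_type_perm v : bidx (type_perm v) = bidx v.
Proof. by apply: bidx_block; rewrite permE mem_next mem_bidx. Qed.

Lemma type_markE v : type_mark v = ktype_h T (bidx v). Proof. by rewrite ffunE. Qed.

Lemma porbit_type_perm u v : (u \in porbit type_perm v) = (bidx u == bidx v).
Proof.
apply/porbitP/eqP => [[k ->]|uv].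
  by elim: k => [|k IH]; rewrite ?perm1 // expgSr permM bidx_type_perm.
have ub : u \in block (bidx v) by rewrite -uv mem_bidx.
have := mem_bidx T v; set s := block _ in ub *; set f := nth v s 0 => vs.
have orb k : (k < size s)%N -> nth v s k = (type_perm ^+ k)%g f.
  move=> ks; have := map_expg_rot (map_type_perm (bidx v)) (ltnW ks) => /(congr1 (fun s => nth v s 0)).
  rewrite (nth_map v) ?(leq_ltn_trans _ ks) // => ->; rewrite nth_cat size_drop subn_gt0 ks.
  by rewrite nth_drop addn0.
have [ku eu] : exists k, u = (type_perm ^+ k)%g f.
  by exists (index u s); rewrite -orb ?index_mem // nth_index.
have [kv ev] : exists k, v = (type_perm ^+ k)%g f.
  by exists (index v s); rewrite -orb ?index_mem // nth_index.
have /porbitP[k ->] : u \in porbit type_perm v; last by exists k.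
by rewrite -eq_porbit_mem eu porbit_perm; apply/eqP; rewrite [in RHS]ev porbit_perm.
Qed.

Lemma card_porbit_type v : #|porbit type_perm v| = lam (bidx v).
Proof.
rewrite -(size_block (bidx_lt T v)) -(card_uniqP (block_uniq T (bidx v))).
by apply: eq_card => u; rewrite porbit_type_perm mem_block_bidx.
Qed.

Lemma ktype_nth i j : lam i = lam j -> ktype_h T i = ktype_h T j ->
  nth (ord0, ord0) T i = nth (ord0, ord0) T j.
Proof.
by rewrite /ktype_lam /ktype_h; case: (nth _ T i) (nth _ T j) => [l h] [l' h'] /= /val_inj -> ->.
Qed.

Lemma block_swapP i : swappable T i ->
  [/\ map (block_swap T i) (block i) = block i.+1, map (block_swap T i) (block i.+1) = block i
    & forall v, bidx v != i -> bidx v != i.+1 -> block_swap T i v = v].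
Proof.
case/and3P=> it /eqP el _; have ss : size (block i) = size (block i.+1).
  by rewrite !size_block // ltnW.
have us : uniq (block i ++ block i.+1).
  rewrite cat_uniq !block_uniq andbT; apply/hasPn => v; rewrite !mem_block_bidx => /eqP ->.
  by rewrite neq_ltn ltnSn orbT.
have [m1 m2 m3] := prod_tperm erefl ss us; split=> // v vi vi1; apply: m3.
by rewrite mem_cat !mem_block_bidx negb_or vi.
Qed.

Lemma bidx_block_swap i v : swappable T i ->
  bidx (block_swap T i v) = if bidx v == i then i.+1 else if bidx v == i.+1 then i else bidx v.
Proof.
move=> sw; have [m1 m2 m3] := block_swapP sw.
case: eqP => [e|/eqP vi]; last case: eqP => [e|/eqP vi1]; last by rewrite m3.
  by apply: bidx_block; rewrite -m1 map_f // mem_block_bidx e.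
by apply: bidx_block; rewrite -m2 map_f // mem_block_bidx e.
Qed.

(** The stabiliser of the pair ([type_perm], [type_mark]) under conjugation and transport of
    markings. *)
Definition type_stab (s : 'S_n) : Prop :=
  commute s type_perm /\ forall v, type_mark (s v) = type_mark v.

Lemma type_stabM s s' : type_stab s -> type_stab s' -> type_stab (s * s').
Proof.
move=> [c1 m1] [c2 m2]; split=> [|v]; last by rewrite permM m2 m1.
exact/commute_sym/commuteM/commute_sym/c2/commute_sym.
Qed.

Lemma block_swap_stab i : swappable T i -> type_stab (block_swap T i).
Proof.
move=> sw; have [m1 m2 m3] := block_swapP sw; split=> [|v]; last first.
  rewrite !type_markE bidx_block_swap //; have /and3P[_ _ /eqP eh] := sw.
  by case: eqP => [->|_] //; case: eqP => [->|].
have comm j s s' : map (block_swap T i) (block j) = block s' -> s = j ->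
    forall v, v \in block s -> (block_swap T i * type_perm)%g v = (type_perm * block_swap T i)%g v.
  move=> e -> v vs; rewrite !permM; move: v vs; apply/eq_in_map.
  by rewrite map_comp e map_type_perm [RHS]map_comp map_type_perm map_rot e.
apply/permP => v; have [e|vi] := eqVneq (bidx v) i.
  by apply: (comm i i i.+1); rewrite // mem_block_bidx e.
have [e|vi1] := eqVneq (bidx v) i.+1.
  by apply: (comm i.+1 i.+1 i); rewrite // mem_block_bidx e.
by rewrite !permM !m3 ?bidx_type_perm.
Qed.

Lemma type_stab_bidx s u v : type_stab s -> (bidx (s u) == bidx (s v)) = (bidx u == bidx v).
Proof.
move=> [sc _]; rewrite -!porbit_type_perm; apply/porbitP/porbitP => -[k e]; exists k.
  apply: (@perm_inj _ s); rewrite e -!permM; congr (fun_of_perm _ _).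
  exact/commuteX.
rewrite e -!permM; congr (fun_of_perm _ _); exact/esym/commuteX.
Qed.

Lemma type_stab_nth s v : type_stab s ->
  nth (ord0, ord0) T (bidx (s v)) = nth (ord0, ord0) T (bidx v).
Proof.
move=> st; have [_ sm] := st; apply: ktype_nth; last by rewrite -!type_markE.
rewrite -!card_porbit_type -[RHS](card_imset _ (@perm_inj _ s)); apply: eq_card => u.
rewrite porbit_type_perm -{1}(permKV s u) type_stab_bidx // -porbit_type_perm.
by rewrite -{2}(permKV s u) mem_imset //; apply: perm_inj.
Qed.

(* From the last block down to block k, compose s with adjacent swaps until every block is
   mapped onto itself. *)
Lemma stab_sort s k : type_stab s -> exists v, [/\ v \in ktypeN T, type_stab (s * v)
  & forall u, (k <= bidx u)%N -> bidx ((s * v)%g u) = bidx u].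
Proof.
move=> st; have [tk|] := leqP t k.
  exists 1%g; rewrite mulg1 group1; split=> // u ku.
  by have := leq_trans tk ku; rewrite leqNgt bidx_lt.
move=> /ltnW /subnKC; move: (t - k)%N => d.
elim: d k => [|d IH] k e.
  exists 1%g; rewrite mulg1 group1; split=> // u ku.
  by have := bidx_lt T u; rewrite -e addn0 ltnNge ku.
have [v [vN vst vP]] := IH k.+1 (etrans (addSnnS k d) e).
have kt : (k < t)%N by rewrite -e addnS ltnS leq_addr.
have [f fk] : exists f, bidx f = k.
  have : block k != [::] by rewrite -size_eq0 size_block // -lt0n ktype_lam_gt0.
  case E : (block k) => [//|f ?] _; exists f; apply: bidx_block; by rewrite E mem_head.
(* Later blocks are already in place, so block [k] is sent to some block k - d. Each adjacent swap
   brings its image one block closer to [k], and the induction is on d. *)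
suff main : forall d v, v \in ktypeN T -> type_stab (s * v) ->
    (forall u, (k < bidx u)%N -> bidx ((s * v)%g u) = bidx u) ->
    (bidx ((s * v)%g f) + d = k)%N ->
    exists v, [/\ v \in ktypeN T, type_stab (s * v)
    & forall u, (k <= bidx u)%N -> bidx ((s * v)%g u) = bidx u].
  apply: (main (k - bidx ((s * v)%g f))%N v) => //; rewrite subnKC // leqNgt; apply/negP => lt.
  set u := (s * v)%g f in lt; have := vP u lt => /eqP.
  by rewrite type_stab_bidx // fk => /eqP eu; rewrite eu ltnn in lt.
move=> {v vN vst vP IH e}; elim=> [|d' IH] v vN vst vP e.
  exists v; split=> // u; rewrite leq_eqVlt => /predU1P[ku|]; last exact: vP.
  have /eqP -> : bidx ((s * v)%g u) == bidx ((s * v)%g f) by rewrite type_stab_bidx // fk ku.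
  by rewrite -ku -e addn0.
set j := bidx ((s * v)%g f) in e.
have jk : (j < k)%N by rewrite -e addnS ltnS leq_addr.
have ejk : nth (ord0, ord0) T j = nth (ord0, ord0) T k by rewrite type_stab_nth // fk.
have ej1 : nth (ord0, ord0) T j.+1 = nth (ord0, ord0) T k.
  by apply: ktype_nth_sandwich ejk; rewrite ?leqnSn.
have sw : swappable T j.
  by rewrite /swappable (leq_ltn_trans jk kt) /ktype_lam /ktype_h ejk ej1 !eqxx.
have swN : block_swap T j \in ktypeN T.
  by apply/mem_gen/imsetP; exists (Ordinal (ltn_trans jk kt)); rewrite ?inE.
apply: (IH (v * block_swap T j)%g); rewrite ?groupM // ?mulgA.
- by apply: type_stabM => //; apply: block_swap_stab.
- move=> u ku; rewrite permM bidx_block_swap // vP // !gtn_eqF //.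
    exact: leq_ltn_trans jk ku.
  exact: ltn_trans jk ku.
- by rewrite permM bidx_block_swap // -/j eqxx addSnnS.
Qed.

Lemma block_cycle_stab k : type_stab (block_cycle T k).
Proof.
have fixb v : bidx v != k -> block_cycle T k v = v.
  by rewrite -mem_block_bidx => /block_cycle_supported.
have bE v : bidx v = k -> block_cycle T k v = type_perm v.
  by move=> /eqP; rewrite -mem_block_bidx => /type_perm_block.
have bb v : bidx (block_cycle T k v) = bidx v.
  by have [/bE ->|/fixb ->//] := eqVneq (bidx v) k; rewrite bidx_type_perm.
split=> [|v]; last by rewrite !type_markE bb.
apply/permP => v; rewrite !permM; have [vk|vk] := eqVneq (bidx v) k.
  by rewrite !bE // bidx_type_perm.
by rewrite !fixb // bidx_type_perm.
Qed.

Lemma type_stabV s : type_stab s -> type_stab s^-1.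
Proof.
move=> [sc sm]; split=> [|v]; last by rewrite -{2}(permKV s v) sm.
exact/commute_sym/commuteV/commute_sym.
Qed.

Lemma type_stabX s k : type_stab s -> type_stab (s ^+ k).
Proof.
move=> st; elim: k => [|k IH]; last by rewrite expgS; apply: type_stabM.
by split=> [|v]; [exact/commute_sym/commute1 | rewrite perm1].
Qed.

(** On a block that it preserves, a permutation commuting with the cycle is determined by the image
    of one point [f], hence is a power of the cycle. These powers are cancelled block by block. *)
Lemma stab_cycles s k : type_stab s -> (forall u, bidx (s u) = bidx u) -> (k <= t)%N ->
  exists c, [/\ c \in ktypeC T, forall u, bidx ((s * c)%g u) = bidx u, type_stab (s * c)
    & forall u, (bidx u < k)%N -> (s * c)%g u = u].
Proof.
move=> st sb; elim: k => [_|k IH kt]; first by exists 1%g; rewrite mulg1 group1.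
have [c [cC cb cst cP]] := IH (ltnW kt).
have [f fk] : exists f, bidx f = k.
  have : block k != [::] by rewrite -size_eq0 size_block // -lt0n ktype_lam_gt0.
  case E : (block k) => [//|f ?] _; exists f; apply: bidx_block; by rewrite E mem_head.
have /porbitP[a ea] : (s * c)%g f \in porbit type_perm f by rewrite porbit_type_perm cb.
have bs l : supported (block_cycle T k ^+ l)%g (block k).
  exact/supportedX/block_cycle_supported.
have bb l u : bidx ((block_cycle T k ^+ l)%g u) = bidx u.
  have [uk|uk] := boolP (u \in block k); last by rewrite bs.
  by rewrite (bidx_block uk); apply/bidx_block/supported_fix.
have cyc l u : bidx u = k -> (block_cycle T k ^+ l)%g u = (type_perm ^+ l)%g u.
  move=> uk; elim: l => [|l IHl]; rewrite ?perm1 // !expgSr !permM -IHl.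
  by apply/esym/type_perm_block; rewrite mem_block_bidx bb uk.
have ck u : bidx u = k -> (s * c)%g u = (block_cycle T k ^+ a)%g u.
  move=> uk; have /porbitP[l eu] : u \in porbit type_perm f by rewrite porbit_type_perm uk fk.
  have cc : (type_perm ^+ l * (s * c))%g = (s * c * type_perm ^+ l)%g.
    by apply/esym; apply: commuteX; have [] := cst.
  by rewrite cyc // eu -permM cc permM ea -!permM -!expgD addnC.
exists (c * block_cycle T k ^- a)%g; rewrite mulgA; split.
- by rewrite groupM // groupV groupX // block_cycleC.
- by move=> u; rewrite permM -[LHS](bb a) permKV cb.
- exact/type_stabM/type_stabV/type_stabX/block_cycle_stab.
move=> u; rewrite ltnS leq_eqVlt permM => /predU1P[uk|uk]; first by rewrite ck // permK.
by rewrite cP // (supportedV (bs a)) // mem_block_bidx neq_ltn uk.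
Qed.

Lemma ktypeC_sub : ktypeC T \subset ktypeZ T. Proof. exact: joing_subl. Qed.
Lemma ktypeN_sub : ktypeN T \subset ktypeZ T. Proof. exact: joing_subr. Qed.

Theorem stab_ktypeZ s : type_stab s -> s \in ktypeZ T.
Proof.
move=> st; have [v [vN vst vP]] := stab_sort 0 st.
have [c [cC _ _ cP]] := stab_cycles vst (fun u => vP u (leq0n _)) (leqnn t).
have e : (s * v * c = 1)%g by apply/permP => u; rewrite perm1 cP ?bidx_lt.
have -> : s = (c^-1 * v^-1)%g by rewrite -[s](mulgK (v * c)%g) mulgA e mul1g invMg.
by rewrite groupM // groupV; [apply: (subsetP ktypeC_sub) | apply: (subsetP ktypeN_sub)].
Qed.

Lemma card_type p : #|[set v : 'I_n | nth (ord0, ord0) T (bidx v) == p]| = (p.1 * count_mem p T)%N.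
Proof.
rewrite -sum1_card.
transitivity (\sum_(i < t | nth (ord0, ord0) T i == p) lam i)%N; last first.
  rewrite (eq_bigr (fun=> nat_of_ord p.1)) => [|i /eqP e]; last by rewrite /ktype_lam e.
  rewrite sum_nat_const -sum1_card -sum1_count (big_nth (ord0, ord0)) big_mkord mulnC.
  by [].
rewrite (partition_big (fun v => Ordinal (bidx_lt T v)) (fun i : 'I_t => nth (ord0, ord0) T i == p)) /=.
  apply: eq_bigr => i /eqP ip; rewrite -size_block // -(card_uniqP (block_uniq T i)) -sum1_card.
  apply: eq_bigl => v; rewrite inE mem_block_bidx -val_eqE /=.
  by case: (bidx v =P i) => [->|]; rewrite ?ip ?eqxx ?andbF.
by move=> v0; rewrite inE.
Qed.

End Stabiliser.

Lemma sum_lam n b (T : ktype n b) (p : 'I_n.+1 * 'I_b.+1) :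
  #|[set v : 'I_n | (#|porbit (type_perm T) v| == p.1) && (type_mark T v == p.2)]|
    = (p.1 * count_mem p T)%N.
Proof.
rewrite -card_type; apply: eq_card => v; rewrite !inE card_porbit_type type_markE.
by rewrite /ktype_lam /ktype_h; case: (nth _ T _) p => [l h] [l' h'].
Qed.

Lemma card_porbitJ n (s g : 'S_n) u : #|porbit (s ^ g)%g (g u)| = #|porbit s u|.
Proof.
rewrite -[RHS](card_imset _ (@perm_inj _ g)); apply: eq_card => v.
rewrite -(permKV g v) mem_imset; last exact: perm_inj.
apply/porbitP/porbitP => -[k e]; exists k; move: e; rewrite -conjXg permJ.
  exact: perm_inj.
by move->.
Qed.

(** The number of points with a given cycle length and mark is invariant under [g]. Divided by the
    length it is the multiplicity of that pair in the type, and a sorted sequence is determined by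
    its multiplicities. *)
Lemma type_perm_inj n b (T T' : ktype n b) (g : 'S_n) :
  (type_perm T ^ g)%g = type_perm T' -> (forall v, type_mark T' (g v) = type_mark T v) ->
  T = T'.
Proof.
move=> eg em; apply/val_inj/val_inj.
have so (U : ktype n b) : sorted (@ktype_ge n b) U by have /and3P[_ _] := valP U.
apply: (sorted_eq (@ktype_ge_trans n b) (@ktype_ge_anti n b) (so T) (so T')).
apply/allP => p _ /=.
(* Pairs of length 0 escape the count of points, but they do not occur in a type. *)
have [p0|p0] := posnP p.1.
  have no0 (U : ktype n b) : count_mem p U = 0%N.
    apply/count_memPn/negP => pU; have /and3P[/allP pos _ _] := valP U.
    by have := pos p pU; rewrite p0.
  by rewrite !no0.
rewrite -(eqn_pmul2l p0) -!sum_lam; apply/eqP.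
rewrite -[LHS](card_imset _ (@perm_inj _ g)); apply: eq_card => v.
rewrite -(permKV g v) mem_imset; last exact: perm_inj.
by rewrite !inE em -eg card_porbitJ.
Qed.

Section Counting.

Variables n b : nat.

Definition mark_act (k : {ffun 'I_n -> 'I_b.+1}) (s : 'S_n) : {ffun 'I_n -> 'I_b.+1} :=
  [ffun v => k (s^-1 v)%g].

Fact mark_act1 : mark_act^~ 1%g =1 id.
Proof. by move=> k; apply/ffunP => v; rewrite ffunE invg1 perm1. Qed.

Fact mark_actM k : act_morph mark_act k.
Proof. by move=> s s'; apply/ffunP => v; rewrite !ffunE invMg permM. Qed.

Definition mark_action := TotalAction mark_act1 mark_actM.

Definition marked_perms : {set 'S_n * {ffun 'I_n -> 'I_b.+1}} :=
  [set o | mark_act o.2 o.1 == o.2].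

(** Burnside: the fixed markings summed over all permutations number n! times the orbits, and every
    orbit of markings contains a sorted tuple. *)
Lemma card_marked_perms : (#|marked_perms| <= n`! * 'C(n + b, n))%N.
Proof.
have -> : #|marked_perms| = (\sum_(s in [set: 'S_n]) #|('Fix_([set: {ffun 'I_n -> 'I_b.+1}] | mark_action)[s])%g|)%N.
  rewrite -sum1_card (eq_bigl (fun o => true && (mark_act o.2 o.1 == o.2))); last first.
    by move=> o; rewrite inE.
  rewrite -(pair_big_dep xpredT (fun s k => mark_act k s == k) (fun _ _ => 1%N)) /=.
  apply: eq_big => [s|s _]; first by rewrite inE.
  by rewrite -sum1_card; apply: eq_bigl => k; rewrite in_setI in_setT; apply/eqP/afix1P.
rewrite Frobenius_Cauchy; last by apply/actsP => s _ k; rewrite !inE.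
rewrite cardsT card_Sn mulnC leq_mul2l; apply/orP; right.
pose G (u : n.-tuple 'I_b.+1) := orbit mark_action [set: 'S_n] [ffun v => tnth u v].
rewrite -card_sorted_tuples; apply: leq_trans (leq_imset_card G _); apply: subset_leq_card.
apply/subsetP => _ /imsetP[k _ ->]; apply/imsetP.
pose le (p q : 'I_b.+1) := (p <= q)%N.
pose u := sort_tuple le [tuple k v | v < n].
have up : perm_eq [tuple k v | v < n] u by rewrite perm_sym perm_sort.
exists u.
  rewrite inE sorted_map; apply: sort_sorted => p q; exact: leq_total.
rewrite /G; apply/eqP; rewrite orbit_eq_mem; apply/orbitP.
have /tuple_permP[p e] := up.
exists (p^-1)%g; rewrite ?inE //; apply/ffunP => v; rewrite !ffunE invgK.
by have /(congr1 (fun u => tnth u v)) := val_inj e; rewrite !tnth_mktuple.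
Qed.

(* The pairs (type_perm T, type_mark T) lie in distinct orbits, and their stabilisers are
   contained in the groups ktypeZ T. *)
Lemma sum_index_ktypeZ : (\sum_(T : ktype n b) #|[set: 'S_n] : ktypeZ T|%g <= n`! * 'C(n + b, n))%N.
Proof.
apply: leq_trans card_marked_perms.
pose F (T : ktype n b) g := ((type_perm T ^ g)%g, mark_act (type_mark T) g).
pose O T := F T @: [set: 'S_n].
have OP T : O T \subset marked_perms.
  apply/subsetP => _ /imsetP[g _ ->]; rewrite inE /= -(mark_actM _ g) -conjgC mark_actM.
  apply/eqP; congr (mark_act _ g); apply/ffunP => v; rewrite ffunE !type_markE.
  by rewrite -[in RHS](permKV (type_perm T) v) bidx_type_perm.
have disj o T T' : o \in O T -> o \in O T' -> T = T'.
  case/imsetP=> g _ -> /imsetP[g' _ [eg em]].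
  apply: (@type_perm_inj _ _ _ _ (g * g'^-1)%g).
    by rewrite conjgM eg conjgK.
  move=> v; have /ffunP/(_ (g v)) := em; rewrite !ffunE permK permM => <-.
  by [].
(* Orbit and stabiliser: each fibre of [F T] lies in a right coset of [ktypeZ T], which bounds the
   orbit from below. *)
have card_O T : (#|[set: 'S_n] : ktypeZ T|%g <= #|O T|)%N.
  rewrite -(leq_pmul2l (cardG_gt0 (ktypeZ T))) Lagrange ?subsetT // -sum1_card.
  rewrite (partition_big (F T) (mem (O T))) /= => [|g _]; last exact: imset_f.
  rewrite mulnC -sum_nat_const; apply: leq_sum => _ /imsetP[g0 _ ->].
  rewrite sum1_card -(card_rcoset _ g0); apply: subset_leq_card; apply/subsetP => g.
  move=> gP; have /andP[_ /eqP[eg em]] : (g \in [set: 'S_n]) && (F T g == F T g0) := gP.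
  rewrite mem_rcoset; apply: stab_ktypeZ; split.
    by rewrite /commute [RHS]conjgC conjgM eg conjgK.
  by move=> v; have /ffunP/(_ (g v)) := em; rewrite !ffunE permK permM => <-.
apply: (@leq_trans (\sum_T #|O T|)%N); first by apply: leq_sum => T _; apply: card_O.
have cO T : #|O T| = (\sum_(o in marked_perms | o \in O T) 1)%N.
  rewrite -sum1_card; apply: eq_bigl => o.
  by case oT: (o \in O T); rewrite ?andbF // (subsetP (OP T)).
rewrite (eq_bigr _ (fun T _ => cO T)) (exchange_big_dep (mem marked_perms)) /=; last first.
  by move=> T o _ /andP[].
rewrite -sum1_card; apply: leq_sum => o _; rewrite sum1_card.
by apply/card_le1_eqP => T T' /andP[_ oT] /andP[_ oT']; exact: (disj o T' T oT' oT).
Qed.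

(** The right-hand side is the number of admissible labellings of k points, which links the Burnside
    count to the canonical monomials. *)
Lemma ffact_prod_addn k : ((k + b) ^_ k = \prod_(j < k) (b.+1 + j))%N.
Proof.
by elim: k => [|k IH]; rewrite ?big_ord0 // addSn ffactSS IH big_ord_recr mulnC /= addSn addnC.
Qed.

End Counting.

(** * Primitivity of the root of unity in the cycle characters *)

(* If 'Re y < 'Re u, then multiplying y by u^2 or by its inverse increases the real part. *)
Lemma unit_circle_sector (u y : algC) : `|u| = 1 -> `|y| = 1 -> 0 <= 'Im u -> u != 1 ->
  'Re y <= 'Re u -> 'Re (y * u ^+ 2) <= 'Re y -> 'Re (y * u^* ^+ 2) <= 'Re y ->
  y = u \/ y = u^*.
Proof.
move=> nu ny q0 u1 apu; rewrite !expr2 !(ReM, ImM) Re_conj Im_conj => h1 h2.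
have := normC2_Re_Im u; have := normC2_Re_Im y; rewrite nu ny expr1n => ey eu.
suff ap : 'Re y = 'Re u.
  have : 'Im y ^+ 2 = 'Im u ^+ 2.
    by rewrite -['Im y ^+ 2](addKr ('Re y ^+ 2)) -['Im u ^+ 2](addKr ('Re y ^+ 2)) -ey ap eu.
  move/eqP; rewrite eqf_sqr => /orP[] /eqP im; [left|right]; apply/eqCP.
    by rewrite ap im.
  by rewrite Re_conj Im_conj ap im.
move: apu h1 h2 ey eu q0 (Creal_Re u) (Creal_Im u) (Creal_Re y) (Creal_Im y).
have pu1 : 'Im u = 0 -> 'Re u = -1.
  move=> im0; have := normC2_Re_Im u; rewrite nu im0 expr1n expr0n addr0 => /esym/eqP.
  rewrite sqrf_eq1 => /orP[] /eqP // re1; case/eqP: u1; apply/eqCP.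
  by rewrite re1 im0 (Creal_ReP _ _) ?rpred1 // (Creal_ImP _ _) ?rpred1.
move: ('Re u) ('Im u) ('Re y) ('Im y) pu1 => p q a c pu1 ap h1 h2 ey eu q0 Rp Rq Ra Rc.
apply/le_anti; rewrite ap /=.
have [qz|qnz] := eqVneq q 0.
  have : `|a| <= 1 by rewrite -(@expr_le1 _ 2) // real_normK // ey lerDl real_exprn_even_ge0.
  by rewrite (pu1 qz) real_ler_norml // => /andP[].
have {q0 qnz} q0 : 0 < q by rewrite lt_def qnz.
(* With u = p + iq and y = a + ic, the two hypotheses on rotated real parts divide by 2q into q a +
   p c >= 0 and q a - p c >= 0. Their sum gives a >= 0 and their product gives a^2 >= p^2. *)
have k1 : 0 <= q * a + p * c.
  rewrite -(pmulr_rge0 _ (q0)) -(pmulr_rge0 _ (ltr0Sn algC 1)).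
  have -> : 2%:R * (q * (q * a + p * c)) = a * (p ^+ 2 + q ^+ 2) - (a * (p * p - q * q) - c * (p * q + p * q)) by ring.
  by rewrite -eu mulr1 subr_ge0.
have k2 : 0 <= q * a - p * c.
  rewrite -(pmulr_rge0 _ (q0)) -(pmulr_rge0 _ (ltr0Sn algC 1)).
  have -> : 2%:R * (q * (q * a - p * c)) = a * (p ^+ 2 + q ^+ 2) - (a * (p * p - - q * - q) - c * (p * - q + p * - q)) by ring.
  by rewrite -eu mulr1 subr_ge0.
have a0 : 0 <= a.
  rewrite -(pmulr_rge0 _ (q0)) -(pmulr_rge0 _ (ltr0Sn algC 1)).
  have -> : 2%:R * (q * a) = (q * a + p * c) + (q * a - p * c) by ring.
  exact: addr_ge0.
have p0 : 0 <= p := le_trans a0 ap.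
have : 0 <= (q * a + p * c) * (q * a - p * c) by apply: mulr_ge0.
have -> : (q * a + p * c) * (q * a - p * c) = (1 - p ^+ 2) * a ^+ 2 - p ^+ 2 * (1 - a ^+ 2).
  by rewrite {1}eu ey; ring.
have -> : (1 - p ^+ 2) * a ^+ 2 - p ^+ 2 * (1 - a ^+ 2) = a ^+ 2 - p ^+ 2 by ring.
by rewrite subr_ge0 ler_pXn2r.
Qed.

Lemma zeta_expn l : (0 < l)%N -> zeta l ^+ l = 1.
Proof. by move=> l0; rewrite /zeta exprAC rootCK // sqrrN expr1n. Qed.

Lemma norm_root_unity (y : algC) l : (0 < l)%N -> y ^+ l = -1 -> `|y| = 1.
Proof.
move=> l0 e; apply/eqP; rewrite -(@pexpr_eq1 _ _ l) // -normrX e normrN1 //.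
Qed.

Lemma exists_max_real k (f : nat -> algC) : (0 < k)%N -> (forall j, f j \is Num.real) ->
  exists2 i, (i < k)%N & forall j, (j < k)%N -> f j <= f i.
Proof.
case: k => // k _ Rf; elim: k => [|k [i ik imax]].
  by exists 0%N => // j; rewrite ltnS leqn0 => /eqP ->.
have [le|lt] := real_leP (Rf k.+1) (Rf i).
  exists i => [|j]; first exact: ltnW.
  by rewrite ltnS leq_eqVlt => /predU1P[->|/imax].
exists k.+1 => // j; rewrite ltnS leq_eqVlt => /predU1P[->//|/imax le].
exact/ltW/(le_lt_trans le).
Qed.

(* If the order k of u^2 were smaller than l, rotate a primitive 2l-th root of unity by
   powers of u^2 into the sector between the conjugates of u; by the maximality of Re u
   it then equals u or its conjugate, hence is an odd power of u. *)
Lemma zeta_neq1 l k : (0 < k < l)%N -> zeta l ^+ k != 1.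
Proof.
case/andP=> k0 kl; have l0 : (0 < l)%N := ltn_trans k0 kl.
apply/eqP => zk; pose u : algC := l.-root (-1); have ul : u ^+ l = -1 by rewrite rootCK.
have uk : u ^+ (2 * k) = 1 by rewrite exprM.
have nu := norm_root_unity l0 ul.
have l2 : (0 < 2 * l)%N by rewrite muln_gt0.
have [y prim_y] := C_prim_root_exists l2.
have yl : y ^+ l = -1.
  have /eqP := prim_expr_order prim_y; rewrite mulnC exprM sqrf_eq1 => /orP[|/eqP //].
  rewrite -(prim_order_dvd prim_y) => /(dvdn_leq l0).
  by rewrite leqNgt mul2n -addnn -[X in (X < _)%N]addn0 ltn_add2l l0.
pose r j := y * u ^+ (2 * j).
have rl j : r j ^+ l = -1.
  by rewrite exprMn yl exprAC ul exprM sqrrN !expr1n mulr1.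
have r_mod j : r j = r (j %% k)%N.
  by rewrite /r {1}(divn_eq j k) mulnDr exprD mulnCA exprM exprAC uk expr1n mul1r.
have [i ik imax] := exists_max_real k0 (fun j => Creal_Re (r j)).
have rmax j : 'Re (r j) <= 'Re (r i) by rewrite r_mod imax ?ltn_mod.
have conj_u : u^* = u^-1 by rewrite invC_norm nu expr1n invr1 mul1r.
have u0 : u != 0 by rewrite -normr_eq0 nu oner_eq0.
(* The chosen root has the largest real part among the l-th roots of -1 in the closed upper half
   plane; conjugation handles the lower one. *)
have Re_u (z : algC) : z ^+ l = -1 -> 'Re z <= 'Re u.
  move=> zl; have [z0|z0] := real_leP (rpred0 _ : 0 \is Num.real) (Creal_Im z).
    exact: rootC_Re_max.
  rewrite -Re_conj; apply: rootC_Re_max; rewrite // ?Im_conj ?oppr_ge0 ?ltW //.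
  by rewrite -rmorphXn zl rmorphN1.
have u1 : u != 1.
  apply/eqP => u1; have := ul; rewrite u1 expr1n => /eqP.
  by rewrite -subr_eq0 opprK -mulr2n pnatr_eq0.
have l1 : (1 < l)%N by apply: leq_ltn_trans k0 kl.
(* The 2k-th power of [r i] equals that of [y], whose order 2l exceeds 2k. *)
have no_y : r i ^+ (2 * k) = 1 -> False.
  rewrite exprMn [X in _ * X]exprAC uk expr1n mulr1 => y2k.
  have := prim_order_dvd prim_y (2 * k)%N; rewrite y2k eqxx => /(dvdn_leq _).
  by rewrite muln_gt0 k0 leq_mul2l /= leqNgt kl => /(_ isT).
have [||e|e] := unit_circle_sector nu (norm_root_unity l0 (rl i)) (Im_rootC_ge0 _ l1) u1 (Re_u _ (rl i)).
- by rewrite -mulrA -exprD -[2%N]muln1 -mulnDr addn1 rmax.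
- have -> : r i * u^* ^+ 2 = r (i + k.-1)%N; last exact: rmax.
  apply: (mulIf (expf_neq0 2 u0)); rewrite conj_u -mulrA -exprMn mulVf // expr1n mulr1.
  rewrite -mulrA -exprD -{2}[2%N]muln1 -mulnDr -addnA addn1 prednK // -/(r _).
  by rewrite [RHS]r_mod modnDr -r_mod.
- apply: no_y; rewrite e uk //.
- by apply: no_y; rewrite e conj_u exprVn uk invr1.
Qed.

(** * Types of canonical monomials *)

Lemma uniq_snd_inj (A B : eqType) (r : seq (A * B)) a1 a2 j : uniq (map snd r) ->
  (a1, j) \in r -> (a2, j) \in r -> a1 = a2.
Proof.
elim: r => //= g r IH /andP[gr ur]; rewrite !inE.
case/predU1P=> [e1|r1] /predU1P[e2|r2]; last exact: IH.
- by move: e2; rewrite -e1 => -[].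
- by move: gr; rewrite -e1 (map_f snd r2).
- by move: gr; rewrite -e2 (map_f snd r1).
Qed.

Section Labels.

Variables (m b : nat) (H : falgType rat) (gr : nat -> {vspace H}).
Hypothesis H_cohomology : connected_PD_algebra m gr.
Variables (w : H) (x : 'I_b.+1 -> H) (deg : 'I_b.+1 -> nat).
Hypothesis x_basis : homogeneous_basis m gr w x deg.
Variable n : nat.
Hypothesis m_gt0 : (0 < m)%N.

Local Notation kriz := (kriz m n gr).
Local Notation kP := (@kP m n H gr).
Local Notation kG := (@kG m n H gr).
Local Notation klabel := (klabel b).
Local Notation kfactor := (@kfactor m b H gr x n).
Local Notation kmon := (@kmon m b H gr x n).
Local Notation khom := (@khom m H gr n).
Local Notation kmonomial := (@kmonomial m n b H gr x).

Definition label_mark (l : klabel n) : 'I_b.+1 := if l is inl h then h else ord0.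

Definition label_edges (t : 'I_n -> klabel n) (s : seq 'I_n) : seq ('I_n * 'I_n) :=
  pmap (fun j => if t j is inr a then Some (a, j) else None) s.

Definition mon_marks (t : 'I_n -> klabel n) (j : 'I_n) : 'I_b.+1 := label_mark (t j).

Definition mon_edges (t : 'I_n -> klabel n) := label_edges t (enum 'I_n).

Lemma mem_mon_edges t a j : ((a, j) \in mon_edges t) = (t j == inr a).
Proof.
rewrite mem_pmap; apply/mapP/eqP => [[j' _]|e]; last by exists j; rewrite ?mem_enum // e.
by case e : (t j') => [//|a'] [-> ->].
Qed.

Lemma mon_edges_snd t : map snd (mon_edges t) = [seq j <- enum 'I_n | t j != inl (label_mark (t j))].
Proof.
rewrite /mon_edges; elim: (enum 'I_n) => //= j s IH.
by case: (t j) => [h|a] /=; rewrite ?eqxx /= -IH.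
Qed.

Lemma mon_edges_sorted t : sorted (fun g g' : 'I_n * 'I_n => g.2 < g'.2)%N (mon_edges t).
Proof.
suff : sorted (fun j j' : 'I_n => j < j')%N (map snd (mon_edges t)) by rewrite sorted_map.
rewrite mon_edges_snd; apply: sorted_filter => [j1 j2 j3|]; first exact: ltn_trans.
have := iota_ltn_sorted 0 n; by rewrite -val_enum_ord sorted_map.
Qed.

Lemma mon_canonical t : admissible t -> canonical_monomial x (mon_marks t) (mon_edges t).
Proof.
move=> ta; split; last 1 first.
- by move=> [a j]; rewrite mem_mon_edges /mon_marks => /eqP -> /=; rewrite (hb_first x_basis).
- by move=> [a j]; rewrite mem_mon_edges => /eqP e /=; have := forallP ta j; rewrite e.
- exact: mon_edges_sorted.
Qed.

(** Strictly increasing larger endpoints mean that a point is the larger end of at most one edge, so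
    each point carries a single label; its mark is then forced to be 1. *)
Lemma canonical_label a r : canonical_monomial x a r ->
  exists t, [/\ admissible t, a =1 mon_marks t & r = mon_edges t].
Proof.
move=> [r_lt r_sorted r_mark].
have r_fun a1 a2 j : (a1, j) \in r -> (a2, j) \in r -> a1 = a2.
  have ur : uniq (map snd r).
    apply: (@sorted_uniq _ (fun j j' : 'I_n => j < j')%N) => [j1 j2 j3||]; first exact: ltn_trans.
      by move=> j'; rewrite ltnn.
    by rewrite sorted_map.
  exact: uniq_snd_inj ur.
pose t j : klabel n := if [pick a' | (a', j) \in r] is Some a' then inr a' else inl (a j).
have tE j a' : (t j == inr a') = ((a', j) \in r).
  rewrite /t; case: pickP => [a1 r1|no]; last by rewrite no.
  by apply/eqP/idP => [[<-]//|r2]; congr inr; apply: r_fun r1 r2.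
exists t; split.
- apply/forallP => j; case e : (t j) => [//|a']; apply: (r_lt (a', j)).
  by rewrite -tE e.
- move=> j; rewrite /mon_marks /t; case: pickP => [a' r1|//] /=.
  by apply: (x_inj x_basis); rewrite (r_mark (a', j)) // (hb_first x_basis).
apply: (@irr_sorted_eq _ (fun g g' : 'I_n * 'I_n => g.2 < g'.2)%N) => //.
- by move=> g1 g2 g3; apply: ltn_trans.
- by move=> g; rewrite ltnn.
- exact: mon_edges_sorted.
- by case=> a' j; rewrite mem_mon_edges tE.
Qed.

(** This is m_T. *)
Definition type_forest (T : ktype n b) : kriz :=
  kforest m gr x (fun i : 'I_(size T) => ktype_h T i) (fun i => block T i).

(** The same homogeneous factors in two orders, classes before edges against point by point; each
    new point changes only the sign. *)
Lemma kmonomial_kmon t : exists k : nat,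
  kmonomial (mon_marks t) (mon_edges t) = (-1) ^+ k *: kmon t.
Proof.
rewrite /kmonomial /kmon /mon_edges.
have -> : \prod_i kP i (x (mon_marks t i)) = \prod_(i <- enum 'I_n) kP i (x (mon_marks t i)).
  by rewrite enumT [index_enum _]unlock.
elim/last_ind: (enum 'I_n) => [|s j [k IH]].
  by exists 0%N; rewrite /label_edges /= !big_nil mulr1 scale1r.
have homA s' : exists q k, khom q k (\prod_(i <- s') kP i (x (mon_marks t i))).
  by apply: khom_prod => i; do 2!eexists; apply/khom_kP/(hb_homog x_basis).
have homB s' : exists q k, khom q k (\prod_(g <- label_edges t s') kG g.1 g.2).
  by apply: khom_prod => i; do 2!eexists; apply/khom_kG.
rewrite rev_rcons big_cons big_rcons /=.
have -> : label_edges t (rcons s j) = label_edges t s ++ label_edges t [:: j].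
  by rewrite -cats1 /label_edges pmap_cat.
rewrite big_cat /=.
set A := \prod_(i <- s) _ in IH *; set B := \prod_(g <- label_edges t s) _ in IH *.
have [qA [kA hA]] := homA s; have [qB [kB hB]] := homB s; rewrite -/A -/B in hA hB.
have sc c e f : (-1) ^+ c *: e = f -> e = (-1) ^+ c *: f :> kriz.
  by move=> <-; rewrite scalerA -expr2 sqrr_sign scale1r.
have {}IH := esym IH; have {IH} -> := sc _ _ _ IH.
rewrite /mon_marks /label_edges /=; case e : (t j) => [h|a'] /=.
  rewrite big_nil mulr1 -mulrA -palg_scalerAr; set Pj := kP j (x h).
  have hP : khom 0 (deg h) Pj by apply/khom_kP/(hb_homog x_basis).
  exists (kA * deg h + k)%N; rewrite scalerA -exprD -addnA addnn -signr_odd oddD odd_double addbF signr_odd.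
  by rewrite mulrA (khom_comm hA hP) -palg_scalerAl -mulrA.
rewrite (hb_first x_basis) rmorph1 mulr1 big_seq1 mulrA -palg_scalerAr.
have hG := khom_kG m gr a' j; have hAB := khomM hA hB.
exists ((kA + kB) * (2 * m - 1) + k)%N.
rewrite scalerA -exprD -addnA addnn -signr_odd oddD odd_double addbF signr_odd.
by rewrite (khom_comm hAB hG).
Qed.

Section RootFunction.

Variable t : 'I_n -> klabel n.
Hypothesis ta : admissible t.

Definition parent (j : 'I_n) : 'I_n := if t j is inr a then a else j.

(** For an admissible labelling the parent is smaller except at a root, so n steps always reach the
    root. *)
Definition tree_root (j : 'I_n) : 'I_n := iter n parent j.

Lemma parent_lt j a : t j = inr a -> (a < j)%N.
Proof. by move=> e; have := forallP ta j; rewrite e. Qed.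

Lemma parent_le j : (parent j <= j)%N.
Proof. by rewrite /parent; case e : (t j) => [//|a]; apply/ltnW/parent_lt. Qed.

Lemma iter_parent_le k j : (iter k parent j <= j)%N.
Proof. by elim: k => //= k; apply: leq_trans (parent_le _). Qed.

Lemma parent_iter k (j : 'I_n) : (j <= k)%N -> parent (iter k parent j) = iter k parent j.
Proof.
elim: k j => [|k IH] j jk.
  by apply/val_inj/eqP; rewrite eqn_leq parent_le (leq_trans jk).
rewrite iterSr; case e : (t j) => [h|a].
  have pj : parent j = j by rewrite /parent e.
  have it k' : iter k' parent j = j by elim: k' => //= k' ->.
  by rewrite pj it.
apply: IH; rewrite /parent e -ltnS; exact: leq_trans (parent_lt e) jk.
Qed.

Lemma parent_root j : parent (tree_root j) = tree_root j.
Proof. by apply: parent_iter; apply: ltnW. Qed.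

Lemma root_parent j : tree_root (parent j) = tree_root j.
Proof. by rewrite /tree_root -iterSr /= parent_root. Qed.

Lemma root_le j : (tree_root j <= j)%N. Proof. exact: iter_parent_le. Qed.

Lemma root_fix j : parent j = j -> tree_root j = j.
Proof.
move=> pj; have it k : iter k parent j = j by elim: k => //= k ->. exact: it.
Qed.

Lemma root_idem j : tree_root (tree_root j) = tree_root j.
Proof. exact/root_fix/parent_root. Qed.

Lemma marked_edge_root u v : marked_edge (mon_edges t) u v -> tree_root u = tree_root v.
Proof.
rewrite /marked_edge !mem_mon_edges => /orP[] /eqP e.
  by rewrite -[RHS]root_parent /parent e.
by rewrite -[LHS]root_parent /parent e.
Qed.

Lemma connect_root u v : connect (marked_edge (mon_edges t)) u v = (tree_root u == tree_root v).
Proof.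
have sym : connect_sym (marked_edge (mon_edges t)).
  by apply: sym_connect_sym => a c; rewrite /marked_edge orbC.
apply/idP/eqP => [/connectP[p + ->]|e].
  by elim: p u => //= a p IH u /andP[/marked_edge_root -> /IH].
have upk j k : connect (marked_edge (mon_edges t)) j (iter k parent j).
  elim: k => [|k IH] /=; first exact: connect0.
  apply: connect_trans IH _; set j' := iter _ _ _; rewrite /parent.
  case ej : (t j') => [h|a]; first exact: connect0.
  by apply: connect1; rewrite /marked_edge !mem_mon_edges ej eqxx orbT.
by apply: connect_trans (upk u n) _; rewrite sym [iter _ _ _]e upk.
Qed.

(* [f] numbers the trees of the forest of [t] compatibly with the type [T]. *)
Definition typed (T : ktype n b) (f : 'I_n -> 'I_(size T)) : Prop :=
  [/\ forall j a, t j = inr a -> (a < j)%N /\ f a = f j,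
      forall j h, t j = inl h ->
        h = ktype_h T (f j) /\ forall u : 'I_n, (u < j)%N -> f u != f j
    & forall i, #|[set u | f u == i]| = ktype_lam T i].

Arguments typed : clear implicits.

Lemma monomial_typed T : monomial_of_type x T (mon_marks t) (mon_edges t) ->
  exists f, typed T f.
Proof.
case=> f [f_conn f_card f_mark]; exists f.
have fE u v : (f u == f v) = (tree_root u == tree_root v) by rewrite f_conn connect_root.
have rootP j h : t j = inl h -> forall u : 'I_n, f u = f j -> (j <= u)%N.
  move=> e u /eqP; rewrite fE => /eqP ru; apply: leq_trans (root_le u).
  by rewrite ru root_fix // /parent e.
split=> // j.
  move=> a e; split; first exact: parent_lt.
  by apply/eqP; rewrite fE -[tree_root j]root_parent /parent e.
move=> h e; split; last first.
  by move=> u uj; apply/eqP => /(rootP _ _ e); rewrite leqNgt uj.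
apply: (x_inj x_basis); rewrite -(f_mark (f j) j) ?/mon_marks ?e // => v; exact: rootP e v.
Qed.

(** The roots, sorted by the size and mark of their trees, give [T]; a point is numbered by the
    position of its root in the sorted list. *)
Lemma type_exists : exists T : ktype n b,
  monomial_of_type x T (mon_marks t) (mon_edges t).
Proof.
pose lab (j : 'I_n) : 'I_n.+1 * 'I_b.+1 := (inord #|[set u | tree_root u == j]|, mon_marks t j).
pose roots := [seq j <- enum 'I_n | parent j == j].
pose rs := sort (fun i j => ktype_ge (lab i) (lab j)) roots.
have lab1 j : (lab j).1 = #|[set u | tree_root u == j]| :> nat.
  by rewrite inordK // ltnS; apply: leq_trans (max_card _) _; rewrite card_ord.
have rsP j : (j \in rs) = (parent j == j) by rewrite mem_sort mem_filter mem_enum andbT.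
have urs : uniq rs by rewrite sort_uniq filter_uniq ?enum_uniq.
have ge_total : total (fun i j => ktype_ge (lab i) (lab j)).
  move=> i j; rewrite /ktype_ge; move: (lab i).1 (lab j).1 (lab i).2 (lab j).2 => p q h h'.
  rewrite (eq_sym q); case: (ltngtP p q) => [||/val_inj ->]; rewrite ?orbT // eqxx /=;
    exact: leq_total.
have rs_size : (size (map lab rs) <= n)%N.
  by rewrite size_map size_sort size_filter (leq_trans (count_size _ _)) ?size_enum_ord.
have isT : is_ktype (Bseq rs_size).
  apply/and3P; split=> /=.
  - apply/allP => _ /mapP[j jrs ->]; rewrite lab1 card_gt0; apply/set0Pn; exists j.
    by rewrite inE root_fix //; apply/eqP; rewrite -rsP.
  - rewrite big_map (eq_bigr _ (fun j _ => lab1 j)).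
    have -> : (\sum_(j <- rs) #|[set u | tree_root u == j]| =
        \sum_(j <- roots) #|[set u | tree_root u == j]|)%N.
      by apply: perm_big; rewrite perm_sort.
    rewrite big_filter big_enum_cond /=.
    have nE : (n = \sum_(j : 'I_n) 1)%N by rewrite sum1_card card_ord.
    rewrite [X in _ == X]nE [X in _ == X](partition_big tree_root (fun j => parent j == j)) /=;
      last first.
      by move=> u _; rewrite parent_root.
    by apply/eqP; apply: eq_bigr => j _; rewrite -sum1_card; apply: eq_bigl => u; rewrite inE.
  by rewrite sorted_map; apply: sort_sorted.
exists (KType isT).
have sT : size (KType isT) = size rs by rewrite /= size_map.
have root_rs u : tree_root u \in rs by rewrite rsP parent_root.
have lt u : (index (tree_root u) rs < size (KType isT))%N by rewrite sT index_mem.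
pose f u : 'I_(size (KType isT)) := Ordinal (lt u); exists f.
have fE u i : (f u == i) = (tree_root u == nth u rs i).
  have irs : (i < size rs)%N by rewrite -sT.
  rewrite -val_eqE /=; apply/eqP/eqP => [<-|->]; first by rewrite nth_index.
  by rewrite index_uniq.
have labT (i : 'I_(size (KType isT))) j0 : nth (ord0, ord0) (KType isT) i = lab (nth j0 rs i).
  by rewrite /= (nth_map j0) // -sT.
split=> [u v|i|i u fu umin].
- rewrite connect_root -val_eqE /=; apply/eqP/eqP => [|->] //.
  by move=> /(congr1 (nth u rs)); rewrite !nth_index.
- have irs : (i < size rs)%N by rewrite -sT.
  have /hasP[j0 _ _] : has predT rs by rewrite has_predT; apply: leq_ltn_trans irs.
  rewrite /ktype_lam (labT i j0) lab1; apply: eq_card => u; rewrite !inE fE.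
  by congr (_ == _); apply: set_nth_default.
have /eqP ru : f u == i by apply/eqP.
have ur : tree_root u = u.
  apply/val_inj/eqP; rewrite eqn_leq root_le umin //.
  by apply/eqP; rewrite -fu -val_eqE /= root_idem.
rewrite /ktype_h (labT i u) /=; congr (x (mon_marks t _)).
by move/eqP: fu; rewrite fE ur => /eqP.
Qed.

Section Typed.

Variables (T : ktype n b) (f : 'I_n -> 'I_(size T)).
Hypothesis fT : typed T f.

Lemma typed_root (i : 'I_(size T)) : exists j, [/\ f j = i, t j = inl (ktype_h T i)
  & forall u, f u = i -> u != j -> exists a, t u = inr a].
Proof.
have [f_edge f_root f_card] := fT.
have : (0 < #|[set u | f u == i]|)%N by rewrite f_card ktype_lam_gt0.
case/card_gt0P=> u0; rewrite inE => u0i.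
case: (@arg_minnP _ u0 (fun u => f u == i) val u0i) => j /eqP ji jmin; exists j.
case e : (t j) => [h|a]; last first.
  have [aj fa] := f_edge _ _ e; have := jmin a; rewrite fa ji eqxx => /(_ isT).
  by rewrite leqNgt aj.
have [-> jroot] := f_root _ _ e; split=> //; first by rewrite ji.
move=> u ui uj; case eu : (t u) => [h'|a]; last by exists a.
have ju : (j < u)%N by rewrite ltn_neqAle eq_sym uj; apply: jmin; rewrite ui.
by have [_ /(_ j ju)] := f_root _ _ eu; rewrite ji ui eqxx.
Qed.

(** Each tree has one root, which carries the mark, and all its other points carry edges. Both
    bidegrees are instances. *)
Lemma typed_sum (F : klabel n -> nat) c : (forall a, F (inr a) = c) ->
  (\sum_j F (t j) = \sum_(i < size T) (F (inl (ktype_h T i)) + (ktype_lam T i - 1) * c))%N.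
Proof.
move=> Fc; have [_ _ f_card] := fT.
rewrite (partition_big f predT) //=; apply: eq_bigr => i _.
have [j [ji tj uj]] := typed_root i.
rewrite (bigD1 j) /= ?ji // tj; congr addn.
rewrite (eq_bigr (fun => c)) => [|u /andP[/eqP ui /(uj _ ui)[a ->]] //].
rewrite sum_nat_const; congr muln; rewrite -f_card (cardsD1 j) inE ji eqxx addKn.
by apply: eq_card => u; rewrite !inE andbC.
Qed.

Lemma typed_bidegree :
  mon_bidegree m deg t (ktype_q T) (ktype_deg T deg + ktype_q T * (2 * m - 1)).
Proof.
split.
  rewrite (typed_sum (c := 1)) //; apply: eq_bigr => i _; by rewrite muln1.
rewrite (typed_sum (c := 2 * m - 1)) // big_split /= /ktype_q big_distrl /=.
by [].
Qed.

(** The words of the forest partition the points and have the lengths of the blocks, so reading them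
    letter by letter against the blocks defines a permutation taking m_T to the forest. *)
Lemma kmon_typed :
  lspan (fun e => exists s : 'S_n, e = kact s (type_forest T)) (kmon t).
Proof.
have [f_edge f_root f_card] := fT.
have f_root' j h : t j = inl h -> h = ktype_h T (f j) /\ forall u : 'I_n, (u < j)%N -> f u != f j.
  exact: f_root.
have := kmon_forest (hs := fun i => ktype_h T i) x_basis m_gt0 f_edge f_root'.
apply: lspan_trans => _ [ws ws_perm ->]; apply: lspan_base.
have sz i : size (ws i) = size (block T i).
  rewrite size_block // (perm_size (ws_perm i)) -f_card -sum1_card size_filter -sum1_count big_enum_cond.
  by apply: eq_bigl => u; rewrite inE.
have uws i : uniq (ws i) by rewrite (perm_uniq (ws_perm i)) filter_uniq ?enum_uniq.
have mws i u : (u \in ws i) = (f u == i) by rewrite (perm_mem (ws_perm i)) mem_filter mem_enum andbT.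
pose bi u := Ordinal (bidx_lt T u).
pose g u := nth u (ws (bi u)) (index u (block T (bidx T u))).
have idx_lt u : (index u (block T (bidx T u)) < size (ws (bi u)))%N.
  by rewrite sz index_mem mem_bidx.
have fg u : f (g u) = bi u by apply/eqP; rewrite -mws mem_nth.
have g_inj : injective g.
  move=> u v e; have buv : bi u = bi v by rewrite -!fg e.
  have buv' : bidx T u = bidx T v := congr1 val buv.
  have vB : v \in block T (bidx T u) by rewrite buv' mem_bidx.
  have eW : nth u (ws (bi u)) (index u (block T (bidx T u))) =
      nth u (ws (bi u)) (index v (block T (bidx T u))).
    move: e; rewrite /g -buv -buv' => ->; apply: set_nth_default.
    by rewrite sz index_mem.
  move/eqP: eW; rewrite nth_uniq ?sz ?index_mem ?mem_bidx // => /eqP.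
  by apply: index_inj; rewrite ?mem_bidx.
exists (perm g_inj); rewrite kact_kforest //; apply: eq_kforest => i.
have /hasP[j0 _ _] : has predT (block T i).
  by rewrite has_predT size_block ?ktype_lam_gt0.
apply: (@eq_from_nth _ j0); first by rewrite size_map sz.
move=> k; rewrite sz => kb; rewrite (nth_map j0) // permE /g.
have bk : bidx T (nth j0 (block T i) k) = i by apply: bidx_block; apply: mem_nth.
have -> : bi (nth j0 (block T i) k) = i by apply: val_inj.
rewrite bk index_uniq ?block_uniq //; apply: set_nth_default; by rewrite sz.
Qed.

End Typed.
End RootFunction.
End Labels.

(** * The vector generating E(L, H) *)

Lemma prod_adjacent (A : pzRingType) (F : nat -> A) t i : (i.+1 < t)%N ->
  \prod_(j < t) F j =
    (\prod_(0 <= j < i) F j) * (F i * F i.+1) * \prod_(i.+2 <= j < t) F j.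
Proof.
move=> it; rewrite -(big_mkord predT) (@big_cat_nat _ _ _ i.+2) //=.
by rewrite !big_nat_recr //= !mulrA.
Qed.

Lemma odd_cycle n (c : 'S_n) r s : uniq (r :: s) ->
  map c (r :: s) = rot 1 (r :: s) -> supported c (r :: s) -> odd_perm c = odd (size s).
Proof.
elim: s c => [|a s IH] c us cs cf.
  suff -> : c = 1%g by rewrite odd_perm1.
  apply/permP => v; rewrite perm1; have [->|vr] := eqVneq v r; first by case: cs.
  by apply: cf; rewrite inE.
have ra : r != a by move: us; rewrite cons_uniq inE negb_or => /andP[/andP[]].
pose c' := (tperm r a * c)%g.
have cr : c r = a by move: cs; rewrite rot1_cons /= => -[].
have -> : c = (tperm r a * c')%g by rewrite mulgA tperm2 mul1g.
rewrite odd_permM odd_tperm ra (IH c') //.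
- by move: us; rewrite /= inE negb_or => /andP[/andP[_ ->] /andP[_ ->]].
- move: us cs; rewrite !rot1_cons /= inE negb_or => /andP[/andP[_ rs] /andP[as_ _]].
  case=> _; case: s rs as_ {IH cf} => [|d s] /= rs as_.
    by case=> e; rewrite permM tpermL e.
  case=> ca e; rewrite permM tpermL ca; congr (_ :: _); rewrite -e.
  rewrite -[LHS]/(map c' (d :: s)) -[RHS]/(map c (d :: s)).
  apply/eq_in_map => v vs; rewrite permM tpermD //; apply/eqP => ev; move: vs.
    by rewrite -ev (negPf rs).
  by rewrite -ev (negPf as_).
- move=> v vs; rewrite permM; have [->|va] := eqVneq v a; first by rewrite tpermR.
  have vr : v != r by apply: contraNneq vs => ->; rewrite mem_head.
  rewrite tpermD 1?eq_sym //; apply: cf.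
  by move: vs; rewrite !inE !negb_or va => /andP[-> ->].
Qed.

Section Forest.

Variables (m b : nat) (H : falgType rat) (gr : nat -> {vspace H}).
Hypothesis H_cohomology : connected_PD_algebra m gr.
Variables (w : H) (x : 'I_b.+1 -> H) (deg : 'I_b.+1 -> nat).
Hypothesis x_basis : homogeneous_basis m gr w x deg.
Variable n : nat.
Hypothesis m_gt0 : (0 < m)%N.

Local Notation kriz := (kriz m n gr).
Local Notation kmon := (@kmon m b H gr x n).
Local Notation khom := (@khom m H gr n).
Local Notation kact := (@kact m n H gr).
Local Notation kword := (@kword m b H gr x n).
Local Notation type_forest := (@type_forest m b H gr x n).

Lemma kact_lin s a e f : kact s (a *: e + f) = a *: kact s e + kact s f.
Proof. by rewrite kactD // kactZ. Qed.

Lemma kact0 s : kact s 0 = 0.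
Proof. by have := kactZ m_gt0 s 0 (0 : kriz); rewrite !scale0r. Qed.

Lemma kact_comp s s' e : kact (s * s')%g e = kact s' (kact s e).
Proof.
have := lspan_kmon H_cohomology x_basis m_gt0 e; elim/lspan_ind => [|a f g ef eg|_ [t _ ->]].
- by rewrite !kact0.
- by rewrite !kact_lin ef eg.
rewrite /kmon !kact_prod //; apply: eq_bigr => j _; rewrite /kfactor.
by case: (t j) => [h|a]; rewrite ?kact_kP ?kact_kG // !permM.
Qed.

Lemma kact_id e : kact 1%g e = e.
Proof.
have := lspan_kmon H_cohomology x_basis m_gt0 e; elim/lspan_ind => [|a f g ef eg|_ [t _ ->]].
- by rewrite kact0.
- by rewrite kact_lin ef eg.
rewrite /kmon kact_prod //; apply: eq_bigr => j _; rewrite /kfactor.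
by case: (t j) => [h|a]; rewrite ?kact_kP ?kact_kG // !perm1.
Qed.

Variable T : ktype n b.

Definition swap_sign (i : nat) : rat :=
  if odd (deg (ktype_h T i)) then (-1) ^+ ktype_lam T i else (-1) ^+ (ktype_lam T i).+1.

(** The swap exchanges two adjacent factors of equal degree [deg] + (lambda - 1)(2m - 1). Restoring
    their order gives -1 to the square of that degree, hence to its parity: this is alpha. *)
Lemma kact_block_swap i : swappable T i ->
  kact (block_swap T i) (type_forest T) = swap_sign i *: type_forest T.
Proof.
move=> sw; have [m1 m2 m3] := block_swapP sw.
have [it /eqP el /eqP eh] := and3P sw.
pose F k := kword (ktype_h T k) (block T k).
have -> : type_forest T = \prod_(k < size T) F k by [].
have F_hom k : (k < size T)%N ->
    khom (ktype_lam T k).-1 (deg (ktype_h T k) + (ktype_lam T k).-1 * (2 * m - 1)) (F k).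
  move=> kt; rewrite -(size_block kt); apply: (kword_hom x_basis).
  by rewrite -size_eq0 size_block // -lt0n ktype_lam_gt0.
have F_fix k : k != i -> k != i.+1 -> kact (block_swap T i) (F k) = F k.
  move=> ki ki1; rewrite /F kact_kword //; congr (kword _ _).
  rewrite -[RHS]map_id; apply/eq_in_map => v; rewrite mem_block_bidx => /eqP vk.
  by apply: m3; rewrite vk.
rewrite (prod_adjacent F it) !(kactM m_gt0) !kact_prod //.
have -> : \prod_(0 <= k < i) kact (block_swap T i) (F k) = \prod_(0 <= k < i) F k.
  apply: eq_big_nat => k /andP[_ ki]; apply: F_fix; rewrite neq_ltn ?ki //.
  by rewrite (ltn_trans ki).
have -> : \prod_(i.+2 <= k < size T) kact (block_swap T i) (F k) =
    \prod_(i.+2 <= k < size T) F k.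
  apply: eq_big_nat => k /andP[ik _]; apply: F_fix; rewrite neq_ltn ?ik ?orbT //.
  by rewrite (ltnW ik) orbT.
have -> : kact (block_swap T i) (F i) = F i.+1 by rewrite /F kact_kword // m1 eh.
have -> : kact (block_swap T i) (F i.+1) = F i by rewrite /F kact_kword // m2 eh.
rewrite (khom_comm (F_hom i.+1 it) (F_hom i (ltnW it))).
rewrite -palg_scalerAr -palg_scalerAl; congr (_ *: _).
rewrite -eh -el -signr_odd oddM andbb oddD oddM.
have -> : odd (2 * m - 1) by rewrite oddB ?muln_gt0 // oddM.
rewrite andbT /swap_sign; have := ktype_lam_gt0 (ltnW it).
case: (ktype_lam T i) => // l _ /=; rewrite signr_addb -signr_odd.
by case: (odd (deg _)); rewrite ?expr0 ?expr1 ?exprS ?mulN1r ?opprK ?mul1r ?signr_odd.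
Qed.

End Forest.

(** * Modules generated by an eigenvector of a subgroup *)

Section InducedTrace.

Import GroupScope.
Local Open Scope ring_scope.

Variables (gT : finGroupType) (G Z : {group gT}) (N : nat).
Variables (rG : mx_representation algC G N) (v : 'rV[algC]_N).
Hypothesis sZG : Z \subset G.
Hypothesis v_stable : forall z, z \in Z -> (v *m rG z <= v)%MS.
Hypothesis v_neq0 : v != 0.

Definition line_mx (z : gT) : 'M[algC]_1 := v *m rG z *m pinvmx v.

Lemma line_mxE z : z \in Z -> v *m rG z = line_mx z *m v.
Proof. by move=> zZ; rewrite mulmxKpV // v_stable. Qed.

Lemma line_repr : mx_repr Z line_mx.
Proof.
have v_inj (a a' : 'M_1) : a *m v = a' *m v -> a = a'.
  by apply: row_free_inj; rewrite /row_free rank_rV v_neq0.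
split=> [|y z yZ zZ]; apply: v_inj.
  by rewrite -line_mxE // repr_mx1 mulmx1 mul1mx.
rewrite -line_mxE ?groupM // repr_mxM ?(subsetP sZG) // -mulmxA -(line_mxE zZ).
by rewrite !mulmxA -(line_mxE yZ).
Qed.

Definition line_char : 'CF(Z) := cfRepr (MxRepresentation line_repr).

Lemma line_char_lin : line_char \is a linear_char.
Proof. by rewrite qualifE /= cfRepr_char cfRepr1 eqxx. Qed.

Lemma line_charE z : z \in Z -> v *m rG z = line_char z *: v.
Proof.
move=> zZ; rewrite line_mxE // cfunE zZ /= mulr1n /mxtrace big_ord1.
by rewrite [line_mx z in LHS]mx11_scalar mul_scalar_mx.
Qed.

Lemma line_char_eq z a : z \in Z -> v *m rG z = a *: v -> line_char z = a.
Proof.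
move=> zZ; rewrite line_charE // => /eqP; rewrite -subr_eq0 -scalerBl scaler_eq0.
by rewrite (negPf v_neq0) orbF subr_eq0 => /eqP.
Qed.

Local Notation k := #|rcosets Z G|.

(** Right cosets, because the action on row vectors is from the right: the line through v g depends
    only on Z g. *)
Definition coset_rep (i : 'I_k) : gT := repr (enum_val i).

Lemma coset_rep_coset i : Z :* coset_rep i = enum_val i /\ coset_rep i \in G.
Proof.
have /rcosetsP[y yG e] := enum_valP i; rewrite /coset_rep e rcoset_repr; split=> //.
have /rcosetP[z zZ ->] := mem_repr_rcoset Z y; by rewrite groupM // (subsetP sZG).
Qed.

Lemma coset_rep_exists g : g \in G -> exists i, forall j, (g * (coset_rep j)^-1 \in Z)%g = (j == i).
Proof.
move=> gG; have gC : Z :* g \in rcosets Z G by apply/rcosetsP; exists g.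
exists (enum_rank_in gC (Z :* g)) => j.
rewrite -mem_rcoset (coset_rep_coset j).1 -(inj_eq enum_val_inj) enum_rankK_in //.
by rewrite -(coset_rep_coset j).1 -(sameP eqP (rcoset_eqP)) eq_sym.
Qed.

Definition coset_mx : 'M[algC]_(k, N) := \matrix_i (v *m rG (coset_rep i)).

(** A class function on [Z] is extended by 0, so each row has exactly one nonzero entry. *)
Definition coset_act (s : gT) : 'M[algC]_k :=
  \matrix_(i, j) line_char (coset_rep i * s * (coset_rep j)^-1)%g.

Lemma coset_mx_row g : g \in G ->
  v *m rG g = \sum_j line_char (g * (coset_rep j)^-1)%g *: (v *m rG (coset_rep j)).
Proof.
move=> gG; have [i iP] := coset_rep_exists gG; rewrite (bigD1 i) //= big1 => [|j ji]; last first.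
  by rewrite cfun0 ?scale0r // iP.
have zZ : (g * (coset_rep i)^-1)%g \in Z by rewrite iP.
have [_ iG] := coset_rep_coset i.
by rewrite addr0 scalemxAl -line_charE // -mulmxA -repr_mxM ?(subsetP sZG _ zZ) // mulgKV.
Qed.

Lemma coset_mx_act s : s \in G -> coset_mx *m rG s = coset_act s *m coset_mx.
Proof.
move=> sG; apply/row_matrixP => i; have [_ iG] := coset_rep_coset i.
rewrite row_mul rowK -mulmxA -repr_mxM // coset_mx_row ?groupM // row_mul mulmx_sum_row.
by apply: eq_bigr => j _; rewrite rowK !mxE.
Qed.

Lemma cyclic_coset_mx : (cyclic_mx rG v <= coset_mx)%MS.
Proof.
apply: cyclic_mx_sub.
  by apply/mxmoduleP => s sG; rewrite coset_mx_act // submxMl.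
rewrite -[v]mulmx1 -(repr_mx1 rG) coset_mx_row //; apply: summx_sub => j _.
by apply: scalemx_sub; rewrite -(rowK (fun j => v *m rG (coset_rep j)) j) row_sub.
Qed.

Lemma rank_cyclic_index : (\rank (cyclic_mx rG v) <= #|G : Z|)%N.
Proof. by apply: leq_trans (mxrankS cyclic_coset_mx) _; apply: rank_leq_row. Qed.

(** In the formula for the induced character, after inverting the summation variable, the summand is
    constant on right cosets of [Z]; each coset therefore contributes one diagonal entry, and its
    size cancels the normalisation. *)
Lemma trace_coset_act s : s \in G -> \tr (coset_act s) = 'Ind[G] line_char s.
Proof.
move=> sG; rewrite cfIndE // (reindex_inj invg_inj) /=.
rewrite (eq_bigl (fun y => y \in G)) => [|y]; last by rewrite groupV.
rewrite (set_partition_big _ (rcosets_partition sZG)) /= big_enum_val /= mulr_sumr.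
apply: eq_bigr => i _; rewrite mxE -(coset_rep_coset i).1.
rewrite (eq_bigr (fun=> line_char (coset_rep i * s * (coset_rep i)^-1)%g)).
  by rewrite sumr_const card_rcoset -[X in _ * X]mulr_natl mulKf // neq0CG.
move=> _ /rcosetP[z zZ ->]; rewrite -[RHS](cfunJ _ _ (groupVr zZ)); congr (line_char _).
by rewrite !conjgE !invgK invMg !mulgA.
Qed.

(* The rows of coset_mx form a basis of the module generated by v, in which s acts by the
   monomial matrix coset_act s. *)
Lemma trace_induced (p : 'M[algC]_N) s : s \in G -> p *m p = p ->
  (p :=: cyclic_mx rG v)%MS -> \rank p = #|G : Z| -> \tr (p *m rG s) = 'Ind[G] line_char s.
Proof.
move=> sG pp pK rp; rewrite -trace_coset_act //.
have pM : (p <= coset_mx)%MS by rewrite pK cyclic_coset_mx.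
have rM : \rank coset_mx = k.
  by apply/eqP; rewrite eqn_leq rank_leq_row; have := mxrankS pM; rewrite rp.
have Mp : (coset_mx <= p)%MS by rewrite -(mxrank_leqif_sup pM) rp rM.
have [X Xp] := submxP pM; have [Y YM] := submxP Mp.
have Mpp : coset_mx *m p = coset_mx by rewrite YM -mulmxA pp.
have MX : coset_mx *m X = 1%:M.
  apply: (@row_free_inj _ _ _ _ coset_mx); first by rewrite /row_free rM.
  by rewrite mul1mx -mulmxA -Xp.
by rewrite Xp -mulmxA mxtrace_mulC coset_mx_act // -mulmxA MX mulmx1.
Qed.

End InducedTrace.

Lemma supported_eq n (c c' : 'S_n) s : supported c s -> supported c' s ->
  map c s = map c' s -> c = c'.
Proof.
move=> cs cs' e; apply/permP => v; have [vs|vs] := boolP (v \in s); last by rewrite cs ?cs'.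
by move/eq_in_map: e; apply.
Qed.

Lemma mulmx_ringE (R : pzRingType) N (A B : 'M[R]_N) : A * B = A *m B.
Proof. by []. Qed.

Section TypeVector.

Variables (m b : nat) (H : falgType rat) (gr : nat -> {vspace H}).
Hypothesis H_cohomology : connected_PD_algebra m gr.
Variables (w : H) (x : 'I_b.+1 -> H) (deg : 'I_b.+1 -> nat).
Hypothesis x_basis : homogeneous_basis m gr w x deg.
Variable n : nat.
Hypothesis m_gt0 : (0 < m)%N.

Local Notation kriz := (kriz m n gr).
Local Notation kact := (@kact m n H gr).
Local Notation kword := (@kword m b H gr x n).
Local Notation type_forest := (@type_forest m b H gr x n).

Variables (N : nat) (rG : mx_representation algC [set: 'S_n] N).
Variable psi : kriz -> 'rV[algC]_N.
Hypothesis psi_lin : forall a e f, psi (a *: e + f) = ratr a *: psi e + psi f.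
Hypothesis psi_act : forall s e, psi (kact s e) = psi e *m rG s.

Local Notation cycle_proj := (cycle_proj rG).

Lemma cycle_projJ c y l d : cycle_proj c y l *m rG d = rG d *m cycle_proj (c ^ d)%g y l.
Proof.
rewrite mulmx_suml mulmx_sumr; apply: eq_bigr => j _.
rewrite -scalemxAl -scalemxAr -!repr_mxM ?inE //; congr (_ *: rG _).
by rewrite -conjXg -conjVg -conjgC.
Qed.

Lemma cycle_proj_comm c y l d : commute c d -> cycle_proj c y l *m rG d = rG d *m cycle_proj c y l.
Proof. by move=> cd; rewrite cycle_projJ conjgE cd mulKg. Qed.

Lemma cycle_proj_commr c y l c' y' l' : commute c c' ->
  cycle_proj c y l *m cycle_proj c' y' l' = cycle_proj c' y' l' *m cycle_proj c y l.
Proof.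
move=> cc; rewrite [LHS]mulmx_sumr [RHS]mulmx_suml; apply: eq_bigr => j _.
rewrite -scalemxAl -scalemxAr cycle_proj_comm //.
exact/commuteV/commuteX.
Qed.

Lemma cycle_proj_eigen (c : 'S_n) y l : (0 < l)%N -> (c ^+ l)%g = 1%g -> y ^+ l = 1 ->
  cycle_proj c y l *m rG c = y *: cycle_proj c y l.
Proof.
case: l => // l _ cl yl; rewrite mulmx_suml scaler_sumr big_ord_recl big_ord_recr /= addrC.
congr (_ + _).
  rewrite -scalemxAl -repr_mxM ?inE // scalerA -exprS yl expr0 expg0 invg1 mul1g; congr (_ *: rG _).
  by apply: (mulIg (c ^+ l)%g); rewrite mulVg -expgS.
apply: eq_bigr => j _; rewrite -scalemxAl -repr_mxM ?inE // scalerA -exprS; congr (_ *: rG _).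
by rewrite /bump /= add1n expgS invMg mulgKV.
Qed.

Variable T : ktype n b.
Local Notation t := (size T).
Local Notation lam := (ktype_lam T).
Local Notation cyc := (block_cycle T).

(** The value of phi on the i-th block cycle: the root of unity times the sign of a cycle of length
    lambda. *)
Definition cycle_value (i : nat) : algC := zeta (lam i) * (-1) ^+ (lam i).-1.

Definition block_proj (i : nat) : 'M[algC]_N := cycle_proj (cyc i) (cycle_value i) (lam i).

Definition type_vec : 'rV[algC]_N := psi (type_forest T) *m \prod_(i < t) block_proj i.

Lemma block_cycle_commute i j : commute (cyc i) (cyc j).
Proof.
have [->//|ij] := eqVneq i j.
apply: (supported_commute (@block_cycle_supported _ _ T i)) => v.
rewrite mem_block_bidx => /eqP vi; apply: block_cycle_supported.
by rewrite mem_block_bidx vi.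
Qed.

Lemma block_proj_cycle i j : block_proj i *m rG (cyc j) = rG (cyc j) *m block_proj i.
Proof. exact/cycle_proj_comm/block_cycle_commute. Qed.

Lemma block_proj_eigen i : (i < t)%N ->
  block_proj i *m rG (cyc i) = cycle_value i *: block_proj i.
Proof.
move=> it; apply: cycle_proj_eigen; first exact: ktype_lam_gt0.
  rewrite -(size_block it); apply: expg_size; last exact: block_cycle_supported.
  exact: map_block_cycle.
rewrite exprMn zeta_expn ?ktype_lam_gt0 // mul1r -exprM -signr_odd oddM.
by have := ktype_lam_gt0 it; case: (lam i) => // l _ /=; rewrite andbN.
Qed.

Lemma type_vec_cycle i : (i < t)%N -> type_vec *m rG (cyc i) = cycle_value i *: type_vec.
Proof.
move=> it; rewrite /type_vec -mulmxA scalemxAr; congr (_ *m _).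
have comm r : (forall j, j \in r -> j != i) ->
    (\prod_(j <- r) block_proj j) *m rG (cyc i) = rG (cyc i) *m \prod_(j <- r) block_proj j.
  elim: r => [|j r IH] ri; first by rewrite big_nil mulmx1 mul1mx.
  rewrite big_cons mulmx_ringE -mulmxA IH => [|j' j'r]; last by rewrite ri // inE j'r orbT.
  by rewrite !mulmxA block_proj_cycle.
rewrite -(big_mkord predT) (@big_cat_nat _ _ _ i) //=; last exact: ltnW.
rewrite mulmx_ringE (big_ltn it) mulmx_ringE -!mulmxA comm => [|j]; last first.
  by rewrite mem_index_iota => /andP[ij _]; rewrite neq_ltn ij orbT.
by rewrite (mulmxA (block_proj i)) block_proj_eigen // -scalemxAl -scalemxAr.
Qed.

Lemma block_cycle_swap i : swappable T i ->
  [/\ (cyc i ^ block_swap T i = cyc i.+1)%g, (cyc i.+1 ^ block_swap T i = cyc i)%g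
    & forall j, j != i -> j != i.+1 -> (cyc j ^ block_swap T i = cyc j)%g].
Proof.
move=> sw; have [m1 m2 m3] := block_swapP sw.
have conj j k : map (block_swap T i) (block T j) = block T k ->
    (cyc j ^ block_swap T i = cyc k)%g.
  move=> e; apply: (@supported_eq _ _ _ (block T k)).
  - move=> v vk; have {}vk : (block_swap T i)^-1%g v \notin block T j.
      by apply: contra vk => vj; rewrite -e -[v](permKV (block_swap T i)) map_f.
    by rewrite conjgE !permM (block_cycle_supported vk) permKV.
  - exact: block_cycle_supported.
  rewrite map_block_cycle -e -map_rot -map_block_cycle -!map_comp; apply: eq_map => v /=.
  by rewrite conjgE !permM permK.
split; [exact: conj | exact: conj | move=> j ji ji1].
rewrite conjgE; suff -> : (cyc j * block_swap T i = block_swap T i * cyc j)%g by rewrite mulKg.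
apply: (supported_commute (@block_cycle_supported _ _ T j)) => v.
by rewrite mem_block_bidx => /eqP vj; apply: m3; rewrite vj.
Qed.

(** Conjugation by the swap exchanges the projectors of the two blocks and fixes the others. The two
    commute, so the swap passes through the whole product and acts on m_T by its sign. *)
Lemma type_vec_swap i : swappable T i ->
  type_vec *m rG (block_swap T i) = ratr (swap_sign deg T i) *: type_vec.
Proof.
move=> sw; have [c1 c2 c3] := block_cycle_swap sw.
have [it /eqP el /eqP eh] := and3P sw.
have ev : cycle_value i = cycle_value i.+1 by rewrite /cycle_value el.
have proj1 : block_proj i *m rG (block_swap T i) = rG (block_swap T i) *m block_proj i.+1.
  by rewrite /block_proj cycle_projJ c1 el ev.
have proj2 : block_proj i.+1 *m rG (block_swap T i) = rG (block_swap T i) *m block_proj i.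
  by rewrite /block_proj cycle_projJ c2 el ev.
have comm r : (forall j, j \in r -> (j != i) && (j != i.+1)) ->
    (\prod_(j <- r) block_proj j) *m rG (block_swap T i) =
    rG (block_swap T i) *m \prod_(j <- r) block_proj j.
  elim: r => [|j r IH] ri; first by rewrite big_nil mulmx1 mul1mx.
  rewrite big_cons mulmx_ringE -mulmxA IH => [|j' j'r]; last by rewrite ri // inE j'r orbT.
  have /andP[ji ji1] := ri j (mem_head _ _).
  by rewrite !mulmxA [block_proj j *m _]cycle_projJ c3.
have swap12 : block_proj i *m block_proj i.+1 = block_proj i.+1 *m block_proj i.
  exact/cycle_proj_commr/block_cycle_commute.
have e : (\prod_(j < t) block_proj j) *m rG (block_swap T i) =
    rG (block_swap T i) *m \prod_(j < t) block_proj j.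
  rewrite (prod_adjacent block_proj it) !mulmx_ringE -!mulmxA comm => [|j]; last first.
    rewrite mem_index_iota => /andP[ij _]; rewrite !neq_ltn ij orbT andbT.
    by rewrite (ltnW ij) orbT.
  rewrite (mulmxA (block_proj i.+1)) proj2 -(mulmxA (rG _)) (mulmxA (block_proj i)) proj1.
  rewrite -[in LHS]mulmxA !(mulmxA _ (rG _)) comm => [|j]; last first.
    rewrite mem_index_iota => /andP[_ ji]; rewrite !neq_ltn ji /=.
    by rewrite (leqW ji).
  by rewrite (mulmxA (block_proj i.+1)) -swap12 -!mulmxA.
rewrite /type_vec -mulmxA e mulmxA -psi_act (kact_block_swap x_basis m_gt0 sw).
by rewrite (psiZ psi_lin) -scalemxAl.
Qed.

Lemma type_vec_stable z : z \in ktypeZ T -> (type_vec *m rG z <= type_vec)%MS.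
Proof.
suff sub : ktypeZ T \subset rstabs rG type_vec.
  by move=> zZ; have := subsetP sub z zZ; rewrite inE => /andP[].
rewrite join_subG; apply/andP; split.
  rewrite /ktypeC bigprodGE gen_subG; apply/bigcupsP => i _.
  by rewrite cycle_subG inE inE /= type_vec_cycle // scalemx_sub.
rewrite gen_subG; apply/subsetP => c /imsetP[i]; rewrite inE => sw -> {c}.
by rewrite inE inE /= type_vec_swap // scalemx_sub.
Qed.

(* [klyachko_word] is applied to the blocks one after the other; the resulting operators
   commute with the projectors of the other blocks. *)
Lemma forest_prefix k : (k <= t)%N -> exists B : 'M[algC]_N,
  (forall U : 'M_N, mxmodule rG U -> (U *m B <= U)%MS) /\
  psi (type_forest T) = psi (type_forest T) *m \prod_(0 <= i < k) block_proj i *m B.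
Proof.
elim: k => [_|k IH kt].
  by exists 1%:M; split=> [U _|]; rewrite ?mulmx1 // big_geq // mulmx1.
have [B [BU e]] := IH (ltnW kt).
pose F i := kword (ktype_h T i) (block T i).
have F_fix i d : i != k -> supported d (block T k) -> kact d (F i) = F i.
  move=> ik dk; rewrite /F kact_kword //; congr (kword _ _).
  rewrite -[RHS]map_id; apply/eq_in_map => v; rewrite mem_block_bidx => /eqP vi.
  by apply: dk; rewrite mem_block_bidx vi.
have fE : type_forest T = (\prod_(0 <= i < k) F i) * F k * \prod_(k.+1 <= i < t) F i.
  rewrite [LHS](_ : _ = \prod_(i < t) F i) // -(big_mkord predT).
  by rewrite (@big_cat_nat _ _ _ k.+1) //= big_nat_recr.
have fL : fixed_by (block T k) (\prod_(0 <= i < k) F i).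
  move=> d dk; rewrite kact_prod //; apply: eq_big_nat => i /andP[_ ik].
  by apply: F_fix => //; rewrite neq_ltn ik.
have fR : fixed_by (block T k) (\prod_(k.+1 <= i < t) F i).
  move=> d dk; rewrite kact_prod //; apply: eq_big_nat => i /andP[ik _].
  by apply: F_fix => //; rewrite neq_ltn ik orbT.
case eb : (block T k) => [|r s]; first by have := ktype_lam_gt0 kt; rewrite -size_block // eb.
have lamE : lam k = (size s).+1 by rewrite -(size_block kt) eb.
have u_rs : uniq (r :: s) by rewrite -eb block_uniq.
have c_rs : map (cyc k) (r :: s) = rot 1 (r :: s) by rewrite -eb map_block_cycle.
have s_rs : supported (cyc k) (r :: s) by rewrite -eb; apply: block_cycle_supported.
rewrite eb in fL fR.
have [|B' [[B'c B'U]]] := klyachko_word x_basis m_gt0 psi_lin psi_act (z := zeta (lam k))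
  (ktype_h T k) u_rs c_rs s_rs fL fR.
  by move=> i /andP[i0 il]; apply: zeta_neq1; rewrite i0 lamE.
rewrite -{1}eb in B'c; have fE' := fE; rewrite {2}/F eb in fE'; rewrite -fE' => e'.
exists (B' *m B); split=> [U mU|].
  by rewrite mulmxA (submx_trans _ (BU U mU)) // submxMr // B'U.
have {}e' : psi (type_forest T) = psi (type_forest T) *m block_proj k *m B'.
  by rewrite [LHS]e' /block_proj /cycle_value lamE.
have B'_comm i : i != k -> B' *m block_proj i = block_proj i *m B'.
  move=> ik; rewrite [LHS]mulmx_sumr [RHS]mulmx_suml; apply: eq_bigr => j _.
  rewrite -scalemxAl -scalemxAr B'c // => v vk; apply: (@supportedV _ _ (block T i)).
    exact/supportedX/block_cycle_supported.
  by move: vk; rewrite mem_block_bidx => /eqP vk; rewrite mem_block_bidx vk eq_sym.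
have comm r' : (forall i, i \in r' -> i != k) ->
    (block_proj k *m B') *m \prod_(i <- r') block_proj i =
    (\prod_(i <- r') block_proj i) *m (block_proj k *m B').
  elim: r' => [|i r' IHr] r'k; first by rewrite big_nil mulmx1 mul1mx.
  rewrite big_cons mulmx_ringE -[RHS]mulmxA -IHr => [|j jr]; last by rewrite r'k // inE jr orbT.
  rewrite !mulmxA -[_ *m B' *m _]mulmxA B'_comm ?r'k ?mem_head // !mulmxA.
  by rewrite [_ *m block_proj i]cycle_proj_commr //; apply: block_cycle_commute.
rewrite {1}e {1}e' big_nat_recr //= mulmx_ringE -!mulmxA; congr (_ *m _).
rewrite (mulmxA _ B') (mulmxA _ _ B) comm => [|i]; first by rewrite -!mulmxA.
by rewrite mem_index_iota => /andP[_ ik]; rewrite neq_ltn ik.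
Qed.

Lemma forest_in_cyclic : (psi (type_forest T) <= cyclic_mx rG type_vec)%MS.
Proof.
have [B [BU ->]] := forest_prefix (leqnn t).
rewrite big_mkord; apply: submx_trans (BU _ (cyclic_mx_module rG _)).
by rewrite submxMr // cyclic_mx_id.
Qed.

End TypeVector.

(** * The decomposition of the Kriz algebra *)

Section SignCharacter.

Variables (n : nat) (G : {group 'S_n}).

Lemma sign_repr : mx_repr G (fun s : 'S_n => ((-1) ^+ odd_perm s)%:M : 'M[algC]_1).
Proof.
split=> [|s s' _ _]; first by rewrite odd_perm1.
by rewrite odd_permM signr_addb scalar_mxM.
Qed.

Definition sign_char : 'CF(G) := cfRepr (MxRepresentation sign_repr).

Lemma sign_char_lin : sign_char \is a linear_char.
Proof. by rewrite qualifE /= cfRepr_char cfRepr1 eqxx. Qed.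

Lemma sign_charE s : s \in G -> sign_char s = (-1) ^+ odd_perm s.
Proof. by move=> sG; rewrite cfunE sG /= mulr1n mxtrace_scalar. Qed.

End SignCharacter.

Lemma odd_block_cycle n b (T : ktype n b) i : (i < size T)%N ->
  odd_perm (block_cycle T i) = odd (ktype_lam T i).-1.
Proof.
move=> it; have := map_block_cycle T i; have := @block_cycle_supported _ _ T i.
have := block_uniq T i; have := ktype_lam_gt0 it; rewrite -(size_block it).
by case: (block T i) => // r s _ us cf cs; rewrite (odd_cycle us cs cf).
Qed.

Lemma is_xi_intro n b (T : ktype n b) deg (xi : 'CF(ktypeZ T)) :
  xi \is a linear_char ->
  (forall i, (i < size T)%N -> xi (block_cycle T i) = cycle_value T i) ->
  (forall i, swappable T i -> xi (block_swap T i) = ratr (swap_sign deg T i)) ->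
  is_xi deg xi.
Proof.
move=> xi_lin xi_cycle xi_swap.
have sC := ktypeC_sub T; have sN := ktypeN_sub T.
exists ('Res[ktypeC T] xi), ('Res[ktypeN T] xi); split.
(* The definition of phi contains the sign character; multiplying by it once more recovers the
   untwisted character. *)
- exists ('Res[ktypeC T] xi * sign_char (ktypeC T)); split.
  + by rewrite rpredM ?cfRes_lin_char ?sign_char_lin.
  + move=> i it; have cC := block_cycleC it.
    rewrite cfunE cfResE // sign_charE // xi_cycle // odd_block_cycle // signr_odd.
    by rewrite /cycle_value -mulrA -expr2 sqrr_sign mulr1.
  + move=> c cC; rewrite [in RHS]cfunE sign_charE // -mulrA -expr2 sqrr_sign mulr1 //.
- split=> [|i sw]; first exact: cfRes_lin_char.
  have it : (i < size T)%N by case/andP: sw => /ltnW.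
  have swN : block_swap T i \in ktypeN T.
    by apply/mem_gen/imsetP; exists (Ordinal it); rewrite ?inE.
  rewrite cfResE // xi_swap // /swap_sign.
  by case: ifP => _; rewrite rmorph_sign.
move=> c v cC vN; rewrite !cfResE // lin_charM //.
- exact: (subsetP sC).
- exact: (subsetP sN).
Qed.

Section Coordinates.

Variables (m b : nat) (H : falgType rat) (gr : nat -> {vspace H}).
Hypothesis H_cohomology : connected_PD_algebra m gr.
Variables (w : H) (x : 'I_b.+1 -> H) (deg : 'I_b.+1 -> nat).
Hypothesis x_basis : homogeneous_basis m gr w x deg.
Variable n : nat.
Hypothesis m_gt0 : (0 < m)%N.

Local Notation kriz := (kriz m n gr).
Local Notation kact := (@kact m n H gr).
Local Notation klabel := (klabel b).
Local Notation kmon := (@kmon m b H gr x n).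

Definition labelling : finType := {t : {ffun 'I_n -> klabel n} | admissible t}.

Lemma card_labelling : #|labelling| = \prod_(j < n) (b.+1 + j).
Proof.
pose F (j : 'I_n) := [pred l : klabel n | if l is inr a then (a < j)%N else true].
rewrite card_sig; transitivity #|family F|; first exact: eq_card.
rewrite card_family foldrE big_map big_enum /=; apply: eq_bigr => j _.
rewrite -sum1_card big_sumType /= sum1_card card_ord; congr addn.
rewrite -(big_ord_widen _ (fun=> 1%N)) ?sum1_card ?card_ord //; exact/ltnW.
Qed.

Implicit Types t : labelling.

Lemma labelling_admissible t : admissible (val t).
Proof. by case: t. Qed.

Lemma labelling_of (t : 'I_n -> klabel n) : admissible t ->
  exists t' : labelling, val t' =1 t.
Proof.
move=> ta; have ta' : admissible [ffun j => t j].
  by apply/forallP => j; rewrite ffunE; exact: (forallP ta j).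
by exists (exist (fun t : {ffun 'I_n -> klabel n} => admissible t) _ ta') => j /=; rewrite ffunE.
Qed.

Lemma kc_exists t0 : exists phi : kriz -> rat,
  (forall a e f, phi (a *: e + f) = a * phi e + phi f) /\
  forall t, phi (kmon (val t)) = (t == t0)%:R.
Proof.
have [phi [phi_lin phiE]] := kmon_dual H_cohomology x_basis m_gt0 (labelling_admissible t0).
exists phi; split=> // t; rewrite phiE; last exact: labelling_admissible.
congr (_ %:R); congr nat_of_bool; apply/forallP/eqP => [e|-> //].
by apply/val_inj/ffunP => j; apply/eqP.
Qed.

(* The coefficient of kmon (val t). *)
Definition kc t : kriz -> rat := sval (cid (kc_exists t)).

Lemma kc_lin t a e f : kc t (a *: e + f) = a * kc t e + kc t f.
Proof. by rewrite /kc; case: cid => phi []. Qed.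

Lemma kc_kmon t t' : kc t (kmon (val t')) = (t' == t)%:R.
Proof. by rewrite /kc; case: cid => phi []. Qed.

Lemma kc0 t : kc t 0 = 0.
Proof. by have := kc_lin t (-1) 0 0; rewrite scaler0 addr0 mulN1r addNr. Qed.

Lemma kcZ t a e : kc t (a *: e) = a * kc t e.
Proof. by rewrite -[a *: e]addr0 kc_lin kc0 addr0. Qed.

Lemma kc_sum t (I : finType) (P : pred I) (a : I -> rat) (F : I -> kriz) :
  kc t (\sum_(i | P i) a i *: F i) = \sum_(i | P i) a i * kc t (F i).
Proof.
elim/big_rec2: _ => [|i _ e _ <-]; first exact: kc0.
by rewrite kc_lin.
Qed.

Lemma kact_sum s (I : finType) (P : pred I) (a : I -> rat) (F : I -> kriz) :
  kact s (\sum_(i | P i) a i *: F i) = \sum_(i | P i) a i *: kact s (F i).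
Proof.
elim/big_rec2: _ => [|i _ e _ <-]; first exact: kact0.
by rewrite kact_lin.
Qed.

Lemma kc_expand e : e = \sum_t kc t e *: kmon (val t).
Proof.
have := lspan_kmon H_cohomology x_basis m_gt0 e; elim/lspan_ind => [|a f g ef eg|_ [t ta ->]].
- by rewrite big1 // => t _; rewrite kc0 scale0r.
- rewrite {1}ef {1}eg scaler_sumr -big_split; apply: eq_bigr => t _ /=.
  by rewrite kc_lin scalerDl scalerA.
have [t' t'E] := labelling_of ta.
have -> : kmon t = kmon (val t') by rewrite /kmon; apply: eq_bigr => j _; rewrite t'E.
rewrite (bigD1 t') //= kc_kmon eqxx scale1r big1 ?addr0 // => t1 ne.
by rewrite kc_kmon eq_sym (negPf ne) scale0r.
Qed.

Definition crow e : 'rV[rat]_#|labelling| := \row_i kc (enum_val i) e.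

Definition act_mx (s : 'S_n) : 'M[rat]_#|labelling| :=
  \matrix_i crow (kact s (kmon (val (enum_val i : labelling)))).

Lemma crow_act s e : crow (kact s e) = crow e *m act_mx s.
Proof.
apply/rowP => j; rewrite !mxE {1}(kc_expand e) kact_sum kc_sum.
rewrite (eq_bigl (fun t => t \in labelling)) // big_enum_val.
by apply: eq_bigr => i _; rewrite !mxE.
Qed.

Lemma act_repr : mx_repr [set: 'S_n] act_mx.
Proof.
split=> [|s s' _ _]; apply/row_matrixP => i.
  rewrite rowK (kact_id H_cohomology x_basis m_gt0); apply/rowP => j.
  by rewrite !mxE kc_kmon (inj_eq enum_val_inj).
by rewrite row_mul !rowK (kact_comp H_cohomology x_basis m_gt0) crow_act.
Qed.

Definition act_representation := MxRepresentation act_repr.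

Definition crowC e : 'rV[algC]_#|labelling| := map_mx ratr (crow e).

Lemma crowC_lin a e f : crowC (a *: e + f) = ratr a *: crowC e + crowC f.
Proof. by apply/rowP => i; rewrite !mxE kc_lin rmorphD rmorphM. Qed.

Lemma crowC_act s e :
  crowC (kact s e) = crowC e *m map_repr (@ratr algC) act_representation s.
Proof. by rewrite /crowC crow_act map_mxM. Qed.

End Coordinates.

Section Decomposition.

Variables (m b : nat) (H : falgType rat) (gr : nat -> {vspace H}).
Hypothesis H_cohomology : connected_PD_algebra m gr.
Variables (w : H) (x : 'I_b.+1 -> H) (deg : 'I_b.+1 -> nat).
Hypothesis x_basis : homogeneous_basis m gr w x deg.
Variable n : nat.
Hypothesis m_gt0 : (0 < m)%N.

Local Notation kriz := (kriz m n gr).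
Local Notation kact := (@kact m n H gr).
Local Notation kmon := (@kmon m b H gr x n).
Local Notation labelling := (labelling b n).
Local Notation kc := (@kc m b H gr H_cohomology w x deg x_basis n m_gt0).
Local Notation crowC := (@crowC m b H gr H_cohomology w x deg x_basis n m_gt0).
Local Notation rG := (map_repr (@ratr algC)
  (act_representation H_cohomology x_basis n m_gt0)).
Local Notation psi_lin := (@crowC_lin m b H gr H_cohomology w x deg x_basis n m_gt0).
Local Notation psi_act := (@crowC_act m b H gr H_cohomology w x deg x_basis n m_gt0).

Implicit Types (t : labelling) (T : ktype n b).

Lemma type_of_exists t : exists T, monomial_of_type x T (mon_marks (val t)) (mon_edges (val t)).
Proof. by apply: type_exists; apply: labelling_admissible. Qed.

(** A choice at this stage; that no other type is possible follows from the dimension count, in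
    [type_of_unique]. *)
Definition type_of t : ktype n b := sval (cid (type_of_exists t)).

Lemma type_ofP t : exists f, typed (val t) (T := type_of t) f.
Proof.
apply: (monomial_typed x_basis (labelling_admissible t)).
by rewrite /type_of; case: cid.
Qed.

Definition tvec T : 'rV[algC]_#|labelling| := type_vec x rG crowC T.
Definition tmod T : 'M[algC]_#|labelling| := cyclic_mx rG (tvec T).

Lemma tvec_stable T z : z \in ktypeZ T -> (tvec T *m rG z <= tvec T)%MS.
Proof. exact: (type_vec_stable x_basis m_gt0 psi_lin psi_act). Qed.

Lemma typed_tmod t T f : typed (val t) (T := T) f -> (crowC (kmon (val t)) <= tmod T)%MS.
Proof.
move/(kmon_typed x_basis m_gt0).
elim/lspan_ind => [|a e f' he hf|_ [s ->]].
- by rewrite (psi0 psi_lin) sub0mx.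
- by rewrite psi_lin addmx_sub ?scalemx_sub.
rewrite psi_act; apply: (mxmodule_trans (cyclic_mx_module rG _)); rewrite ?inE //.
exact: (forest_in_cyclic x_basis m_gt0 psi_lin psi_act).
Qed.

(** The coordinate projector onto the monomials whose chosen type is [T]. These projectors add up to
    the identity whatever choices were made, which is all the rank estimate asks of them. *)
Definition tproj T : 'M[algC]_#|labelling| :=
  diag_mx (\row_i (type_of (enum_val i) == T)%:R).

Lemma crowC_kmon i : crowC (kmon (val (enum_val i : labelling))) = delta_mx 0 i.
Proof.
apply/rowP => j; rewrite !mxE kc_kmon (inj_eq enum_val_inj) eqxx /= eq_sym.
by rewrite rmorph_nat.
Qed.

Lemma tproj_sub T : (tproj T <= tmod T)%MS.
Proof.
apply/row_subP => i; rewrite row_diag_mx mxE -crowC_kmon.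
case: eqP => [<-|_]; last by rewrite scale0r sub0mx.
by rewrite scale1r; have [f fT] := type_ofP (enum_val i); apply: typed_tmod fT.
Qed.

Lemma sum_tproj : \sum_T tproj T = 1%:M.
Proof.
apply/matrixP => i j; rewrite summxE (bigD1 (type_of (enum_val i))) //= big1 ?addr0.
  by rewrite !mxE eqxx.
by move=> T Ti; rewrite !mxE eq_sym (negPf Ti) mul0rn.
Qed.

Lemma rank_cyclic0 : \rank (cyclic_mx rG 0) = 0%N.
Proof. by rewrite [cyclic_mx rG 0](_ : _ = 0) ?mxrank0 //; apply/eqP; rewrite cyclic_mx_eq0. Qed.

(* The ranks of the projectors are at most the indices and add up to at least the dimension,
   which is at least the sum of the indices. *)
Lemma rank_tproj T : \rank (tproj T) = #|[set: 'S_n] : ktypeZ T|%g.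
Proof.
have le1 T' : (\rank (tproj T') <= \rank (tmod T') <= #|[set: 'S_n] : ktypeZ T'|%g)%N.
  rewrite mxrankS ?tproj_sub //=.
  have [v0|v0] := eqVneq (tvec T') 0; first by rewrite /tmod v0 rank_cyclic0.
  exact: (rank_cyclic_index (subsetT _) (@tvec_stable T') v0).
have le2 : (#|labelling| <= \sum_T' \rank (tproj T'))%N.
  rewrite -{1}(mxrank1 algC #|labelling|) -sum_tproj.
  elim/big_rec2: _ => [|T' r A _ IH]; first by rewrite mxrank0.
  by apply: leq_trans (mxrank_add _ _) _; rewrite leq_add2l.
have le3 : (\sum_(T' : ktype n b) #|[set: 'S_n] : ktypeZ T'|%g <= #|labelling|)%N.
  apply: leq_trans (sum_index_ktypeZ n b) _.
  by rewrite card_labelling -ffact_prod_addn mulnC bin_ffact.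
have le T' := leq_trans (andP (le1 T')).1 (andP (le1 T')).2.
have [le4 eq4] := leqif_sum (fun T' (_ : xpredT T') => leqif_eq (le T')).
have : (\sum_T' \rank (tproj T'))%N == (\sum_(T' : ktype n b) #|[set: 'S_n] : ktypeZ T'|%g)%N.
  by rewrite eqn_leq le4 (leq_trans le3 le2).
by rewrite eq4 => /forallP/(_ T)/eqP.
Qed.

(** The rank equals a group index and is therefore positive, while a zero vector would generate the
    zero module. *)
Lemma tvec_neq0 T : tvec T != 0.
Proof.
apply/eqP => v0; have := mxrankS (tproj_sub T).
by rewrite rank_tproj /tmod v0 rank_cyclic0 leqNgt indexg_gt0.
Qed.

Lemma rank_tmod T : (\rank (tmod T) <= #|[set: 'S_n] : ktypeZ T|%g)%N.
Proof. exact: (rank_cyclic_index (subsetT _) (@tvec_stable T) (tvec_neq0 T)). Qed.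

Lemma tproj_tmod T : (tproj T :=: tmod T)%MS.
Proof.
apply/eqmxP; rewrite tproj_sub /= -(geq_leqif (mxrank_leqif_sup (tproj_sub T))).
by rewrite rank_tproj rank_tmod.
Qed.

Definition type_char T : 'CF(ktypeZ T) :=
  line_char (subsetT _) (@tvec_stable T) (tvec_neq0 T).

Lemma type_char_is_xi T : is_xi deg (type_char T).
Proof.
apply: is_xi_intro => [|i it|i sw]; first exact: line_char_lin.
  apply: line_char_eq; first exact: (subsetP (ktypeC_sub T) _ (block_cycleC it)).
  exact: type_vec_cycle.
apply: line_char_eq; last exact: (type_vec_swap x_basis m_gt0 psi_lin psi_act).
have it : (i < size T)%N by case/andP: sw => /ltnW.
by apply/(subsetP (ktypeN_sub T))/mem_gen/imsetP; exists (Ordinal it); rewrite ?inE.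
Qed.

Lemma tproj_idem T : tproj T *m tproj T = tproj T.
Proof.
apply/matrixP => i j; rewrite mul_diag_mx !mxE.
by case: (_ == T); rewrite ?mul1r ?mul0r ?mul0rn.
Qed.

Lemma trace_tproj T s : \tr (tproj T *m rG s) = 'Ind[[set: 'S_n]] (type_char T) s.
Proof.
apply: trace_induced; rewrite ?inE //; [exact: tproj_idem | exact: tproj_tmod | exact: rank_tproj].
Qed.

Lemma trace_tprojE T s : \tr (tproj T *m rG s) =
  \sum_(t | type_of t == T) ratr (kc t (kact s (kmon (val t)))).
Proof.
rewrite /mxtrace [RHS]big_mkcond /=.
rewrite [RHS](eq_bigl (fun t => t \in labelling)) // [RHS]big_enum_val.
apply: eq_bigr => i _; rewrite mul_diag_mx !mxE.
by case: eqP => _; rewrite ?mul1r ?mul0r.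
Qed.

Lemma tmod_kc t e T : (crowC e <= tmod T)%MS -> type_of t != T -> kc t e = 0.
Proof.
rewrite -tproj_tmod => /submxP[Y eY] tT.
have := congr1 (fun A : 'rV_#|labelling| => A 0 (enum_rank t)) eY.
rewrite mul_mx_diag !mxE enum_rankK (negPf tT) mulr0 => /eqP.
by rewrite fmorph_eq0 => /eqP.
Qed.

(** Stability of E(T) under permutations: the translate stays in K_T, which by the equality of ranks
    has only coordinates of type [T]. *)
Lemma kc_act_type t t' s : type_of t' != type_of t -> kc t' (kact s (kmon (val t))) = 0.
Proof.
apply: tmod_kc; have [f fT] := type_ofP t; rewrite psi_act.
by apply: (mxmodule_trans (cyclic_mx_module rG _)); rewrite ?inE // (typed_tmod fT).
Qed.

(** A monomial of type [T] lies in K_T, where coordinates of other types vanish, but its own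
    coordinate is 1. *)
Lemma type_of_unique t T f : typed (val t) (T := T) f -> type_of t = T.
Proof.
move/typed_tmod/(tmod_kc (t := t)); have [//|_ /(_ isT)/eqP] := eqVneq.
by rewrite kc_kmon eqxx oner_eq0.
Qed.

(** One statement for all three claims: [P] selects a single type, the types of a given bidegree, or
    every type. The representation is rational, and its trace is split according to the type of the
    basis monomial. *)
Lemma coordinate_character (P : pred (ktype n b)) (U : kriz -> Prop) :
  (forall e, U e <-> forall t, ~~ P (type_of t) -> kc t e = 0) ->
  has_character kact U (\sum_(T | P T) 'Ind[[set: 'S_n]] (type_char T)).
Proof.
move=> UP; pose A := [set t : labelling | P (type_of t)].
pose el (i : 'I_#|A|) : kriz := kmon (val (enum_val i)).
have kc_el i j : kc (enum_val i) (el j) = (j == i)%:R.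
  by rewrite kc_kmon (inj_eq enum_val_inj).
have expand u : U u -> u = \sum_i kc (enum_val i) u *: el i.
  move/UP => u0; rewrite {1}(kc_expand H_cohomology x_basis m_gt0 u) (bigID (mem A)) /=.
  have -> : \sum_(t | t \notin A) kc t u *: kmon (val t) = 0.
    by apply: big1 => t; rewrite inE => /u0 ->; rewrite scale0r.
  by rewrite addr0 big_enum_val.
have U_act s i : U (kact s (el i)).
  apply/UP => t tP; apply: kc_act_type; apply: contraNneq tP => ->.
  by have := enum_valP i; rewrite inE.
pose rs s : 'M[rat]_#|A| := \matrix_(i, j) kc (enum_val j) (kact s (el i)).
have rs_act s i : kact s (el i) = \sum_j rs s i j *: el j.
  by rewrite {1}(expand _ (U_act s i)); apply: eq_bigr => j _; rewrite mxE.
have rs_repr : mx_repr [set: 'S_n] rs.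
  split=> [|s s' _ _]; apply/matrixP => i j; rewrite !mxE.
    by rewrite (kact_id H_cohomology x_basis m_gt0) kc_el.
  rewrite (kact_comp H_cohomology x_basis m_gt0) rs_act kact_sum // kc_sum.
  by apply: eq_bigr => k _; rewrite !mxE.
exists #|A|, el, (MxRepresentation rs_repr); split=> //.
  split=> [u|c c0 i].
    split=> [/expand ->|[c ->]]; first by exists (fun i => kc (enum_val i) u).
    apply/UP => t tP; rewrite kc_sum big1 // => i _; rewrite kc_kmon.
    case: eqP => [it|_]; last exact: mulr0.
    by have := enum_valP i; rewrite inE it (negPf tP).
  have := congr1 (kc (enum_val i)) c0; rewrite kc0 kc_sum (bigD1 i) //= kc_el eqxx mulr1.
  by rewrite big1 ?addr0 // => j /negPf ji; rewrite kc_el ji mulr0.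
apply/cfun_inP => s _; rewrite sum_cfunE cfunE inE mulr1n.
transitivity (\sum_(t | P (type_of t)) ratr (kc t (kact s (kmon (val t)))) : algC).
  rewrite (partition_big type_of P) //=; apply: eq_bigr => T PT.
  rewrite -trace_tproj trace_tprojE; apply: eq_bigl => t.
  by case: eqP => [->|]; rewrite ?PT ?andbF.
rewrite (eq_bigl (fun t => t \in A)) => [|t]; last by rewrite inE.
by rewrite big_enum_val; apply: eq_bigr => i _; rewrite !mxE.
Qed.

End Decomposition.

(** * The subspaces E(L, H) and E_q^k in coordinates *)

Section Parts.

Variables (m b : nat) (H : falgType rat) (gr : nat -> {vspace H}).
Hypothesis H_cohomology : connected_PD_algebra m gr.
Variables (w : H) (x : 'I_b.+1 -> H) (deg : 'I_b.+1 -> nat).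
Hypothesis x_basis : homogeneous_basis m gr w x deg.
Variable n : nat.
Hypothesis m_gt0 : (0 < m)%N.

Local Notation kriz := (kriz m n gr).
Local Notation kmon := (@kmon m b H gr x n).
Local Notation khom := (@khom m H gr n).
Local Notation labelling := (labelling b n).
Local Notation kc := (@kc m b H gr H_cohomology w x deg x_basis n m_gt0).
Local Notation type_of := (@type_of b H x n).
Local Notation kmonomial := (@kmonomial m n b H gr x).

Implicit Types (t : labelling) (T : ktype n b).

Lemma kc_lspan (S : kriz -> Prop) e t : (forall f, S f -> kc t f = 0) -> lspan S e -> kc t e = 0.
Proof.
move=> S0; elim/lspan_ind => [|a f g f0 g0|]; [exact: kc0 | | exact: S0].
by rewrite kc_lin f0 g0 mulr0 addr0.
Qed.

Lemma lspan_kc (S : kriz -> Prop) e :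
  (forall t, kc t e = 0 \/ lspan S (kmonomial (mon_marks (val t)) (mon_edges (val t)))) ->
  lspan S e.
Proof.
move=> tS; rewrite (kc_expand H_cohomology x_basis m_gt0 e); apply: lspan_sum => t _ _.
have [->|St] := tS t; first by rewrite scale0r; apply: lspan0.
apply: lspanZ; have [k kE] := kmonomial_kmon x_basis (val t).
have -> : kmon (val t) = (-1) ^+ k *: kmonomial (mon_marks (val t)) (mon_edges (val t)).
  by rewrite kE scalerA -expr2 sqrr_sign scale1r.
exact: lspanZ.
Qed.

Lemma kriz_typeP T e :
  kriz_type x T e <-> forall t, ~~ (type_of t == T) -> kc t e = 0.
Proof.
split=> [eT t tT|e0].
  apply: kc_lspan eT => _ [a [r [ar aT ->]]].
  have [t' [t'a aE rE]] := canonical_label x_basis ar.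
  have [t1 t1E] := labelling_of t'a.
  have {aE} aE : a = mon_marks t' by apply: funext.
  have {t1E} t1E : t' = val t1 by apply: funext.
  rewrite {}rE {}aE {t'a} t1E in aT *.
  have [f fT] := monomial_typed x_basis (labelling_admissible t1) aT.
  have t1T := type_of_unique H_cohomology x_basis m_gt0 fT.
  have [k ->] := kmonomial_kmon x_basis (val t1).
  rewrite kcZ kc_kmon; case: eqP => [t1t|_]; last exact: mulr0.
  by rewrite -t1t t1T eqxx in tT.
apply: lspan_kc => t; have [tT|/e0] := boolP (type_of t == T); [right | by left].
apply: lspan_base; exists (mon_marks (val t)), (mon_edges (val t)); split=> //.
  exact: (mon_canonical x_basis (labelling_admissible t)).
by move/eqP: tT => <-; rewrite /type_of; case: cid.
Qed.

Definition type_bidegree (q k : nat) T :=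
  (ktype_q T == q) && (ktype_deg T deg + q * (2 * m - 1) == k)%N.

Lemma type_of_bidegree t q k : mon_bidegree m deg (val t) q k <-> type_bidegree q k (type_of t).
Proof.
have [f fT] := type_ofP x_basis t; have [e1 e2] := typed_bidegree m deg fT.
rewrite /mon_bidegree e1 e2 /type_bidegree; split=> [[-> <-]|/andP[/eqP <- /eqP <-]] //.
by rewrite !eqxx.
Qed.

Lemma khom_prod_sum (F : 'I_n -> kriz) d : (forall i, khom 0 (d i) (F i)) ->
  khom 0 (\sum_i d i) (\prod_i F i).
Proof.
move=> Fd; elim/big_rec2: _ => [|i e k _]; first exact: khom1.
exact: khomM (Fd i).
Qed.

Lemma khom_edges (r : seq ('I_n * 'I_n)) :
  khom (size r) (size r * (2 * m - 1)) (\prod_(g <- r) kG m gr g.1 g.2).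
Proof.
elim: r => [|g r IH]; first by rewrite big_nil; apply: khom1.
by rewrite big_cons mulSn; apply: khomM (khom_kG _ _ _ _) IH.
Qed.

Lemma size_mon_edges (t : 'I_n -> klabel b n) : size (mon_edges t) = \sum_j label_q (t j).
Proof.
rewrite /mon_edges -big_enum /=; elim: (enum 'I_n) => [|j s IH]; first by rewrite big_nil.
by rewrite big_cons /=; case: (t j) => [h|a] /=; rewrite IH.
Qed.

Lemma mon_marks_deg (t : 'I_n -> klabel b n) :
  (\sum_j deg (mon_marks t j) + (\sum_j label_q (t j)) * (2 * m - 1) =
   \sum_j label_deg m deg (t j))%N.
Proof.
rewrite big_distrl -big_split; apply: eq_bigr => j _; rewrite /mon_marks /=.
case: (t j) => [h|a] /=; first by rewrite mul0n addn0.
by rewrite (deg0 H_cohomology x_basis) mul1n.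
Qed.

(** Reduction to canonical monomials preserves the bidegree, so a homogeneous product involves only
    monomials of its own bidegree, and the bidegree of a monomial depends only on its type. *)
Lemma kriz_partP q k e :
  kriz_part q k e <-> forall t, ~~ type_bidegree q k (type_of t) -> kc t e = 0.
Proof.
split=> [eqk t tqk|e0].
  apply: kc_lspan eqk => _ [y [d [r [yd rq dk ->]]]].
  have := khomM (khom_prod_sum (fun i => khom_kP m i (yd i))) (khom_edges r).
  rewrite add0n rq dk => /(khom_lspan H_cohomology x_basis m_gt0).
  apply: kc_lspan => _ [t' [t'a t'qk ->]].
  have [t1 t1E] := labelling_of t'a.
  have {t1E} t1E : t' = val t1 by apply: funext.
  rewrite {}t1E in t'qk *.
  rewrite kc_kmon; case: eqP => // t1t; case/negP: tqk.
  by rewrite -t1t; apply/type_of_bidegree.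
apply: lspan_kc => t; have [tqk|/e0] := boolP (type_bidegree q k (type_of t)); [right | by left].
have [tq tk] := (type_of_bidegree t q k).2 tqk.
apply: lspan_base; exists (fun j => x (mon_marks (val t) j)), (fun j => deg (mon_marks (val t) j)).
exists (mon_edges (val t)); split=> //; first by move=> i; apply: (hb_homog x_basis).
  by rewrite size_mon_edges.
by rewrite -tk -tq mon_marks_deg.
Qed.

End Parts.

Theorem theorem3p15 (m n b : nat) (m_gt0 : (0 < m)%N) (n_gt0 : (0 < n)%N)
    (H : falgType rat) (gr : nat -> {vspace H})
    (H_cohomology : connected_PD_algebra m gr)
    (w : H) (x : 'I_b.+1 -> H) (deg : 'I_b.+1 -> nat)
    (x_basis : homogeneous_basis m gr w x deg) :
  exists xi : forall T : ktype n b, 'CF(ktypeZ T),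
    (forall T : ktype n b, is_xi deg (xi T)) /\
    [/\ forall T : ktype n b,
          has_character (@kact m n H gr) (@kriz_type m n b H gr x T)
            ('Ind[[set: 'S_n]] (xi T)),
        forall q k : nat,
          has_character (@kact m n H gr) (@kriz_part m n H gr q k)
            (\sum_(T : ktype n b |
                (ktype_q T == q) && (ktype_deg T deg + q * (2 * m - 1) == k)%N)
               'Ind[[set: 'S_n]] (xi T))
      & has_character (@kact m n H gr) (fun _ : kriz m n gr => True)
          (\sum_(T : ktype n b) 'Ind[[set: 'S_n]] (xi T))].
Proof.
exists (type_char H_cohomology x_basis m_gt0); split; first exact: type_char_is_xi.
split=> [T|q k|].
- rewrite -(big_pred1_eq +%R T (fun T => 'Ind[[set: 'S_n]] (type_char H_cohomology x_basis m_gt0 T))).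
  apply: coordinate_character => e; exact: kriz_typeP.
- by apply: coordinate_character => e; exact: kriz_partP.
by apply: coordinate_character.
Qed.
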